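(* Let $n\ge1$, let $M\subset\mathbb R^n$ be a closed subset with the metric inherited from the Euclidean metric, with reach $\tau_M$, and let $f\colon M\to\mathbb R^N$ be Lipschitz with Lipschitz constant $L_f$ (with respect to the $\infty$-norm on $\mathbb R^N$). Let $0<\delta\le\frac{1-\mathcal J_n}{(1+\mathcal J_n)\mathcal J_n}\tau_M$ and fix $\rho$ with $\delta\le\rho<\frac{1-\mathcal J_n}{\mathcal J_n}\tau_M$. Let $\epsilon_{\mathrm{met}}\ge0$ satisfy $$\epsilon_{\mathrm{met}}\le\rho-\delta\quad\text{and}\quad\epsilon_{\mathrm{met}}\le\frac{1-\mathcal E^{\rho}_{\tau_M}\mathcal J_n}{1+\mathcal E^{\rho}_{\tau_M}\mathcal J_n}\,\delta,$$ and let $\epsilon_{\mathrm{fun}}\ge0$. Let $\mathbb M$ be a metric space with a (not necessarily continuous) function $\mathbb f\colon\mathbb M\to\mathbb R^N$. Then any $(\epsilon_{\mathrm{met}},\epsilon_{\mathrm{fun}})$-correspondence between $(\mathbb M,\mathbb f)$ and $(M,f)$ induces an interleaving $$\mathcal R^\delta(\mathbb M^\bullet)\simeq_{\mathcal E^\delta_{\tau_M}L_f\,\mathcal J_n\,\delta+\mathcal E^{\rho_n}_{\tau_M}L_f\,\mathcal L_n\,\epsilon_{\mathrm{met}}+\epsilon_{\mathrm{fun}}}M^\bullet,\qquad\rho_n:=\frac{\rho}{1-\mathcal J_n},$$ in the persistent homotopy category $\mathrm{ho}(\mathrm{Top}^{\mathbb R^N})$ (i.e. whenever such a correspondence exists,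 such an interleaving exists).
   Context: Constants. $\mathcal J_n:=\sqrt{\frac{n}{2(n+1)}}$; $\mathcal L_n:=\frac{2\mathcal J_n}{1-\mathcal J_n}$. The reach $\tau_M\in[0,\infty]$ of a closed $M\subset\mathbb R^n$ is the supremum of all $\tau\ge0$ such that for every $x\in\mathbb R^n$ with $d(x,M)<\tau$ the function $M\to\mathbb R$, $y\mapsto d(x,y)$ has a unique minimizer. For $0\le r<\tau_M/\mathcal J_n$, $\mathcal E^r_{\tau_M}:=\left(1-\mathcal J_n\frac{r}{\tau_M}\right)^{-1}$, read as $1$ if $\tau_M=\infty$ or $r=0$. Persistent homotopy. $N\ge0$; $\mathbb R^N$ carries the componentwise partial order and is viewed as a category. $\mathrm{ho}(\mathrm{Top}^{\mathbb R^N})$ is the localization of the category of functors $\mathbb R^N\to\mathrm{Top}$ at the objectwise weak homotopy equivalences. $F^{\bullet+\varepsilon}$ is the precomposition of $F^\bullet$ with $u\mapsto u+(\varepsilon,\dots,\varepsilon)$, and $s$ denotes structure maps $F^\bullet\to F^{\bullet+\varepsilon}$. An $\varepsilon$-interleaving $F^\bullet\simeq_\varepsilon G^\bullet$ in the persistent homotopy category consists of morphisms $\varphi\colon F^\bullet\to G^{\bullet+\varepsilon}$, $\psi\colon G^\bullet\to F^{\bullet+\varepsilon}$ in $\mathrm{ho}(\mathrm{Top}^{\mathbb R^N})$ with $\psi^{+\varepsilon}\circ\varphi=s$ and $\varphi^{+\varepsilon}\circ\psi=s$ there. For a metric space $X$ with function $g\colon X\to\mathbb R^N$, $X^\bullet$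 is the functor $u\mapsto X^u=\{x\mid g(x)\le u\}$ (subspace topology, inclusions). $\mathcal R^\delta(X)$ is the simplicial complex of finite nonempty subsets of $X$ with all pairwise distances (including $d(x,x)=0$) $<\delta$; $\mathcal R^\delta(X^\bullet)$ is the functor $u\mapsto\mathcal R^\delta(X^u)$, regarded as space-valued via geometric realization. Correspondences. An $(\epsilon_{\mathrm{met}},\epsilon_{\mathrm{fun}})$-correspondence between $(\mathbb M_0,\mathbb f_0)$ and $(\mathbb M_1,\mathbb f_1)$ is a subset $\mathfrak C\subset\mathbb M_0\times\mathbb M_1$ projecting onto both factors with $|d(x,x')-d(y,y')|\le\epsilon_{\mathrm{met}}$ for all $(x,y),(x',y')\in\mathfrak C$ and $\|\mathbb f_0(x)-\mathbb f_1(y)\|_\infty\le\epsilon_{\mathrm{fun}}$ for all $(x,y)\in\mathfrak C$. *)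

(* Defs.v *)
From HB Require Import structures.
From mathcomp Require Import all_boot all_order all_algebra finmap.
From mathcomp Require Import all_classical all_reals all_analysis.

Set Implicit Arguments.
Unset Strict Implicit.
Unset Printing Implicit Defensive.

Import Order.TTheory GRing.Theory Num.Theory numFieldNormedType.Exports.

Local Open Scope classical_set_scope.
Local Open Scope ring_scope.

(* The library norm [`|x|] on ['rV[R]_n] is the infinity norm; it induces the
   same topology as the Euclidean distance. *)
Definition eucl (R : realType) (n : nat) (x y : 'rV[R]_n) : R :=
  Num.sqrt (\sum_(i < n) (x ord0 i - y ord0 i) ^+ 2).

Definition dist_to (R : realType) (n : nat) (M : set 'rV[R]_n) (x : 'rV[R]_n)
    : \bar R :=
  ereal_inf [set (eucl x y)%:E | y in M].

Definition reach (R : realType) (n : nat) (M : set 'rV[R]_n) : \bar R :=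
  ereal_sup [set t%:E | t in [set t : R | 0 <= t /\
    forall x, (dist_to M x < t%:E)%E ->
      exists! y, M y /\ forall z, M z -> eucl x y <= eucl x z]].

Definition Jconst (R : realType) (n : nat) : R :=
  Num.sqrt (n%:R / (2 * (n.+1)%:R)).

Definition Lconst (R : realType) (n : nat) : R := 2 * Jconst R n / (1 - Jconst R n).

(* For finite [tau] and [r = 0] the formula gives [1], also when [tau = 0]. *)
Definition Efactor (R : realType) (n : nat) (tau : \bar R) (r : R) : R :=
  if tau is t%:E then (1 - Jconst R n * (r / t))^-1 else 1.

Definition unit_interval (R : realType) : set R := [set t | 0 <= t <= 1].
Arguments unit_interval : clear implicits.

Definition cube (R : realType) (n : nat) : set 'rV[R]_n :=
  [set t | forall i, 0 <= t ord0 i <= 1].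
Arguments cube : clear implicits.

Definition cube_boundary (R : realType) (n : nat) : set (cube R n) :=
  [set t : cube R n | exists i, (set_val t) ord0 i = 0 \/ (set_val t) ord0 i = 1].

Definition homotopic_rel (R : realType) (X Y : topologicalType) (A : set X)
    (f g : X -> Y) : Prop :=
  exists H : X * unit_interval R -> Y,
    [/\ continuous H,
        forall x t, set_val t = 0 -> H (x, t) = f x,
        forall x t, set_val t = 1 -> H (x, t) = g x
      & forall x t, A x -> H (x, t) = f x].

(* A representative of an element of the [n]-th homotopy group at [x]. *)
Definition nloop (R : realType) (n : nat) (X : topologicalType) (x : X)
    (c : cube R n -> X) : Prop :=
  continuous c /\ forall t, cube_boundary t -> c t = x.

Definition path_connected_points (R : realType) (X : topologicalType)
    (x y : X) : Prop :=
  exists c : unit_interval R -> X,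
    [/\ continuous c, forall t, set_val t = 0 -> c t = x
      & forall t, set_val t = 1 -> c t = y].

Definition pi0_bijective (R : realType) (X Y : topologicalType) (f : X -> Y)
    : Prop :=
  (forall x x', path_connected_points R (f x) (f x') ->
     path_connected_points R x x') /\
  (forall y, exists x, path_connected_points R (f x) y).

(* The map induced by [f] from the [n]-th homotopy group of [X] at [x] to that
   of [Y] at [f x] is a group homomorphism for [n > 0], so that it is an
   isomorphism exactly when it is bijective. *)
Definition pi_bijective (R : realType) (n : nat) (X Y : topologicalType)
    (f : X -> Y) (x : X) : Prop :=
  (forall a b : cube R n -> X, nloop x a -> nloop x b ->
     homotopic_rel R (@cube_boundary R n) (f \o a) (f \o b) ->
     homotopic_rel R (@cube_boundary R n) a b) /\
  (forall c : cube R n -> Y, nloop (f x) c ->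
     exists2 a : cube R n -> X, nloop x a &
       homotopic_rel R (@cube_boundary R n) (f \o a) c).

Definition weak_equiv (R : realType) (X Y : topologicalType) (f : X -> Y)
    : Prop :=
  [/\ continuous f, pi0_bijective R f
    & forall n x, (0 < n)%N -> pi_bijective R n f x].

Definition lev (R : realType) (N : nat) (u v : 'rV[R]_N) : Prop :=
  forall i, u ord0 i <= v ord0 i.

Record pspace (R : realType) (N : nat) := PSpace {
  pobj :> 'rV[R]_N -> topologicalType ;
  pmap : forall u v, lev u v -> pobj u -> pobj v ;
  pmap_cont : forall u v (h : lev u v), continuous (pmap h) ;
  pmap_id : forall u (h : lev u u) x, pmap h x = x ;
  pmap_comp : forall u v w (huv : lev u v) (hvw : lev v w) (huw : lev u w) x,
    pmap hvw (pmap huv x) = pmap huw x }.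
Arguments pmap_cont {R N} p {u v} h.

Record pmor (R : realType) (N : nat) (F G : pspace R N) := PMor {
  pcomp :> forall u, F u -> G u ;
  pcomp_cont : forall u, continuous (@pcomp u) ;
  pcomp_nat : forall u v (h : lev u v) (x : F u),
    @pcomp v (pmap h x) = pmap h (@pcomp u x) }.
Arguments pcomp {R N F G} _ u _.
Arguments pcomp_cont {R N F G} _ u.
Arguments pcomp_nat {R N F G} _ {u v} h x.

Lemma pmor_ext (R : realType) (N : nat) (F G : pspace R N) (f g : pmor F G) :
  (forall u x, f u x = g u x) -> f = g.
Proof.
case: f g => [f f1 f2] [g g1 g2] /= fg.
have fgE : f = g by apply: functional_extensionality_dep => u; apply/funext.
by case: _ / fgE in g1 g2 fg *; congr PMor; apply: Prop_irrelevance.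
Qed.

Definition pmor_id (R : realType) (N : nat) (F : pspace R N) : pmor F F.
Proof. by exists (fun u x => x) => // u x. Defined.

Definition pmor_comp (R : realType) (N : nat) (F G H : pspace R N)
  (g : pmor G H) (f : pmor F G) : pmor F H.
Proof.
exists (fun u x => g u (f u x)).
- by move=> u x; apply: continuous_comp; apply: pcomp_cont.
- by move=> u v h x; rewrite !pcomp_nat.
Defined.

Definition pweak_equiv (R : realType) (N : nat) (F G : pspace R N)
    (f : pmor F G) : Prop :=
  forall u, weak_equiv R (f u).

Lemma lev_shift (R : realType) (N : nat) (e : R) (u v : 'rV[R]_N) :
  lev u v -> lev (u + const_mx e) (v + const_mx e).
Proof. by move=> h i; rewrite !mxE lerD2r. Qed.

Lemma lev_add (R : realType) (N : nat) (e : R) (u : 'rV[R]_N) :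
  0 <= e -> lev u (u + const_mx e).
Proof. by move=> h i; rewrite !mxE lerDl. Qed.

Definition pshift (R : realType) (N : nat) (e : R) (F : pspace R N)
  : pspace R N.
Proof.
exists (fun u => F (u + const_mx e)) (fun u v h => pmap (lev_shift e h)).
- by move=> u v h; apply: pmap_cont.
- by move=> u h x; apply: pmap_id.
- by move=> u v w h1 h2 h3 x; apply: pmap_comp.
Defined.

Definition pshift_mor (R : realType) (N : nat) (e : R) (F G : pspace R N)
  (f : pmor F G) : pmor (pshift e F) (pshift e G).
Proof.
exists (fun u => f (u + const_mx e)).
- by move=> u; exact: (pcomp_cont f (u + const_mx e)).
- by move=> u v h x; exact: (pcomp_nat f (lev_shift e h)).
Defined.

Definition pstruct (R : realType) (N : nat) (e : R) (he : 0 <= e)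
  (F : pspace R N) : pmor F (pshift e F).
Proof.
exists (fun u => pmap (lev_add u he)).
- by move=> u; apply: pmap_cont.
- move=> u v h x /=.
  have h' : lev u (v + const_mx e).
    by move=> i; apply: le_trans (h i) (lev_add v he i).
  by rewrite !(pmap_comp _ _ h').
Defined.

Lemma pweak_equiv_shift (R : realType) (N : nat) (e : R) (F G : pspace R N)
  (f : pmor F G) : pweak_equiv f -> pweak_equiv (pshift_mor e f).
Proof. by move=> hf u; apply: hf. Qed.

(* Localization at the objectwise weak equivalences by generators and
   relations: a morphism is a formal composite of morphisms and of formal
   inverses of weak equivalences, taken up to [ho_eq]. *)

Inductive ho_hom (R : realType) (N : nat)
    : pspace R N -> pspace R N -> Type :=
| ho_map F G : pmor F G -> ho_hom F G
| ho_inv F G (w : pmor F G) : pweak_equiv w -> ho_hom G F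
| ho_comp F G H : ho_hom G H -> ho_hom F G -> ho_hom F H.

Inductive ho_eq (R : realType) (N : nat)
    : forall F G : pspace R N, ho_hom F G -> ho_hom F G -> Prop :=
| ho_refl F G (a : ho_hom F G) : ho_eq a a
| ho_sym F G (a b : ho_hom F G) : ho_eq a b -> ho_eq b a
| ho_trans F G (a b c : ho_hom F G) : ho_eq a b -> ho_eq b c -> ho_eq a c
| ho_congr F G H (b b' : ho_hom G H) (a a' : ho_hom F G) :
    ho_eq b b' -> ho_eq a a' -> ho_eq (ho_comp b a) (ho_comp b' a')
| ho_assoc F G H K (c : ho_hom H K) (b : ho_hom G H) (a : ho_hom F G) :
    ho_eq (ho_comp c (ho_comp b a)) (ho_comp (ho_comp c b) a)
| ho_idl F G (a : ho_hom F G) : ho_eq (ho_comp (ho_map (pmor_id G)) a) a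
| ho_idr F G (a : ho_hom F G) : ho_eq (ho_comp a (ho_map (pmor_id F))) a
| ho_map_comp F G H (g : pmor G H) (f : pmor F G) :
    ho_eq (ho_comp (ho_map g) (ho_map f)) (ho_map (pmor_comp g f))
| ho_invl F G (w : pmor F G) (hw : pweak_equiv w) :
    ho_eq (ho_comp (ho_inv hw) (ho_map w)) (ho_map (pmor_id F))
| ho_invr F G (w : pmor F G) (hw : pweak_equiv w) :
    ho_eq (ho_comp (ho_map w) (ho_inv hw)) (ho_map (pmor_id G)).

Fixpoint ho_shift (R : realType) (N : nat) (e : R) (F G : pspace R N)
    (a : ho_hom F G) : ho_hom (pshift e F) (pshift e G) :=
  match a in ho_hom F G return ho_hom (pshift e F) (pshift e G) with
  | ho_map _ _ f => ho_map (pshift_mor e f)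
  | ho_inv _ _ _ hw => ho_inv (pweak_equiv_shift e hw)
  | ho_comp _ _ _ b a => ho_comp (ho_shift e b) (ho_shift e a)
  end.

Lemma ho_shift_eq (R : realType) (N : nat) (e : R) (F G : pspace R N)
  (a b : ho_hom F G) : ho_eq a b -> ho_eq (ho_shift e a) (ho_shift e b).
Proof.
have idE K : pshift_mor e (pmor_id K) = pmor_id (pshift e K) by exact: pmor_ext.
elim=> {F G a b} /=.
- by move=> F G a; apply: ho_refl.
- by move=> F G a b _; apply: ho_sym.
- by move=> F G a b c _ ab _; apply: ho_trans.
- by move=> F G H b b' a a' _ hb _ ha; apply: ho_congr.
- by move=> F G H K c b a; apply: ho_assoc.
- by move=> F G a; rewrite idE; apply: ho_idl.
- by move=> F G a; rewrite idE; apply: ho_idr.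
- move=> F G H g f.
  have -> : pshift_mor e (pmor_comp g f) =
            pmor_comp (pshift_mor e g) (pshift_mor e f) by exact: pmor_ext.
  exact: ho_map_comp.
- by move=> F G w hw; rewrite idE; apply: ho_invl.
- by move=> F G w hw; rewrite idE; apply: ho_invr.
Qed.

Definition pstruct2 (R : realType) (N : nat) (e : R) (he : 0 <= e)
    (F : pspace R N) : pmor F (pshift e (pshift e F)) :=
  pmor_comp (pstruct he (pshift e F)) (pstruct he F).

Definition interleaved (R : realType) (N : nat) (e : R) (F G : pspace R N)
    : Prop :=
  exists (he : 0 <= e)
         (phi : ho_hom F (pshift e G)) (psi : ho_hom G (pshift e F)),
    ho_eq (ho_comp (ho_shift e psi) phi) (ho_map (pstruct2 he F)) /\
    ho_eq (ho_comp (ho_shift e phi) psi) (ho_map (pstruct2 he G)).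

Definition sublevel (R : realType) (N : nat) (X : Type) (g : X -> 'rV[R]_N)
    (u : 'rV[R]_N) : set X :=
  [set x | lev (g x) u].

Lemma sublevelS (R : realType) (N : nat) (X : Type) (g : X -> 'rV[R]_N)
  (u v : 'rV[R]_N) : lev u v -> sublevel g u `<=` sublevel g v.
Proof. by move=> h x gx i; apply: le_trans (gx i) (h i). Qed.

Definition set_incl (X : Type) (A B : set X) (h : A `<=` B) (x : A) : B :=
  exist _ (val x) (mem_set (h _ (set_mem (valP x)))).

Lemma set_incl_continuous (X : topologicalType) (A B : set X) (h : A `<=` B) :
  continuous (set_incl h).
Proof.
apply: (@continuous_comp_initial _ _ _ (set_val : B -> X)).
exact: (@initial_continuous A X set_val).
Qed.

Definition sublevel_pspace (R : realType) (N : nat) (X : topologicalType)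
  (g : X -> 'rV[R]_N) : pspace R N.
Proof.
exists (fun u => (sublevel g u : Type) : topologicalType)
       (fun u v h => set_incl (sublevelS h)).
- by move=> u v h; apply: set_incl_continuous.
- by move=> u h x; apply: val_inj.
- by move=> u v w h1 h2 h3 x; apply: val_inj.
Defined.

Local Open Scope fset_scope.

Record simplicial_complex (V : choiceType) := SimplicialComplex {
  simplex : set {fset V} ;
  simplex_neq0 : forall s, simplex s -> s != fset0 ;
  simplex_face : forall s t, simplex s -> t `<=` s -> t != fset0 ->
    simplex t }.

Definition realization (R : realType) (V : choiceType)
    (K : simplicial_complex V) : Type :=
  [set w : {fsfun V -> R with 0} |
    [/\ simplex K (finsupp w), forall v, 0 <= w v
      & \sum_(v <- finsupp w) w v = 1]].

HB.instance Definition _ (R : realType) (V : choiceType)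
    (K : simplicial_complex V) :=
  Choice.on (realization R K).

(* The weak (coherent) topology: [U] is open when its trace on every closed
   simplex [s] is open for the Euclidean topology of that simplex. *)
Definition realization_open (R : realType) (V : choiceType)
    (K : simplicial_complex V) : set_system (realization R K) :=
  [set U | forall s, simplex K s -> forall w, U w -> finsupp (val w) `<=` s ->
    exists2 e : R, 0 < e & forall w', finsupp (val w') `<=` s ->
      (forall v, `|(val w) v - (val w') v| < e) -> U w'].

Lemma realization_openT (R : realType) (V : choiceType)
  (K : simplicial_complex V) : @realization_open R V K setT.
Proof. by move=> s Ks w _ _; exists 1. Qed.

Lemma realization_openI (R : realType) (V : choiceType)
  (K : simplicial_complex V) : setI_closed (@realization_open R V K).
Proof.
move=> A B oA oB s Ks w [Aw Bw] ws.
have [a a0 ha] := oA s Ks w Aw ws; have [b b0 hb] := oB s Ks w Bw ws.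
exists (Num.min a b); first by rewrite lt_min a0.
move=> w' w's h; split; [apply: ha => // v|apply: hb => // v];
  by have := h v; rewrite lt_min => /andP[].
Qed.

Lemma realization_open_bigU (R : realType) (V : choiceType)
  (K : simplicial_complex V) (I : Type) (f : I -> set (realization R K)) :
  (forall i, realization_open (f i)) -> realization_open (\bigcup_i f i).
Proof.
move=> of_ s Ks w [i _ fiw] ws; have [e e0 he] := of_ i s Ks w fiw ws.
by exists e => // w' w's h; exists i => //; apply: he.
Qed.

HB.instance Definition _ (R : realType) (V : choiceType)
    (K : simplicial_complex V) :=
  isOpenTopological.Build (realization R K) (@realization_openT R V K)
    (@realization_openI R V K) (@realization_open_bigU R V K).

Definition realization_incl (R : realType) (V : choiceType)
  (K K' : simplicial_complex V) (h : (simplex K `<=` simplex K')%classic) :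
  realization R K -> realization R K'.
Proof. by apply: set_incl => w [Kw w0 w1]; split=> //; apply: h. Defined.

Lemma realization_incl_continuous (R : realType) (V : choiceType)
  (K K' : simplicial_complex V) (h : (simplex K `<=` simplex K')%classic) :
  continuous (@realization_incl R V K K' h).
Proof.
apply/continuousP => A; rewrite -[open A]/(realization_open A) => oA.
rewrite -[open _]/(realization_open (realization_incl h @^-1` A)).
move=> s Ks w Aw ws.
have [e e0 he] := oA s (h _ Ks) _ Aw ws.
by exists e => // w' w's hw; apply: he.
Qed.

Definition rips (R : realType) (X : metricType R) (delta : R) (A : set X)
  : simplicial_complex X.
Proof.
exists [set s : {fset X} | [/\ s != fset0, forall x, x \in s -> A x
  & forall x y, x \in s -> y \in s -> mdist x y < delta]].
- by move=> s [].
- move=> s t [s0 sA sd] /fsubsetP ts t0; split=> //.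
  + by move=> x /ts; apply: sA.
  + by move=> x y /ts xs /ts; apply: sd.
Defined.

Lemma ripsS (R : realType) (X : metricType R) (delta : R) (A B : set X) :
  (A `<=` B)%classic -> (simplex (rips delta A) `<=` simplex (rips delta B))%classic.
Proof. by move=> AB s [s0 sA sd]; split=> // x /sA /AB. Qed.

Definition rips_pspace (R : realType) (N : nat) (X : metricType R)
  (g : X -> 'rV[R]_N) (delta : R) : pspace R N.
Proof.
exists (fun u => (realization R (rips delta (sublevel g u)) : topologicalType))
       (fun u v h => realization_incl (ripsS (sublevelS h))).
- by move=> u v h; apply: realization_incl_continuous.
- by move=> u h x; apply: val_inj.
- by move=> u v w h1 h2 h3 x; apply: val_inj.
Defined.

Definition correspondence (R : realType) (N : nat) (X Y : Type)
    (dX : X -> X -> R) (dY : Y -> Y -> R)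
    (fX : X -> 'rV[R]_N) (fY : Y -> 'rV[R]_N) (emet efun : R)
    (C : set (X * Y)) : Prop :=
  [/\ forall x, exists y, C (x, y),
      forall y, exists x, C (x, y),
      forall x y x' y', C (x, y) -> C (x', y') ->
        `|dX x x' - dY y y'| <= emet
    & forall x y, C (x, y) -> `|fX x - fY y| <= efun].

(* Main.v *)
(* Let [k] be the inverse of the reach. The nearest-point projection [pi] onto
   [M] satisfies Federer's inequalities on [k d(x, M) < 1]: the distance to [M]
   increases with slope 1 along rays leaving [M], so the points of such a ray
   all project to its origin. By Jung's theorem a finite set of diameter [d] has
   a circumcenter in its hull at distance at most [J d] from its points.

   The map from the Rips complex to [M] moves vertices to [M] by the
   correspondence, takes the barycenter in [R^n] and projects; the map back
   composes a fine partition of unity on [M] with the correspondence. Both are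
   honest maps, and morphisms of the localization related by a homotopy are
   equal because the projection from a cylinder is a weak equivalence.

   One composite is homotopic to the inclusion by a straight line in [R^n]
   followed by [pi]. For the other, write a point [w] of the complex as the
   integral over [u] of the indicators of its superlevel sets [{w > u}], and
   replace these indicators, from low to high levels, by the projected
   circumcenters of the superlevel sets. This homotopy stays in the complex
   because the circumcenter of a set is close to all its subsets. It is applied
   four times: to contract the inclusion to scale [d = E J (delta + emet)], with
   [d + emet <= delta]; twice at scale [d] in [M], where there is room for the
   partition of unity; and below [pi] to reach the composite. *)
Require Import Defs.
From mathcomp Require Import all_boot all_order all_algebra finmap.
From mathcomp Require Import all_classical all_reals all_analysis ring lra zify.
Import Order.TTheory GRing.Theory Num.Theory numFieldNormedType.Exports.

Set Implicit Arguments.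
Unset Strict Implicit.
Unset Printing Implicit Defensive.

Local Open Scope classical_set_scope.
Local Open Scope ring_scope.

(** The vertex maps chosen from the correspondence need not be continuous, so the comparison takes
    place between weight functions. A homotopy over superlevel sets needs no subdivision, and it
    ends in a map that no longer depends on the one it started from: two such homotopies with the
    same centers meet at their ends, which is how the identity and a projection are joined. The
    partition of unity costs a mesh [eta], while distances must stay below [delta]. The upper bound
    on [rho] makes the contraction factor [q] of one step less than 1: the scale is [d] after one
    contraction and [q * d] after two, and [q * d + eta <= d]. The condition [d + emet <= delta],
    under which the correspondence leads back into the complex, follows from the second bound on
    [emet]. Homotopies may use the whole shift [2 * e], hence a drift of [2 * d] in [M]. In the one
    below the projection, a projected point is within [d] of a center, the center within [d] of a
    vertex, and [eta] comes on top, which is too much. But a circumcenter lies within [J * r / 2] of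
    [M], so projected centers can be traded for circumcenters at the cost [d / 2]. *)

Lemma le_of_sqr (R : realType) (a b : R) : 0 <= b -> a ^+ 2 <= b ^+ 2 -> a <= b.
Proof. by move=> b0; case: (leP a b) => // ba; nra. Qed.

(** * Euclidean geometry of row vectors *)

Section Euclid.
Context (R : realType) (n : nat).
Implicit Types (u v x y z : 'rV[R]_n) (a b r : R).

Definition dot u v : R := \sum_(i < n) u ord0 i * v ord0 i.

Lemma dotC u v : dot u v = dot v u.
Proof. by apply: eq_bigr => i _; rewrite mulrC. Qed.

Lemma dotDl u v x : dot (u + v) x = dot u x + dot v x.
Proof. by rewrite -big_split; apply: eq_bigr => i _; rewrite mxE mulrDl. Qed.

Lemma dotZl a u x : dot (a *: u) x = a * dot u x.
Proof. by rewrite mulr_sumr; apply: eq_bigr => i _; rewrite mxE mulrA. Qed.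

Lemma dotNl u x : dot (- u) x = - dot u x.
Proof. by rewrite -scaleN1r dotZl mulN1r. Qed.

Lemma dotBl u v x : dot (u - v) x = dot u x - dot v x.
Proof. by rewrite dotDl dotNl. Qed.

Lemma dot0l x : dot 0 x = 0.
Proof. by rewrite -(subrr x) dotBl subrr. Qed.

Lemma dotDr x u v : dot x (u + v) = dot x u + dot x v.
Proof. by rewrite dotC dotDl !(dotC x). Qed.

Lemma dotZr a x u : dot x (a *: u) = a * dot x u.
Proof. by rewrite dotC dotZl dotC. Qed.

Lemma dotBr x u v : dot x (u - v) = dot x u - dot x v.
Proof. by rewrite dotC dotBl !(dotC x). Qed.

Definition dotE := (dotBl, dotBr, dotDl, dotDr, dotZl, dotZr).

Lemma dot_sqrB u v : dot (u - v) (u - v) = dot u u + dot v v - 2 * dot u v.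
Proof. by rewrite !dotE (dotC v u); ring. Qed.

Lemma dot_suml (I : Type) (s : seq I) (P : pred I) (F : I -> 'rV[R]_n) x :
  dot (\sum_(i <- s | P i) F i) x = \sum_(i <- s | P i) dot (F i) x.
Proof.
apply: (big_morph (dot^~ x)) => [u v|]; first exact: dotDl.
exact: dot0l.
Qed.

Lemma dot_ge0 u : 0 <= dot u u.
Proof. by apply: sumr_ge0 => i _; rewrite -expr2 sqr_ge0. Qed.

Lemma dot_eq0 u : dot u u = 0 -> u = 0.
Proof.
move=> /psumr_eq0P u0; apply/rowP => i; rewrite mxE; apply/eqP.
by rewrite -sqrf_eq0 expr2 u0// => j _; rewrite -expr2 sqr_ge0.
Qed.

Definition enorm u : R := Num.sqrt (dot u u).

Lemma euclE x y : eucl x y = enorm (x - y).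
Proof. by congr Num.sqrt; apply: eq_bigr => i _; rewrite !mxE expr2. Qed.

Lemma enorm_ge0 u : 0 <= enorm u.
Proof. exact: sqrtr_ge0. Qed.

Lemma sqr_enorm u : enorm u ^+ 2 = dot u u.
Proof. by rewrite sqr_sqrtr// dot_ge0. Qed.

Lemma enormZ a u : enorm (a *: u) = `|a| * enorm u.
Proof.
by rewrite /enorm dotZl dotZr mulrA -expr2 sqrtrM ?sqr_ge0// sqrtr_sqr.
Qed.

Lemma enormN u : enorm (- u) = enorm u.
Proof. by rewrite -scaleN1r enormZ normrN1 mul1r. Qed.

Lemma enorm_eq0 u : enorm u = 0 -> u = 0.
Proof. by move=> u0; apply: dot_eq0; rewrite -sqr_enorm u0 expr0n. Qed.

Lemma enorm0 : enorm 0 = 0.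
Proof. by rewrite -(scale0r 0) enormZ normr0 mul0r. Qed.

Lemma dot_le u v : dot u v <= enorm u * enorm v.
Proof.
have [u0|u0] := eqVneq (enorm u) 0.
  by rewrite u0 mul0r (enorm_eq0 u0) dot0l.
have [v0|v0] := eqVneq (enorm v) 0.
  by rewrite v0 mulr0 (enorm_eq0 v0) dotC dot0l.
have U : 0 < enorm u by rewrite lt_def u0 enorm_ge0.
have V : 0 < enorm v by rewrite lt_def v0 enorm_ge0.
have := dot_ge0 (enorm v *: u - enorm u *: v).
rewrite !dotE -!sqr_enorm (dotC v u) => h.
rewrite -(ler_pM2l (mulr_gt0 U V)); nra.
Qed.

Lemma enormD u v : enorm (u + v) <= enorm u + enorm v.
Proof.
apply: le_of_sqr; first by rewrite addr_ge0 ?enorm_ge0.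
rewrite sqr_enorm !dotE -!sqr_enorm (dotC v u); have := dot_le u v; nra.
Qed.

Lemma eucl_ge0 x y : 0 <= eucl x y.
Proof. exact: sqrtr_ge0. Qed.

Lemma eucl_sqr x y : eucl x y ^+ 2 = dot (x - y) (x - y).
Proof. by rewrite euclE sqr_enorm. Qed.

Lemma eucl_sym x y : eucl x y = eucl y x.
Proof. by rewrite !euclE -opprB enormN. Qed.

Lemma eucl_xx x : eucl x x = 0.
Proof. by rewrite euclE subrr enorm0. Qed.

Lemma eucl_eq0 x y : eucl x y = 0 -> x = y.
Proof. by rewrite euclE => /enorm_eq0/subr0_eq. Qed.

Lemma eucl_sqr_shift x y h a : eucl x (y + a *: h) ^+ 2 =
  eucl x y ^+ 2 + 2 * a * dot h (y - x) + a ^+ 2 * dot h h.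
Proof. by rewrite !eucl_sqr !dotE (dotC x h) (dotC x y) (dotC y h); ring. Qed.

Lemma eucl_triangle x y z : eucl x z <= eucl x y + eucl y z.
Proof. by rewrite !euclE -(subrKA y); exact: enormD. Qed.

Lemma coord_le_enorm u i : `|u ord0 i| <= enorm u.
Proof.
rewrite -(sqrtr_sqr (u ord0 i)); apply: ler_wsqrtr.
rewrite /dot (bigD1 i)//= expr2 lerDl sumr_ge0// => j _.
by rewrite -expr2 sqr_ge0.
Qed.

Lemma norm_coord_le u i : `|u ord0 i| <= `|u|.
Proof.
by rewrite [leRHS]/Num.Def.normr/= mx_normrE; apply/bigmax_geP; right; exists (ord0, i).
Qed.

Lemma norm_le_coord u r : 0 <= r -> (forall i, `|u ord0 i| <= r) -> `|u| <= r.
Proof.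
move=> r0 h; rewrite [leLHS]/Num.Def.normr/= mx_normrE.
by apply/bigmax_leP; split=> // -[i j] _; rewrite ord1.
Qed.

Lemma norm_le_coords u v r : `|u - v| <= r ->
  forall i, u ord0 i <= v ord0 i + r /\ v ord0 i <= u ord0 i + r.
Proof.
move=> uv i; have := le_trans (norm_coord_le (u - v) i) uv.
by rewrite !mxE ler_norml => /andP[h1 h2]; split; lra.
Qed.

Lemma norm_le_enorm u : `|u| <= enorm u.
Proof. by apply: norm_le_coord (enorm_ge0 u) _ => i; exact: coord_le_enorm. Qed.

Lemma enorm_le_norm u : enorm u <= n%:R * `|u|.
Proof.
apply: le_of_sqr; first by rewrite mulr_ge0.
rewrite sqr_enorm; apply: (@le_trans _ _ (n%:R * `|u| ^+ 2)).
  rewrite /dot mulr_natl -[X in _ *+ X]card_ord -sumr_const; apply: ler_sum => i _.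
  rewrite (le_trans (ler_norm _))// normrM -expr2.
  by rewrite lerXn2r ?nnegrE// norm_coord_le.
rewrite exprMn ler_wpM2r ?sqr_ge0// -natrX ler_nat.
by case: n => // m; rewrite expnS expn1 leq_pmulr.
Qed.

(** The topology comes from the infinity norm, the estimates from the Euclidean one; the two are
    equivalent by [norm_le_enorm] and [enorm_le_norm]. *)
Lemma cvg_eucl (T : Type) (F : set_system T) (FF : Filter F)
    (g : T -> 'rV[R]_n) x :
  g @ F --> x <-> (fun t => eucl (g t) x) @ F --> (0 : R).
Proof.
split=> [/cvgrPdist_lt h|/cvgrPdist_lt h].
  apply/cvgrPdist_lt => e e0.
  have e' : 0 < e / (n%:R + 1) by rewrite divr_gt0// ltr_wpDl.
  near=> t; rewrite sub0r normrN ger0_norm ?eucl_ge0// eucl_sym euclE.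
  apply: le_lt_trans (enorm_le_norm _) _.
  have : `|x - g t| < e / (n%:R + 1) by near: t; exact: h.
  rewrite ltr_pdivlMr ?ltr_wpDl// mulrC; apply: le_lt_trans.
  by rewrite ler_wpM2r// lerDl.
apply/cvgrPdist_lt => e e0; near=> t.
apply: le_lt_trans (norm_le_enorm _) _; rewrite -euclE eucl_sym.
rewrite -[ltLHS](ger0_norm (eucl_ge0 _ _)) -normrN -sub0r.
by near: t; exact: h.
Unshelve. all: by end_near. Qed.

Lemma ler_dist_eucl x y z : `|eucl z x - eucl z y| <= eucl x y.
Proof.
rewrite ler_norml lerBlDr lerBrDr.
have := eucl_triangle z x y; have := eucl_triangle z y x.
by rewrite (eucl_sym y x) => h1 h2; apply/andP; split; lra.
Qed.

Lemma near_eucl x e : 0 < e -> \forall y \near x, eucl x y < e.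
Proof.
move=> e0; have h : (fun t => eucl t x) @ x --> (0 : R).
  by apply/(@cvg_eucl _ _ (nbhs_filter x)); exact: cvg_id.
move/cvgrPdist_lt: h => /(_ _ e0) h; near=> y.
rewrite eucl_sym -[ltLHS]ger0_norm ?eucl_ge0// -normrN -sub0r.
by near: y.
Unshelve. all: by end_near. Qed.

Lemma continuous_eucl z : continuous (eucl z).
Proof.
move=> x; apply/(@cvgrPdist_lt _ _ _ _ (nbhs_filter x)) => e e0.
near=> y; apply: le_lt_trans (ler_dist_eucl _ _ _) _.
by near: y; exact: near_eucl.
Unshelve. all: by end_near. Qed.

Lemma continuous_dot z : continuous (dot z).
Proof.
move=> x; apply/(@cvgrPdist_lt _ _ _ _ (nbhs_filter x)) => e e0.
have e' : 0 < e / (enorm z + 1) by rewrite divr_gt0// ltr_wpDl// enorm_ge0.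
near=> y; have h : eucl x y < e / (enorm z + 1) by near: y; exact: near_eucl.
have k : enorm z * eucl x y <= e / (enorm z + 1) * enorm z.
  by rewrite mulrC ler_wpM2r ?enorm_ge0// ltW.
apply: (@le_lt_trans _ _ (enorm z * eucl x y)).
  rewrite -dotBr ler_norml; have := dot_le z (x - y); have := dot_le z (y - x).
  by rewrite -!euclE (eucl_sym y) !dotBr => h1 h2; apply/andP; split; lra.
apply: (le_lt_trans k); rewrite mulrAC ltr_pdivrMr ?ltr_wpDl ?enorm_ge0//.
by rewrite ltr_pM2l// ltrDl.
Unshelve. all: by end_near. Qed.

Lemma compact_eucl_ball (A : set 'rV[R]_n) z r : closed A ->
  (forall x, A x -> eucl z x <= r) -> compact A.
Proof.
move=> cA hA; apply: bounded_closed_compact => //.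
exists (`|z| + r); split=> [|e he x Ax]; first exact: num_real.
rewrite /= (le_trans _ (ltW he))// -[x](addrNK z) addrC.
rewrite (le_trans (ler_normD _ _))// lerD2l.
by rewrite (le_trans (norm_le_enorm _))// -euclE eucl_sym hA.
Qed.

Lemma closed_eucl_ball z r : closed [set x | eucl z x <= r].
Proof.
apply: (@closed_comp _ _ (eucl z) [set t | t <= r]).
  by move=> x _; exact: continuous_eucl.
exact: closed_le.
Qed.

End Euclid.

(** * Nearest-point projection and Federer's inequalities *)

Definition nearest (R : realType) (n : nat) (M : set 'rV[R]_n)
    (x a : 'rV[R]_n) : Prop :=
  M a /\ forall z, M z -> eucl x a <= eucl x z.

Section Projection.
Context (R : realType) (n : nat) (M : set 'rV[R]_n) (k : R).
Implicit Types (x y z a b : 'rV[R]_n) (s t : R).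
Hypothesis closedM : closed M.
Hypothesis k0 : 0 <= k.
Hypothesis unip : forall x y, M y -> k * eucl x y < 1 ->
  exists! a, nearest M x a.

Lemma nearest_segment x a s : nearest M x a -> 0 <= s <= 1 ->
  nearest M (a + s *: (x - a)) a.
Proof.
move=> [Ma ha] /andP[s0 s1]; split=> // z Mz.
have := eucl_triangle x (a + s *: (x - a)) z; have := ha z Mz.
rewrite (_ : eucl (a + s *: (x - a)) a = s * eucl x a); last first.
  by rewrite !euclE addrAC subrr add0r enormZ ger0_norm.
rewrite (_ : eucl x (a + s *: (x - a)) = (1 - s) * eucl x a); first lra.
rewrite !euclE opprD addrA -[X in X - _]scale1r -scalerBl enormZ ger0_norm//.
by rewrite subr_ge0.
Qed.

Lemma nearest_unique x a b : nearest M x a -> nearest M x b ->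
  k * eucl x a < 1 -> a = b.
Proof.
move=> na nb h; have [c [_ hc]] := unip (proj1 na) h.
by rewrite -(hc _ na) (hc _ nb).
Qed.

(** Continuity of the projection by compactness, before any Lipschitz bound is available: the points
    of [M] near [y] but [e] away from [a] form a compact set, whose distance to [y] exceeds
    [eucl y a] by uniqueness. A nearest point of [y'] close to [y] is too near to [y] to belong to
    it. *)
Lemma nearest_near y a e : nearest M y a -> k * eucl y a < 1 -> 0 < e ->
  exists2 d, 0 < d & forall y' b, eucl y y' < d -> nearest M y' b ->
    eucl a b < e.
Proof.
move=> na h e0; set r := eucl y a.
pose K := M `&` ([set z | eucl y z <= r + 1] `&` [set z | e <= eucl a z]).
have cK : compact K.
  apply: (@compact_eucl_ball _ _ _ y (r + 1)); last by move=> z [_ []].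
  apply: closedI => //; apply: closedI; first exact: closed_eucl_ball.
  apply: (@closed_comp _ _ (eucl a) [set t | e <= t]); last exact: closed_ge.
  by move=> z _; exact: continuous_eucl.
have far y' b d : d <= 1 / 2 -> eucl y y' < d -> nearest M y' b ->
    eucl y b < r + d + d.
  move=> _ yd [_ /(_ _ (proj1 na)) hb].
  have := eucl_triangle y y' b; have := eucl_triangle y' y a.
  by rewrite (eucl_sym y' y) -/r; lra.
have [K0|K0] := pselect (K !=set0); last first.
  exists (1 / 2) => [|y' b yd nb]; first by rewrite divr_gt0.
  rewrite ltNge; apply/negP => eb; apply: K0; exists b.
  split; [exact: (proj1 nb)|split=> //=].
  by have := far y' b (1/2) (lexx _) yd nb; lra.
have [c] := compact_EVT_min K0 cK
  (@continuous_subspaceT _ _ _ _ (@continuous_eucl _ _ y)).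
rewrite inE => -[Mc [_ /= ec]] hc.
have rc : r < eucl y c.
  rewrite ltNge; apply/negP => cr; have : a = c.
    apply: (nearest_unique na _ h); split=> // z Mz.
    exact: le_trans cr ((proj2 na) z Mz).
  by move=> ac; move: ec; rewrite ac eucl_xx; lra.
(* [far] loses [d] twice: [1 / 2] keeps [b] in the ball of radius [r + 1], half the gap keeps it
   nearer to [y] than [c]. *)
pose d := Num.min (1 / 2) ((eucl y c - r) / 2).
exists d => [|y' b yd nb].
  by rewrite lt_min; apply/andP; split; lra.
have d1 : d <= 1 / 2 by rewrite ge_min lexx.
have d2 : d <= (eucl y c - r) / 2 by rewrite ge_min lexx orbT.
have yb := far y' b d d1 yd nb.
rewrite ltNge; apply/negP => eb; have : K b.
  by split; [exact: (proj1 nb)|split=> //=; lra].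
by move=> /mem_set/hc; lra.
Qed.

(** By continuity the nearest point [b'] of the moved point stays close to [b], so [h] still points
    away from [b'] and the distance to [b'] grows; at [c] that distance was already at least
    [eucl c b]. *)
Lemma nearest_ascent c b h : nearest M c b -> k * eucl c b < 1 ->
  0 < dot h (c - b) ->
  exists2 e, 0 < e & forall t, 0 < t -> t < e ->
    exists2 b', nearest M (c + t *: h) b' & eucl c b < eucl (c + t *: h) b'.
Proof.
move=> nb kb hh; pose p := dot h (c - b).
have h0 : 0 < enorm h.
  rewrite lt_def enorm_ge0 andbT; apply/eqP => /enorm_eq0 h0.
  by move: hh; rewrite h0 dot0l ltxx.
(* By Cauchy-Schwarz, replacing [b] by a point this close lowers [dot h (c - b)] by less than
   half. *)
have pe : 0 < p / (2 * enorm h) by rewrite divr_gt0// mulr_gt0.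
have [d d0 hd] := nearest_near nb kb pe.
pose m := (1 - k * eucl c b) / (k + 1).
have m0 : 0 < m by rewrite divr_gt0// ?subr_gt0// ltr_wpDl.
exists (Num.min (d / enorm h) (m / enorm h)) => [|t t0].
  by rewrite lt_min; apply/andP; split; exact: divr_gt0.
rewrite lt_min !(ltr_pdivlMr _ _ h0) => /andP[td tm].
have ct : eucl c (c + t *: h) = t * enorm h.
  by rewrite euclE opprD addrA subrr sub0r enormN enormZ gtr0_norm.
have [|b' [nb' _]] := unip (x := c + t *: h) (proj1 nb).
  have := eucl_triangle (c + t *: h) c b; rewrite (eucl_sym _ c) ct => tr.
  have : (k + 1) * (t * enorm h) < 1 - k * eucl c b.
    by rewrite mulrC -ltr_pdivlMr// ltr_wpDl.
  have th0 : 0 < t * enorm h by rewrite mulr_gt0.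
  have : k * eucl (c + t *: h) b <= k * (t * enorm h + eucl c b).
    by rewrite ler_wpM2l.
  lra.
exists b' => //; have := hd _ _ _ nb'; rewrite ct => /(_ td).
rewrite ltr_pdivlMr ?mulr_gt0// => bb.
have cb' := (proj2 nb) _ (proj1 nb').
have := dot_le h (b' - b); rewrite -euclE (eucl_sym b') => hb.
have hcb : dot h (c - b') = p - dot h (b' - b) by rewrite /p !dotE; lra.
have q : 0 < dot h (c - b') by rewrite hcb /p; move: hh bb hb; rewrite -/p; nra.
have E : eucl (c + t *: h) b' ^+ 2 =
    eucl c b' ^+ 2 + 2 * t * dot h (c - b') + t ^+ 2 * dot h h.
  by rewrite !(eucl_sym _ b') eucl_sqr_shift.
rewrite ltNge; apply/negP => le; have := dot_ge0 h.
have := eucl_ge0 c b; have := eucl_ge0 (c + t *: h) b'.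
have := eucl_ge0 c b'; move: E q le cb' t0.
by set A := eucl _ b'; set B := eucl c b'; set D := eucl c b; nra.
Qed.

Let dM y : R := inf [set eucl y z | z in M].

Lemma dist_nearest y b : nearest M y b -> inf [set eucl y z | z in M] = eucl y b.
Proof.
move=> [Mb hb]; apply/eqP; rewrite eq_le; apply/andP; split.
  apply: ge_inf; last by exists b.
  by exists 0 => _ [z _ <-]; exact: eucl_ge0.
apply: lb_le_inf; first by exists (eucl y b), b.
by move=> _ [z Mz <-]; exact: hb.
Qed.

Lemma continuous_dist a : M a ->
  continuous (fun y : 'rV[R]_n => inf [set eucl y z | z in M]).
Proof.
move=> Ma.
have lip x y : dM x - dM y <= eucl x y.
  rewrite lerBlDr -lerBlDl; apply: lb_le_inf; first by exists (eucl y a), a.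
  move=> _ [z Mz <-]; rewrite lerBlDl; apply: le_trans (eucl_triangle x y z).
  apply: ge_inf; last by exists z.
  by exists 0 => _ [t _ <-]; exact: eucl_ge0.
move=> x; apply/(@cvgrPdist_lt _ _ _ _ (nbhs_filter x)) => e e0.
near=> y; apply: (@le_lt_trans _ _ (eucl x y)); last first.
  by near: y; exact: near_eucl.
rewrite ler_norml; have := lip x y; have := lip y x.
by rewrite (eucl_sym y) /dM => h1 h2; apply/andP; split; lra.
Unshelve. all: by end_near. Qed.

(* The distance to [M] has slope 1 along [x - a], so its maximum on the ball of
   radius [s] about [x] is attained on the ray from [a] through [x]. *)
Lemma nearest_extend x a s : nearest M x a -> 0 < s -> s < eucl x a ->
  k * (eucl x a + s) < 1 ->
  nearest M (a + ((eucl x a + s) / eucl x a) *: (x - a)) a.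
Proof.
move=> na s0 sT hT; set T := eucl x a in sT hT *.
have T0 : 0 < T by lra.
have kT : k * eucl x a < 1 by rewrite -/T; nra.
pose B := [set y | eucl x y <= s].
have xB : B x by rewrite /B /= eucl_xx ltW.
have cB : compact B := compact_eucl_ball (@closed_eucl_ball _ _ x s) (fun _ h => h).
have [c] := compact_EVT_max (ex_intro _ x xB) cB
  (@continuous_subspaceT _ _ _ _ (continuous_dist (proj1 na))).
rewrite inE => Bc hc.
have ex y : B y -> exists2 b, nearest M y b & k * eucl y b < 1.
  move=> By; have hy : eucl y a <= s + T.
    apply: le_trans (eucl_triangle y x a) _.
    by rewrite -/T lerD2r eucl_sym.
  have hy' : k * eucl y a < 1.
    by apply: le_lt_trans hT; rewrite ler_wpM2l// (addrC T).
  have [b [nb _]] := unip (proj1 na) hy'.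
  exists b => //; apply: le_lt_trans hy'; rewrite ler_wpM2l//.
  exact: (proj2 nb) _ (proj1 na).
have [b nb kb] := ex c Bc.
have maxc y b' : B y -> nearest M y b' -> eucl y b' <= eucl c b.
  by move=> By nb'; rewrite -(dist_nearest nb') -(dist_nearest nb) hc ?inE.
have TT := maxc x a xB na; rewrite -/T in TT.
set T' := eucl c b in maxc TT kb.
(* [c] maximizes the distance to [M] on the ball, so no direction of ascent at [c] may stay in the
   ball. *)
have noasc h : 0 < dot h (c - b) ->
    (exists2 e, 0 < e & forall t, 0 < t -> t < e -> B (c + t *: h)) -> False.
  move=> hh [e e0 he]; have [e' e'0 he'] := nearest_ascent nb kb hh.
  pose t := Num.min e e' / 2.
  have m0 : 0 < Num.min e e' by rewrite lt_min e0.
  have t0 : 0 < t by rewrite divr_gt0.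
  have tm : t < Num.min e e' by rewrite /t; lra.
  move: (tm); rewrite lt_min => /andP[te te'].
  have [b' nb' lt] := he' t t0 te'.
  by have := maxc _ _ (he t t0 te) nb'; rewrite leNgt lt.
have cbT : dot (c - b) (c - b) = T' ^+ 2 by rewrite -eucl_sqr.
have T'0 : 0 < T' by exact: lt_le_trans TT.
have xcs : eucl x c = s.
  apply/eqP; rewrite eq_le; apply/andP; split; first exact: Bc.
  rewrite leNgt; apply/negP => lts; apply: (noasc (c - b)).
    by rewrite cbT exprn_gt0.
  exists ((s - eucl x c) / T'); first by rewrite divr_gt0// subr_gt0.
  move=> t t0; rewrite ltr_pdivlMr// => ht; rewrite /B /=.
  apply: le_trans (eucl_triangle x c _) _.
  rewrite (euclE c) opprD addrA subrr sub0r enormN enormZ gtr0_norm//.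
  by rewrite -euclE -/T'; lra.
set P := dot (c - x) (c - b).
have cxs : dot (c - x) (c - x) = s ^+ 2 by rewrite -eucl_sqr eucl_sym xcs.
have PsT : P = s * T'.
  apply/eqP; rewrite eq_le; apply/andP; split.
    by rewrite /P (le_trans (dot_le _ _))// -!euclE eucl_sym xcs.
  rewrite leNgt; apply/negP => lts.
  (* If Cauchy-Schwarz were strict here, this combination would increase the distance to [M] by [h1]
     and point into the ball by [h2]. *)
  pose h := s *: (c - b) - T' *: (c - x).
  have h1 : dot h (c - b) = T' * (s * T' - P).
    by rewrite /h dotBl !dotZl cbT -/P; ring.
  have h2 : dot h (c - x) = - (s * (s * T' - P)).
    by rewrite /h dotBl !dotZl cxs dotC -/P; ring.
  apply: (noasc h); first by rewrite h1 mulr_gt0// subr_gt0.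
  have g : 0 < s * (s * T' - P) by rewrite mulr_gt0// subr_gt0.
  have hh := dot_ge0 h.
  exists (s * (s * T' - P) / (dot h h + 1)); first by rewrite divr_gt0// ltr_wpDl.
  move=> t t0; rewrite ltr_pdivlMr ?ltr_wpDl// => ht; rewrite /B /=.
  apply: le_of_sqr; first exact: ltW.
  have -> : eucl x (c + t *: h) ^+ 2 =
      s ^+ 2 + 2 * t * dot h (c - x) + t ^+ 2 * dot h h.
    by rewrite eucl_sqr_shift xcs.
  rewrite h2; move: ht g t0 hh; set g := s * _; set d := dot h h; nra.
(* The equality case of Cauchy-Schwarz: [x] lies on the segment from [b] to [c], hence shares the
   nearest point [b]. *)
have E : s *: (c - b) = T' *: (c - x).
  apply/eqP; rewrite -subr_eq0; apply/eqP/dot_eq0.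
  by rewrite dotBl !dotBr !dotZl !dotZr cbT cxs dotC -/P PsT; ring.
have xE : x = b + (1 - s / T') *: (c - b).
  rewrite scalerBl scale1r addrA [b + _]addrC subrK.
  by rewrite mulrC -scalerA E scalerA mulVf ?gt_eqF// scale1r subKr.
have ab : a = b.
  apply: (nearest_unique na _ kT); rewrite xE; apply: (nearest_segment nb).
  apply/andP; split; first by rewrite subr_ge0 ler_pdivrMr// mul1r; lra.
  by rewrite lerBlDr lerDl divr_ge0 ?ltW.
have TE : T = T' - s.
  rewrite /T {1}xE ab euclE addrAC subrr add0r enormZ -euclE -/T' ger0_norm.
    by rewrite mulrBl mul1r divfK ?gt_eqF.
  by rewrite subr_ge0 ler_pdivrMr// mul1r; lra.
suff -> : a + ((T + s) / T) *: (x - a) = c by rewrite ab.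
rewrite [in x - a]xE -ab addrAC subrr add0r scalerA TE subrK.
rewrite (_ : T' / (T' - s) * (1 - s / T') = 1) ?scale1r ?subrKC//.
by field; rewrite !gt_eqF// -TE.
Qed.

(** The heights at which [a] stays nearest form an interval that contains its supremum, by the
    triangle inequality. If the supremum were below [t], [nearest_extend] would go beyond it. *)
Lemma nearest_ray x a t : nearest M x a -> 0 < eucl x a -> 0 <= t ->
  k * t < 1 -> nearest M (a + (t / eucl x a) *: (x - a)) a.
Proof.
set r := eucl x a => na r0 t0 kt.
pose S := [set t | 0 <= t /\ nearest M (a + (t / r) *: (x - a)) a].
have eS u : 0 <= u -> eucl (a + (u / r) *: (x - a)) a = u.
  move=> u0; rewrite euclE addrAC subrr add0r enormZ -euclE -/r.
  rewrite ger0_norm; first by rewrite divfK// gt_eqF.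
  by apply: divr_ge0 => //; exact: ltW.
have down u v : S u -> 0 <= v -> v <= u -> S v.
  move=> [u0 nu] v0 vu; split=> //.
  have [u00|u00] := eqVneq u 0.
    by have -> : v = u by apply/eqP; rewrite eq_le vu u00.
  have := @nearest_segment _ _ (v / u) nu.
  rewrite addrAC subrr add0r scalerA mulrA divfK//; apply.
  have u1 : 0 < u by rewrite lt_def u00.
  by rewrite divr_ge0//= ler_pdivrMr// mul1r.
have Sr : S r by split; [exact: ltW|rewrite divff ?gt_eqF// scale1r subrKC].
apply: contrapT => nt.
have St u : S u -> u <= t.
  move=> Su; rewrite leNgt; apply/negP => tu; apply: nt.
  by have [] := down u t Su t0 (ltW tu).
have hS : has_sup S by split; [exists r|exists t => u; exact: St].
pose T := sup S.
have rT : r <= T by exact: sup_upper_bound.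
have Tt : T <= t by apply: ge_sup; [exists r|move=> u; exact: St].
have T0 : 0 <= T by rewrite (le_trans (ltW r0)).
have ST : S T.
  split=> //; split; first exact: (proj1 na).
  move=> z Mz; rewrite eS// leNgt; apply/negP => lz.
  set p := a + _ in lz.
  have e0 : 0 < (T - eucl p z) / 2 by rewrite divr_gt0// subr_gt0.
  have [u Su hu] := sup_adherent e0 hS; have [u0 [_ nu]] := Su.
  have := nu z Mz; rewrite eS// => uz.
  have := eucl_triangle (a + (u / r) *: (x - a)) p z.
  have -> : eucl (a + (u / r) *: (x - a)) p = T - u.
    rewrite /p euclE opprD addrACA subrr add0r -scalerBl enormZ -euclE -/r.
    rewrite -mulrBl normrM normfV (gtr0_norm r0) divfK ?gt_eqF//.
    rewrite ler0_norm ?opprB// subr_le0.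
    exact: sup_upper_bound hS _ Su.
  by rewrite -/T in hu; lra.
have Tlt : T < t.
  rewrite lt_neqAle Tt andbT; apply/eqP => Te; apply: nt.
  by have [_] := ST; rewrite Te.
have T1 : 0 < T by exact: lt_le_trans rT.
(* [T / 2] ensures [s < T], as [nearest_extend] asks; [t - T] keeps [k * (T + s)] below 1. *)
pose s : R := Num.min (T / 2) (t - T).
have s0 : 0 < s by rewrite lt_min; apply/andP; split; lra.
have s1 : s <= T / 2 by rewrite ge_min lexx.
have s2 : s <= t - T by rewrite ge_min lexx orbT.
have [_ nT] := ST; have := nearest_extend nT s0; rewrite eS//.
rewrite addrAC subrr add0r scalerA mulrA divfK ?gt_eqF// => ext.
have : S (T + s).
  split; first by lra.
  apply: ext; first by lra.
  by apply: le_lt_trans kt; rewrite ler_wpM2l//; lra.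
by move=> /(sup_upper_bound hS); rewrite -/T; lra.
Qed.

(** From the point at height [t] on the ray, [b] is no closer than [a]; expanding the squares gives
    [2 * t * c <= D] for all [t] with [k * t < 1], and the claim is the limit at [t = 1 / k]. *)
Lemma nearest_dot x a b : nearest M x a -> k * eucl x a < 1 -> M b ->
  dot (x - a) (b - a) <= k * eucl x a * eucl a b ^+ 2 / 2.
Proof.
move=> na ka Mb; set r := eucl x a in ka *.
have [r0|r0] := eqVneq r 0.
  by rewrite r0 mulr0 !mul0r (eucl_eq0 r0) subrr dot0l.
have r1 : 0 < r by rewrite lt_def r0 eucl_ge0.
set D := eucl a b ^+ 2; pose c := dot (x - a) (b - a) / r.
suff : c <= k * D / 2.
  rewrite ler_pdivrMr//; lra.
have D0 : 0 <= D by rewrite sqr_ge0.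
have H t : 0 < t -> k * t < 1 -> 2 * t * c <= D.
  move=> t0 kt; have [_ /(_ b Mb)] := nearest_ray na r1 (ltW t0) kt.
  rewrite -/r => h.
  have e1 : eucl (a + (t / r) *: (x - a)) a ^+ 2 = t ^+ 2.
    rewrite eucl_sym eucl_sqr_shift eucl_xx subrr dotC dot0l -eucl_sqr -/r.
    by field; rewrite gt_eqF.
  have e2 : eucl (a + (t / r) *: (x - a)) b ^+ 2 = D - 2 * t * c + t ^+ 2.
    rewrite eucl_sym eucl_sqr_shift -eucl_sqr -/r (eucl_sym b) -/D.
    have -> : dot (x - a) (a - b) = - dot (x - a) (b - a) by rewrite !dotBr; lra.
    by rewrite /c; field; rewrite gt_eqF.
  have : eucl (a + (t / r) *: (x - a)) a ^+ 2 <=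
      eucl (a + (t / r) *: (x - a)) b ^+ 2.
    by rewrite lerXn2r ?nnegrE ?eucl_ge0.
  by rewrite e1 e2; lra.
have [k00|k00] := eqVneq k 0.
  rewrite k00 !mul0r leNgt; apply/negP => c0.
  have : 2 * (D / c + 1) * c <= D.
    apply: H; last by rewrite k00 mul0r.
    by apply: ltr_wpDl => //; apply: divr_ge0 => //; exact: ltW.
  by rewrite (_ : 2 * _ * c = 2 * D + 2 * c); [lra|field; rewrite gt_eqF].
have k1 : 0 < k by rewrite lt_def k00.
rewrite leNgt; apply/negP => ck.
have c0 : 0 < c by apply: le_lt_trans ck; rewrite divr_ge0// mulr_ge0.
have d0 : 0 <= D / (2 * c) by rewrite divr_ge0// mulr_ge0// ltW.
have ik : 0 < k^-1 by rewrite invr_gt0.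
have dk : D / (2 * c) < k^-1.
  rewrite -[ltRHS]mul1r ltr_pdivlMr// mulrAC ltr_pdivrMr; first by lra.
  by lra.
have kk : k * k^-1 = 1 by rewrite mulfV.
have kd : k * (D / (2 * c)) < 1 by rewrite -[ltRHS]kk (ltr_pM2l k1).
(* Any height strictly between [D / (2 * c)] and [1 / k] contradicts [H]; the midpoint is taken. *)
have := H ((k^-1 + D / (2 * c)) / 2).
have -> : 2 * ((k^-1 + D / (2 * c)) / 2) * c = c / k + D / 2.
  by field; rewrite !gt_eqF.
have -> : k * ((k^-1 + D / (2 * c)) / 2) < 1 by rewrite mulrA mulrDr kk; lra.
have -> : 0 < (k^-1 + D / (2 * c)) / 2 by lra.
move=> /(_ isT isT) h.
suff : D / 2 < c / k by lra.
by rewrite ltr_pdivlMr//; lra.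
Qed.

(** Add [nearest_dot] at [x] towards [b] and at [y] towards [a]: the left sides sum to
    [l ^+ 2 - dot (y - x) (b - a)]. Then apply Cauchy-Schwarz and divide by [l]. *)
Lemma nearest_lip x y a b : nearest M x a -> nearest M y b ->
  k * eucl x a < 1 -> k * eucl y b < 1 ->
  (1 - k * (eucl x a + eucl y b) / 2) * eucl a b <= eucl x y.
Proof.
move=> na nb ka kb; set l := eucl a b.
have h1 := nearest_dot na ka (proj1 nb); rewrite -/l in h1.
have h2 := nearest_dot nb kb (proj1 na); rewrite (eucl_sym b) -/l in h2.
have h3 := dot_le (y - x) (b - a).
rewrite -!euclE (eucl_sym y) (eucl_sym b) -/l in h3.
have e : dot (x - a) (b - a) + dot (y - b) (a - b) = l ^+ 2 - dot (y - x) (b - a).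
  have -> : dot (y - b) (a - b) = - dot (y - b) (b - a) by rewrite !dotBr; lra.
  rewrite /l eucl_sym eucl_sqr; move: (b - a) (dotBl b a) => w ->.
  by rewrite !dotBl; ring.
have [->|l0] := eqVneq l 0; first by rewrite mulr0 eucl_ge0.
have l1 : 0 < l by rewrite lt_def l0 eucl_ge0.
rewrite -(ler_pM2r l1); move: h1 h2 h3 e; lra.
Qed.

Lemma nearest_lip_unif s x y a b : nearest M x a -> nearest M y b ->
  s < 1 -> k * eucl x a <= s -> k * eucl y b <= s ->
  eucl a b <= (1 - s)^-1 * eucl x y.
Proof.
move=> na nb s1 ka kb; rewrite mulrC ler_pdivlMr ?subr_gt0// mulrC.
have := nearest_lip na nb (le_lt_trans ka s1) (le_lt_trans kb s1).
apply: le_trans; rewrite ler_wpM2r ?eucl_ge0//; lra.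
Qed.

End Projection.

(** * Jung's theorem *)

Lemma exists_ge_average (R : realFieldType) (I : eqType) (r : seq I)
    (w F : I -> R) : (forall i, i \in r -> 0 <= w i) -> \sum_(i <- r) w i = 1 ->
  exists i, [/\ i \in r, 0 < w i & \sum_(j <- r) w j * F j <= F i].
Proof.
move=> w0 w1; set A := \sum_(j <- r) _.
apply: contrapT => nex.
have lt i : i \in r -> 0 < w i -> F i < A.
  by move=> ir wi; rewrite ltNge; apply/negP => Ai; apply: nex; exists i.
have term0 i : i \in r -> 0 <= w i * (A - F i).
  move=> ir; have := w0 i ir; rewrite le_eqVlt => /orP[/eqP<-|wi].
    by rewrite mul0r.
  by rewrite mulr_ge0 ?ltW// subr_gt0 lt.
have : \sum_(i <- r) w i * (A - F i) == 0.
  under eq_bigr do rewrite mulrBr.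
  by rewrite sumrB -mulr_suml w1 mul1r subrr.
rewrite big_seq psumr_eq0// => /allP all0.
have : \sum_(i <- r) w i = 0.
  apply: big1_seq => i /andP[_ ir]; apply/eqP; rewrite eq_le w0// andbT.
  rewrite leNgt; apply/negP => wi; have := all0 i ir; rewrite ir /=.
  by rewrite mulf_eq0 (gt_eqF wi)/= subr_eq0 gt_eqF// lt.
by rewrite w1 => /eqP; rewrite oner_eq0.
Qed.

(* Membership in the hull of a finite set, tested by linear functionals. *)
Definition inhull (R : realType) (n : nat) (s : seq 'rV[R]_n) (q : 'rV[R]_n) :=
  forall v, exists2 x, x \in s & dot v q <= dot v x.

Section Jung.
Context (R : realType) (n k : nat) (Y : 'I_k.+1 -> 'rV[R]_n).
Implicit Types (w : 'rV[R]_k.+1).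

Definition weights : set 'rV[R]_k.+1 :=
  [set w | (forall i, 0 <= w ord0 i) /\ \sum_i w ord0 i = 1].

Definition wmean w : 'rV[R]_n := \sum_i w ord0 i *: Y i.

(** The variance of the points [Y] under the weights [w]. Its maximization is dual to the smallest
    enclosing ball: at a maximizer the mean is the circumcenter and the variance the squared
    circumradius. *)
Definition wvar w : R :=
  dot w (\row_i dot (Y i) (Y i)) - dot (wmean w) (wmean w).

Lemma compact_weights : compact weights.
Proof.
apply: (@compact_eucl_ball _ _ _ 0 k.+1%:R).
  have -> : weights = (\bigcap_i [set w : 'rV[R]_k.+1 | 0 <= w ord0 i]) `&`
      [set w : 'rV[R]_k.+1 | dot (const_mx 1) w = 1].
    apply/seteqP; split=> w [h1 h2]; split.
    - by move=> i _; exact: h1.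
    - by rewrite /= -[RHS]h2; apply: eq_bigr => i _; rewrite mxE mul1r.
    - by move=> i; exact: h1.
    - by rewrite -[RHS]h2; apply: eq_bigr => i _; rewrite mxE mul1r.
  apply: closedI.
    apply: closed_bigI => i _.
    apply: (@closed_comp _ _ (fun w : 'rV[R]_k.+1 => w ord0 i) [set t | 0 <= t]).
      by move=> w _; exact: coord_continuous.
    exact: closed_ge.
  apply: (@closed_comp _ _ (dot (const_mx 1)) [set t | t = 1]).
    by move=> w _; exact: continuous_dot.
  exact: closed_eq.
move=> w [w0 w1]; rewrite eucl_sym euclE subr0.
rewrite (le_trans (enorm_le_norm _))// -[leRHS]mulr1 ler_wpM2l//.
apply: norm_le_coord => // i; rewrite ger0_norm// -w1 (bigD1 i)//= lerDl.
by rewrite sumr_ge0.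
Qed.

Lemma continuous_wvar : continuous wvar.
Proof.
have -> : wvar = fun w => dot (\row_i dot (Y i) (Y i)) w -
    \sum_(a < n) dot (\row_i Y i ord0 a) w * dot (\row_i Y i ord0 a) w.
  apply/funext => w; rewrite /wvar dotC; congr (_ - _).
  apply: eq_bigr => a _; rewrite /wmean summxE.
  by congr (_ * _); apply: eq_bigr => i _; rewrite !mxE mulrC.
move=> w; suff H (F : set_system 'rV[R]_k.+1) : Filter F ->
    (forall z, dot z x @[x --> F] --> dot z w) ->
    dot (\row_i dot (Y i) (Y i)) x - \sum_(a < n) dot (\row_i Y i ord0 a) x *
      dot (\row_i Y i ord0 a) x @[x --> F] -->
    dot (\row_i dot (Y i) (Y i)) w - \sum_(a < n) dot (\row_i Y i ord0 a) w *
      dot (\row_i Y i ord0 a) w.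
  by apply: (H (nbhs w) (nbhs_filter w)) => z; exact: continuous_dot.
move=> FF hF; apply: cvgB => //; apply: cvg_big => [|a _]; first exact: add_continuous.
exact: cvgM.
Qed.

Lemma dot_delta m i (v : 'rV[R]_m) : dot (delta_mx 0 i) v = v ord0 i.
Proof.
rewrite /dot (bigD1 i)//= mxE !eqxx mul1r big1 ?addr0// => j /negbTE h.
by rewrite mxE h andbF mul0r.
Qed.

(** First-order condition at the maximum: moving a fraction [t] of the weight to the vertex [i]
    changes the variance by [t * ((1 - t) * D - wvar w)], which cannot be positive; let [t] tend to
    0. *)
Lemma wvar_le w i : weights w -> (forall w', weights w' -> wvar w' <= wvar w) ->
  eucl (wmean w) (Y i) ^+ 2 <= wvar w.
Proof.
move=> [w0 w1] wmax; set z := wmean w; set D := eucl z (Y i) ^+ 2.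
have D0 : 0 <= D by rewrite sqr_ge0.
have H t : 0 < t -> t < 1 -> (1 - t) * D <= wvar w.
  move=> t0 t1; pose w' := (1 - t) *: w + t *: delta_mx 0 i.
  have hw' : weights w'.
    split=> [j|].
      rewrite !mxE eqxx/=; apply: addr_ge0; apply: mulr_ge0.
      - by lra.
      - exact: w0.
      - exact: ltW.
      - by [].
    under eq_bigr do rewrite !mxE eqxx/=.
    rewrite big_split/= -!mulr_sumr w1 (bigD1 i)//= eqxx big1.
      by rewrite /= addr0 !mulr1 subrK.
    by move=> j /negbTE ->.
  have zE : wmean w' = (1 - t) *: z + t *: Y i.
    rewrite /wmean; under eq_bigr do rewrite !mxE eqxx/= scalerDl -!scalerA.
    rewrite big_split/= -!scaler_sumr; congr (_ + t *: _).
    rewrite (bigD1 i)//= eqxx scale1r big1 ?addr0// => j /negbTE ->.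
    by rewrite scale0r.
  have fE : dot w' (\row_i dot (Y i) (Y i)) =
      (1 - t) * dot w (\row_i dot (Y i) (Y i)) + t * dot (Y i) (Y i).
    rewrite dotDl !dotZl; congr (_ + t * _).
    by rewrite dot_delta mxE.
  have := wmax _ hw'; rewrite /wvar fE zE -/z.
  rewrite /D eucl_sqr !dotE (dotC (Y i) z) => h.
  rewrite -(ler_pM2l t0); move: h; lra.
rewrite leNgt; apply/negP => lt.
have V0 : 0 <= wvar w.
  apply: le_trans (H (1/2) _ _); [|lra|lra].
  by rewrite mulr_ge0//; lra.
have D1 : 0 < D by exact: le_lt_trans lt.
have D2 : 0 < 2 * D by lra.
(* For this [t] the number [(1 - t) * D] is halfway between [D] and [wvar w]. *)
have q0 : 0 < (D - wvar w) / (2 * D) by apply: divr_gt0 => //; lra.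
have q1 : (D - wvar w) / (2 * D) < 1 by rewrite (ltr_pdivrMr _ _ D2); lra.
have := H _ q0 q1.
have -> : (1 - (D - wvar w) / (2 * D)) * D = D - (D - wvar w) / 2.
  by field; rewrite gt_eqF.
by lra.
Qed.

(* With [u_i] the vertices seen from the mean and [S = sum w_i u_i u_i^T],
   Cauchy-Schwarz gives [(tr S)^2 <= n tr (S^2)]; this is where the dimension
   enters, replacing Caratheodory's theorem. *)
Lemma wvar_sqr_le w : weights w ->
  wvar w ^+ 2 <= n%:R * \sum_i \sum_j w ord0 i * w ord0 j *
    dot (Y i - wmean w) (Y j - wmean w) ^+ 2.
Proof.
move=> [w0 w1]; set z := wmean w.
pose u i := Y i - z.
pose S a b := \sum_i w ord0 i * (u i ord0 a * u i ord0 b).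
have trS : \sum_a S a a = wvar w.
  rewrite exchange_big/=.
  under eq_bigr do rewrite -mulr_sumr -/(dot _ _) dotBl !dotBr (dotC z).
  have -> : dot z z = \sum_i w ord0 i * dot (Y i) z.
    by rewrite {1}/z /wmean dot_suml; apply: eq_bigr => i _; rewrite dotZl.
  rewrite /wvar -/z.
  have zz : dot z z = \sum_i w ord0 i * dot (Y i) z.
    by rewrite {1}/z /wmean dot_suml; apply: eq_bigr => i _; rewrite dotZl.
  under eq_bigr do rewrite mulrBr mulrBr -zz mulrBr.
  rewrite sumrB sumrB sumrB -mulr_suml w1 mul1r -zz subrr subr0.
  by congr (_ - _); apply: eq_bigr => i _; rewrite mxE.
have trS2 : \sum_a S a a ^+ 2 <= \sum_i \sum_j w ord0 i * w ord0 j * dot (u i) (u j) ^+ 2.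
  apply: (@le_trans _ _ (\sum_a \sum_b S a b ^+ 2)).
    apply: ler_sum => a _; rewrite (bigD1 a)//= lerDl sumr_ge0// => b _.
    exact: sqr_ge0.
  rewrite le_eqVlt; apply/orP; left; apply/eqP.
  transitivity (\sum_a \sum_b \sum_i \sum_j
      w ord0 i * w ord0 j * (u i ord0 a * u j ord0 a * (u i ord0 b * u j ord0 b))).
    apply: eq_bigr => a _; apply: eq_bigr => b _.
    rewrite expr2 mulr_suml; apply: eq_bigr => i _.
    by rewrite mulr_sumr; apply: eq_bigr => j _; ring.
  under eq_bigr do rewrite exchange_big/=.
  rewrite exchange_big/=; apply: eq_bigr => i _.
  under eq_bigr do rewrite exchange_big/=.
  rewrite exchange_big/=; apply: eq_bigr => j _.
  rewrite expr2 {1}/dot mulr_suml mulr_sumr; apply: eq_bigr => a _.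
  by rewrite mulr_sumr mulr_sumr; apply: eq_bigr => b _.
have CS := dot_le (\row_a S a a) (const_mx 1).
have one : enorm (const_mx 1 : 'rV[R]_n) ^+ 2 = n%:R.
  rewrite sqr_enorm /dot; under eq_bigr do rewrite !mxE mulr1.
  by rewrite sumr_const card_ord.
have e1 : dot (\row_a S a a) (const_mx 1) = wvar w.
  by rewrite -trS; apply: eq_bigr => a _; rewrite !mxE mulr1.
have e2 : enorm (\row_a S a a) ^+ 2 = \sum_a S a a ^+ 2.
  by rewrite sqr_enorm; apply: eq_bigr => a _; rewrite !mxE.
have V0 : 0 <= wvar w.
  rewrite -trS; apply: sumr_ge0 => a _; apply: sumr_ge0 => i _.
  by rewrite mulr_ge0// -expr2 sqr_ge0.
apply: (@le_trans _ _ (n%:R * \sum_a S a a ^+ 2)); last by rewrite ler_wpM2l.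
rewrite -one -e2 mulrC -exprMn -e1 lerXn2r// nnegrE ?e1//.
by rewrite mulr_ge0 ?enorm_ge0.
Qed.

End Jung.

Lemma sqr_Jconst (R : realType) n : Jconst R n ^+ 2 = n%:R / (2 * n.+1%:R).
Proof. by rewrite sqr_sqrtr// divr_ge0. Qed.

Lemma Jconst_ge0 (R : realType) n : 0 <= Jconst R n.
Proof. exact: sqrtr_ge0. Qed.

(** The center is the mean of the weights of maximal variance [V]. Bounding the squared products in
    [wvar_sqr_le] by affine functions of the products leaves [V ^+ 2 <= n * V * (c - V)] with
    [c = d ^+ 2 / 2], which is the constant of Jung. *)
Lemma jung (R : realType) (n : nat) (s : seq 'rV[R]_n) (d : R) :
  s != [::] -> (forall x y, x \in s -> y \in s -> eucl x y <= d) ->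
  exists2 z, inhull s z & forall x, x \in s -> eucl z x <= Jconst R n * d.
Proof.
case: s => // x0 s _ hd; set l := x0 :: s.
pose Y (i : 'I_(size s).+1) := tnth (in_tuple l) i.
have Yl i : Y i \in l by exact: mem_tnth.
have d0 : 0 <= d by rewrite -(eucl_xx x0) hd// mem_head.
have nW : @weights R (size s) !=set0.
  exists (delta_mx 0 ord0 : 'rV[R]_(size s).+1); split=> [i|].
    by rewrite mxE; case: (_ && _).
  rewrite (bigD1 ord0)//= mxE !eqxx big1 ?addr0// => i /negbTE h.
  by rewrite mxE h andbF.
have [w] := compact_EVT_max nW (@compact_weights R (size s))
  (continuous_subspaceT (continuous_wvar (Y := Y))).
rewrite inE => Ww wmax.
have {}wmax w' : @weights R (size s) w' -> wvar Y w' <= wvar Y w.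
  by move=> hw'; apply: wmax; rewrite inE.
have [w0 w1] := Ww; set z := wmean Y w; set V := wvar Y w in wmax.
have hV i : eucl z (Y i) ^+ 2 <= V by exact: wvar_le.
exists z => [v|].
  have [i [_ wi h]] := @exists_ge_average R _ (index_enum _) (fun i => w ord0 i)
    (fun i => dot v (Y i)) (fun i _ => w0 i) w1.
  exists (Y i) => //; apply: le_trans h.
  rewrite dotC /z /wmean dot_suml.
  by apply: ler_sum => j _; rewrite dotZl dotC.
suff VJ : V <= (Jconst R n * d) ^+ 2.
  move=> x; rewrite -[l]/(tval (in_tuple l)) => /tnthP[i ->].
  apply: le_of_sqr; first by rewrite mulr_ge0// Jconst_ge0.
  exact: le_trans (hV i) VJ.
have V0 : 0 <= V by apply: le_trans (hV ord0); exact: sqr_ge0.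
pose u i := Y i - z.
have mean0 : \sum_i w ord0 i *: u i = 0.
  rewrite /u; under eq_bigr do rewrite scalerBr.
  by rewrite sumrB -scaler_suml w1 scale1r /z /wmean subrr.
have usq i : dot (u i) (u i) <= V by rewrite -eucl_sqr eucl_sym.
have varE : \sum_i w ord0 i * dot (u i) (u i) = V.
  have zz : \sum_i w ord0 i * dot (Y i) z = dot z z.
    by rewrite {3}/z /wmean dot_suml; apply: eq_bigr => i _; rewrite dotZl.
  rewrite /u; under eq_bigr do rewrite dotBl !dotBr (dotC z) mulrBr mulrBr mulrBr.
  rewrite !sumrB -mulr_suml w1 mul1r zz subrr subr0 /V /wvar -/z; congr (_ - _).
  by apply: eq_bigr => i _; rewrite mxE.
(* Complementary slackness: the squared lengths average to [V] and none exceeds [V]. *)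
have tight i : w ord0 i != 0 -> dot (u i) (u i) = V.
  move=> wi; have : \sum_i w ord0 i * (V - dot (u i) (u i)) == 0.
    under eq_bigr do rewrite mulrBr.
    by rewrite sumrB -mulr_suml w1 mul1r varE subrr.
  rewrite psumr_eq0 => [/allP/(_ i)|j _]; last by rewrite mulr_ge0// subr_ge0.
  by rewrite mem_index_enum/= mulf_eq0 (negbTE wi)/= subr_eq0 => /(_ isT)/eqP.
pose c := d ^+ 2 / 2.
(* On the support the products [g] lie between [V - c] and [V], so [(g - (V - c)) * (V - g) >= 0]
   bounds [g ^+ 2] by an affine function. Its linear part vanishes on averaging because the [u i]
   have mean zero. *)
have quad i j : w ord0 i * w ord0 j * dot (u i) (u j) ^+ 2 <=
    (2 * V - c) * (w ord0 i * w ord0 j * dot (u i) (u j)) -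
    w ord0 i * w ord0 j * (V * (V - c)).
  have [->|wi] := eqVneq (w ord0 i) 0; first by rewrite !mul0r !mulr0 subrr.
  have [->|wj] := eqVneq (w ord0 j) 0; first by rewrite mulr0 !mul0r !mulr0 subrr.
  have ti := tight i wi; have tj := tight j wj.
  have g1 : V - c <= dot (u i) (u j).
    have := hd _ _ (Yl i) (Yl j) => /(lerXn2r 2).
    rewrite !nnegrE eucl_ge0 d0 => /(_ isT isT).
    have -> : eucl (Y i) (Y j) ^+ 2 = 2 * V - 2 * dot (u i) (u j).
      rewrite eucl_sqr (_ : Y i - Y j = u i - u j).
        by rewrite dot_sqrB ti tj; ring.
      by rewrite /u opprB addrA subrK.
    by rewrite /c; lra.
  have g2 : dot (u i) (u j) <= V.
    by have := dot_ge0 (u i - u j); rewrite dot_sqrB ti tj; lra.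
  have ww : 0 <= w ord0 i * w ord0 j by rewrite mulr_ge0.
  set g := dot _ _ in g1 g2 *; have gg : 0 <= (g - (V - c)) * (V - g).
    by rewrite mulr_ge0 ?subr_ge0.
  have := mulr_ge0 ww gg; lra.
have main : V ^+ 2 <= n%:R * (V * (c - V)).
  apply: (le_trans (wvar_sqr_le Y Ww)); rewrite ler_wpM2l// -/z.
  apply: (@le_trans _ _ (\sum_i \sum_j ((2 * V - c) *
      (w ord0 i * w ord0 j * dot (u i) (u j)) -
      w ord0 i * w ord0 j * (V * (V - c))))).
    by apply: ler_sum => i _; apply: ler_sum => j _; exact: quad.
  have z1 : \sum_i \sum_j w ord0 i * w ord0 j * dot (u i) (u j) = 0.
    transitivity (dot (\sum_i w ord0 i *: u i) (\sum_i w ord0 i *: u i)).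
      rewrite dot_suml; apply: eq_bigr => i _; rewrite dotC dot_suml.
      by apply: eq_bigr => j _; rewrite !dotZl dotZr dotC; ring.
    by rewrite mean0 dot0l.
  have z2 : \sum_i \sum_j w ord0 i * w ord0 j = 1.
    by under eq_bigr do rewrite -mulr_sumr w1 mulr1; rewrite w1.
  under eq_bigr do rewrite sumrB -mulr_sumr -mulr_suml.
  by rewrite sumrB -mulr_sumr -mulr_suml z1 z2; lra.
have [V00|V00] := eqVneq V 0; first by rewrite V00 sqr_ge0.
have V1 : 0 < V by rewrite lt_def V00.
rewrite exprMn sqr_Jconst; have n0 : 0 < 2 * n.+1%:R :> R by rewrite mulr_gt0.
rewrite mulrAC ler_pdivlMr// -natr1.
have : V <= n%:R * (c - V).
  by rewrite -(ler_pM2l V1) mulrCA -expr2.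
by rewrite /c; lra.
Qed.

(** * Hulls of finite sets and their circumcenters *)

Section Hull.
Context (R : realType) (n : nat).
Implicit Types (s : seq 'rV[R]_n) (a q x z : 'rV[R]_n) (r d : R).

Lemma inhull_mem s x : x \in s -> inhull s x.
Proof. by move=> xs v; exists x. Qed.

Lemma inhull_sub s s' q : {subset s <= s'} -> inhull s q -> inhull s' q.
Proof. by move=> ss' h v; have [x /ss'] := h v; exists x. Qed.

Lemma inhull_average (I : eqType) (l : seq I) (w : I -> R) (y : I -> 'rV[R]_n) s :
  (forall i, i \in l -> 0 <= w i) -> \sum_(i <- l) w i = 1 ->
  (forall i, i \in l -> 0 < w i -> inhull s (y i)) ->
  inhull s (\sum_(i <- l) w i *: y i).
Proof.
move=> w0 w1 hy v.
have [i [il wi h]] := exists_ge_average (fun i => dot v (y i)) w0 w1.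
have [x xs hx] := hy i il wi v; exists x => //; apply: le_trans hx.
apply: le_trans h; rewrite dotC dot_suml; apply: ler_sum => j _.
by rewrite dotZl dotC.
Qed.

Lemma inhull_ball s q a r : inhull s q -> (forall x, x \in s -> eucl a x <= r) ->
  eucl a q <= r.
Proof.
move=> h hr; have [x xs hx] := h (q - a).
have := dot_le (q - a) (x - a); rewrite -!euclE dotBr !(eucl_sym _ a) => h1.
have h2 : eucl a q ^+ 2 = dot (q - a) q - dot (q - a) a.
  by rewrite eucl_sym eucl_sqr dotBr.
have [->|q0] := eqVneq (eucl a q) 0.
  exact: le_trans (eucl_ge0 a x) (hr x xs).
have q1 : 0 < eucl a q by rewrite lt_def q0 eucl_ge0.
rewrite -(ler_pM2l q1) -expr2 h2.
apply: (@le_trans _ _ (eucl a q * eucl a x)); first lra.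
by rewrite ler_wpM2l ?eucl_ge0// hr.
Qed.

(** For the vertex [x] given by the functional [q - z], the angle at [q] in the triangle [z], [q],
    [x] is not acute, so [x] is at least as close to [q] as to [z]. *)
Lemma inhull_near s q z r : inhull s q -> (forall x, x \in s -> eucl z x <= r) ->
  exists2 x, x \in s & eucl q x <= r.
Proof.
move=> h hr; have [x xs hx] := h (q - z); exists x => //.
apply: le_trans (hr x xs); apply: le_of_sqr; first exact: eucl_ge0.
have e : eucl z x ^+ 2 = eucl q x ^+ 2 + dot (q - z) (q - z) +
    2 * (dot (q - z) x - dot (q - z) q).
  rewrite !eucl_sqr -dotBr (_ : z - x = (q - x) - (q - z)); last first.
    by rewrite opprB [RHS]addrC subrKA.
  rewrite (dot_sqrB (q - x)) -[x - q]opprB (dotC (q - z) (- _)) dotNl.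
  by ring.
by have := dot_ge0 (q - z); lra.
Qed.

(** Jung's theorem for the exact diameter [D], so that one center serves every bound [d] and can be
    chosen from the set alone. *)
Lemma jung_center s : s != [::] ->
  exists z, inhull s z /\ forall d, (forall x y, x \in s -> y \in s -> eucl x y <= d) ->
    forall x, x \in s -> eucl z x <= Jconst R n * d.
Proof.
move=> s0; pose D := \big[Num.max/0]_(p <- [seq (x, y) | x <- s, y <- s])
  eucl p.1 p.2.
have hD x y : x \in s -> y \in s -> eucl x y <= D.
  by move=> xs ys; apply: (le_bigmax_seq _ (x, y)) => //; apply/allpairsP; exists (x, y).
have [z hz zD] := jung s0 hD; exists z; split=> // d hd x xs.
apply: le_trans (zD x xs) _; rewrite ler_wpM2l ?Jconst_ge0//.
rewrite /D big_seq; apply: bigmax_le; first by rewrite -(eucl_xx x) hd.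
by move=> _ /allpairsP[[a b] [/= sa sb ->]]; exact: hd.
Qed.

Definition circumcenter s : 'rV[R]_n := xget 0 [set z | inhull s z /\
  forall d, (forall x y, x \in s -> y \in s -> eucl x y <= d) ->
    forall x, x \in s -> eucl z x <= Jconst R n * d].

Lemma circumcenterP s : s != [::] -> inhull s (circumcenter s) /\
  forall d, (forall x y, x \in s -> y \in s -> eucl x y <= d) ->
    forall x, x \in s -> eucl (circumcenter s) x <= Jconst R n * d.
Proof.
by move=> /jung_center[z hz]; rewrite /circumcenter; case: xgetP => [_ ->|/(_ z)].
Qed.

End Hull.

(** * Projecting hulls of small subsets of [M] *)

Section Tube.
Context (R : realType) (n : nat) (M : set 'rV[R]_n) (k r : R).
Implicit Types (s : seq 'rV[R]_n) (a b q x y z : 'rV[R]_n) (d : R).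
Local Notation J := (Jconst R n).
Hypothesis closedM : closed M.
Hypothesis k0 : 0 <= k.
Hypothesis unip : forall x y, M y -> k * eucl x y < 1 ->
  exists! a, nearest M x a.
Hypothesis J_ge : 1 / 2 <= J.
Hypothesis kr : k * (J * r) < 1 - J.

Let E := (1 - k * (J * r))^-1.

Let kr1 : k * (J * r) < 1.
Proof. by apply: lt_le_trans kr _; rewrite gerDl oppr_le0 Jconst_ge0. Qed.

Let kr2 : k * (J * r) < 1 / 2.
Proof. by move: J_ge kr; lra. Qed.

Let E0 : 0 <= E.
Proof. by rewrite invr_ge0 subr_ge0 ltW. Qed.

Definition spread s d := [/\ s != [::], forall x, x \in s -> M x,
  forall x y, x \in s -> y \in s -> eucl x y <= d & d <= r].

Let tube_le t d : d <= r -> t <= J * d -> k * t <= k * (J * r).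
Proof.
by move=> dr td; rewrite ler_wpM2l// (le_trans td)// ler_wpM2l// Jconst_ge0.
Qed.

Lemma hull_near_vertex s d q : spread s d -> inhull s q ->
  exists2 x, x \in s & eucl q x <= J * d.
Proof. by move=> [s0 sM sd dr] hq; apply: inhull_near hq ((circumcenterP s0).2 d sd). Qed.

Lemma hull_nearest s d q : spread s d -> inhull s q ->
  exists2 a, nearest M q a & eucl q a <= J * d.
Proof.
move=> sd hq; have [x xs xq] := hull_near_vertex sd hq; case: sd => [s0 sM sd dr].
have [|a [na _]] := unip (sM x xs) (x := q).
  exact: (le_lt_trans (tube_le dr xq) kr1).
by exists a => //; apply: le_trans xq; exact: na.2 _ (sM x xs).
Qed.

Lemma hull_tube s d q a : spread s d -> inhull s q -> nearest M q a ->
  k * eucl q a <= k * (J * r).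
Proof.
move=> sd hq na; have [x xs xq] := hull_near_vertex sd hq.
case: sd => [s0 sM sd dr]; apply: (tube_le dr).
by apply: le_trans xq; exact: na.2 _ (sM x xs).
Qed.

Lemma tube_lip x y a b : nearest M x a -> nearest M y b ->
  k * eucl x a <= k * (J * r) -> k * eucl y b <= k * (J * r) ->
  eucl a b <= E * eucl x y.
Proof.
move=> na nb; exact: (nearest_lip_unif closedM k0 unip na nb kr1).
Qed.

Lemma nearest_self x : M x -> nearest M x x.
Proof. by move=> Mx; split=> // z _; rewrite eucl_xx eucl_ge0. Qed.

(** The circumcenter is within [J * d] of the vertices, hence of the whole hull, and the projection
    stretches by at most [E]. As [q] may come from the hull of a subset, this compares a set with
    all its subsets. *)
Lemma center_close s d q a b : spread s d -> inhull s q ->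
  nearest M q a -> nearest M (circumcenter s) b -> eucl a b <= E * J * d.
Proof.
move=> sd hq na nb; have [cs hc] := circumcenterP (let: And4 h _ _ _ := sd in h).
apply: le_trans (tube_lip na nb (hull_tube sd hq na) (hull_tube sd cs nb)) _.
rewrite -mulrA ler_wpM2l//.
rewrite eucl_sym; apply: (inhull_ball hq).
by case: sd => _ _ sd _; exact: hc.
Qed.

Lemma hull_proj_near s d q a : spread s d -> inhull s q -> nearest M q a ->
  exists2 x, x \in s & eucl a x <= E * J * d.
Proof.
move=> sd hq na; have [x xs xq] := hull_near_vertex sd hq; exists x => //.
have Mx : M x by case: sd => _ h _ _; exact: h.
have J0 : 0 <= k * (J * r) by case: sd => _ _ h dr;
  rewrite mulr_ge0// mulr_ge0 ?Jconst_ge0// (le_trans _ dr)// -(eucl_xx x) h.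
have := tube_lip na (nearest_self Mx) (hull_tube sd hq na).
rewrite eucl_xx mulr0 => /(_ J0)/le_trans; apply.
by rewrite -mulrA ler_wpM2l.
Qed.

(** A vertex [x] beyond the hyperplane through [z] normal to [z - b] gives
    [t ^+ 2 <= dot (z - b) (x - b)], and Federer's inequality turns this into [t <= k * l ^+ 2 / 2].
    The Lipschitz bound gives [l <= 4 / 3 * (J * r)], so [k * (J * r) < 1 / 2] yields [4 / 9], which
    is below [1 / 2]. *)
Lemma center_depth s d b : spread s d -> nearest M (circumcenter s) b ->
  eucl (circumcenter s) b <= J * r / 2.
Proof.
move=> sd nb; have [cs hc] := circumcenterP (let: And4 h _ _ _ := sd in h).
have kb := hull_tube sd cs nb; case: sd => _ sM sd dr.
set z := circumcenter s in nb cs hc kb *; set t := eucl z b in kb *.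
have [x xs hx] := cs (z - b).
have Mx := sM x xs.
have zx : eucl z x <= J * r.
  by apply: le_trans (hc d sd x xs) _; rewrite ler_wpM2l// Jconst_ge0.
have Jr : 0 <= J * r := le_trans (eucl_ge0 z x) zx.
have kJr := kr2.
have k1 : k * eucl z b < 1 := le_lt_trans kb kr1.
have h1 := nearest_dot closedM k0 unip nb k1 Mx; rewrite -/t in h1.
have := nearest_lip closedM k0 unip nb (nearest_self Mx) k1.
rewrite eucl_xx mulr0 addr0 -/t => /(_ ltr01) h2.
have t2 : t ^+ 2 <= dot (z - b) (x - b).
  by rewrite /t eucl_sqr !(dotBr (z - b)); lra.
set l := eucl b x in h1 h2.
have l0 : 0 <= l by exact: eucl_ge0.
have t0 : 0 <= t by exact: eucl_ge0.
have l1 : l <= 4 / 3 * (J * r) by nra.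
have [->|t00] := eqVneq t 0; first by rewrite divr_ge0.
have t1 : 0 < t by rewrite lt_def t00.
have t3 : t <= k * l ^+ 2 / 2.
  by rewrite -(ler_pM2l t1) -expr2; lra.
have l2 : l ^+ 2 <= (4 / 3 * (J * r)) ^+ 2 by rewrite lerXn2r ?nnegrE// mulr_ge0.
have := ler_wpM2l k0 l2; nra.
Qed.

End Tube.

(** * Lengths of the level intervals of a finite function *)

Section BigMax.
Local Open Scope fset_scope.
Local Open Scope ring_scope.
Context (R : realType) (V : choiceType).
Implicit Types (S T : {fset V}) (w : V -> R) (a t : R).

Lemma bigmax_base (s : seq V) w a b :
  \big[Num.max/Num.max b a]_(i <- s) w i = Num.max b (\big[Num.max/a]_(i <- s) w i).
Proof. by elim: s => [|i s IH]; rewrite ?big_nil// !big_cons IH maxCA. Qed.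

Lemma bigmin_base (s : seq V) w a b :
  \big[Num.min/Num.min b a]_(i <- s) w i = Num.min b (\big[Num.min/a]_(i <- s) w i).
Proof. by elim: s => [|i s IH]; rewrite ?big_nil// !big_cons IH minCA. Qed.

Lemma eq_mem_bigmax (s s' : seq V) w a : s =i s' ->
  \big[Num.max/a]_(i <- s) w i = \big[Num.max/a]_(i <- s') w i.
Proof.
by move=> ss'; apply/eqP; rewrite eq_le; apply/andP; split;
  apply: sub_bigmax_seq => i; rewrite ss'.
Qed.

Lemma eq_mem_bigmin (s s' : seq V) w a : s =i s' ->
  \big[Num.min/a]_(i <- s) w i = \big[Num.min/a]_(i <- s') w i.
Proof.
by move=> ss'; apply/eqP; rewrite eq_le; apply/andP; split;
  apply: sub_bigmin_seq => i; rewrite ss'.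
Qed.

Lemma big_fpowersetU1 (F : {fset V} -> R) S i : i \notin S ->
  \sum_(T <- fpowerset (i |` S)) F T =
  \sum_(T <- fpowerset S) F T + \sum_(T <- fpowerset S) F (i |` T).
Proof.
move=> iS; rewrite (big_fsetID _ (fun T => i \notin T))/=; congr (_ + _).
  apply: eq_fbigl => T; rewrite !inE/= !fpowersetE.
  apply/andP/idP => [[/fsubsetP TS iT]|TS].
    apply/fsubsetP => x xT; have := TS x xT; rewrite !inE => /orP[/eqP xi|//].
    by rewrite -xi xT in iT.
  split; first by rewrite (fsubset_trans TS) ?fsubsetU1.
  by apply: contra iS; exact: (fsubsetP TS).
transitivity (\sum_(T <- [fset i |` T | T in fpowerset S]) F T); last first.
  rewrite big_imfset//= => A B; rewrite !fpowersetE => /fsubsetP AS /fsubsetP BS AB.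
  apply/fsetP => x; have [->|xi] := eqVneq x i.
    by apply/idP/idP => [/AS|/BS]; rewrite (negbTE iS).
  by have /fsetP/(_ x) := AB; rewrite !inE (negbTE xi).
apply: eq_fbigl => T; rewrite !inE/= fpowersetE negbK.
apply/andP/imfsetP => /= [[TS iT]|[A]].
  exists (T `\ i); last by rewrite fsetD1K.
  rewrite fpowersetE; apply/fsubsetP => x; rewrite !inE => /andP[xi xT].
  by have := fsubsetP TS x xT; rewrite !inE (negbTE xi).
by rewrite fpowersetE => AS ->; rewrite fsetUS// fset1U1.
Qed.

(* Length of the set of levels [u] in [a, t] with [{i in S | w i > u} = T]. *)
Definition level_len S w a t T : R :=
  Num.max 0 (\big[Num.min/t]_(i <- T) w i - \big[Num.max/a]_(i <- S `\` T) w i).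

Lemma level_len_notin S w a t T i : i \notin S -> T `<=` S ->
  level_len (i |` S) w a t T = level_len S w (Num.max (w i) a) t T.
Proof.
move=> iS TS; rewrite /level_len bigmax_base; congr (Num.max _ (_ - _)).
have iT : i \notin T by apply: contra iS; exact: (fsubsetP TS).
transitivity (\big[Num.max/a]_(j <- i :: (S `\` T)) w j); last by rewrite big_cons.
apply: eq_mem_bigmax => x; rewrite !inE.
by have [->|_] := eqVneq x i; rewrite ?iT.
Qed.

Lemma level_len_in S w a t T i : i \notin S -> T `<=` S ->
  level_len (i |` S) w a t (i |` T) = level_len S w a (Num.min (w i) t) T.
Proof.
move=> iS TS; rewrite /level_len bigmin_base; congr (Num.max _ (_ - _)).
  transitivity (\big[Num.min/t]_(j <- i :: T) w j); last by rewrite big_cons.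
  apply: eq_mem_bigmin => x.
  by rewrite !inE.
apply: eq_mem_bigmax => x; rewrite !inE.
by have [->|_] := eqVneq x i; rewrite ?(negbTE iS) ?andbF.
Qed.

(** The intervals of the superlevel sets tile [[a, t]]. In the induction the value [w i] cuts the
    interval: [i] belongs to the superlevel sets of the levels below it and to none above. *)
Lemma sum_level_len S w a t :
  \sum_(T <- fpowerset S) level_len S w a t T = Num.max 0 (t - a).
Proof.
elim/finSet_rect: S a t => S IH a t.
have [->|[i iS]] := fset_0Vmem S.
  rewrite fpowerset0 big_seq_fset1 /level_len fsetD0.
  by rewrite (@eq_mem_bigmax fset0 [::])// (@eq_mem_bigmin fset0 [::])// !big_nil.
have iD : i \notin S `\ i by rewrite !inE eqxx.
rewrite -(fsetD1K iS) big_fpowersetU1//.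
rewrite [X in X + _]big_seq_cond [X in _ + X]big_seq_cond.
under eq_bigr => T /andP[TS _].
  rewrite level_len_notin//; last by rewrite -fpowersetE.
  over.
under [X in _ + X]eq_bigr => T /andP[TS _].
  rewrite level_len_in//; last by rewrite -fpowersetE.
  over.
rewrite -!big_seq_cond !IH ?fproperD1//.
rewrite !maxEle !minEle; case: (leP (w i) a) => ?; case: (leP (w i) t) => ?;
  repeat (case: ifPn => ?); lra.
Qed.

Lemma sum_level_len_mem S w a t i : i \in S ->
  \sum_(T <- fpowerset S | i \in T) level_len S w a t T =
  Num.max 0 (Num.min (w i) t - a).
Proof.
move=> iS; have iD : i \notin S `\ i by rewrite !inE eqxx.
rewrite big_mkcond/= -(fsetD1K iS) big_fpowersetU1//.
rewrite [X in X + _]big_seq [X in _ + X]big_seq.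
rewrite big1 ?add0r => [|T]; last first.
  rewrite fpowersetE => /fsubsetP TS; case: ifPn => // iT.
  by have := TS i iT; rewrite (negbTE iD).
under eq_bigr => T TS.
  rewrite fset1U1 level_len_in//; last by rewrite -fpowersetE.
  over.
by rewrite -big_seq sum_level_len.
Qed.

End BigMax.

(** * Finitely supported weights and the homotopy over superlevel sets *)

Section WeightOps.
Local Open Scope fset_scope.
Local Open Scope ring_scope.
Context (R : realType).
Implicit Types (V : choiceType) (t a : R).

Definition mass V (w : {fsfun V -> R with 0}) : R := \sum_(v <- finsupp w) w v.

Definition bary V (L : lmodType R) (j : V -> L) (w : {fsfun V -> R with 0}) : L :=
  \sum_(v <- finsupp w) w v *: j v.

Definition prob V (w : {fsfun V -> R with 0}) : Prop :=
  (forall v, 0 <= w v) /\ mass w = 1.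

Lemma sum_finsupp V (A : nmodType) (F : V -> R -> A) (w : {fsfun V -> R with 0})
    (S : {fset V}) : finsupp w `<=` S -> (forall v, F v 0 = 0) ->
  \sum_(v <- finsupp w) F v (w v) = \sum_(v <- S) F v (w v).
Proof.
by move=> wS F0; apply: big_fset_incl => // v _ /fsfun_dflt ->.
Qed.

Lemma mass_sub V (w : {fsfun V -> R with 0}) (S : {fset V}) :
  finsupp w `<=` S -> mass w = \sum_(v <- S) w v.
Proof. by move=> wS; apply: (sum_finsupp (F := fun _ a => a)). Qed.

Lemma bary_sub V (L : lmodType R) (j : V -> L) (w : {fsfun V -> R with 0})
    (S : {fset V}) : finsupp w `<=` S -> bary j w = \sum_(v <- S) w v *: j v.
Proof.
by move=> wS; apply: (sum_finsupp (F := fun v a => a *: j v)) => // v; rewrite scale0r.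
Qed.

Lemma massE V (w : {fsfun V -> R with 0}) : mass w = bary (fun=> 1 : R^o) w.
Proof. by apply: eq_bigr => v _; rewrite /GRing.scale/= mulr1. Qed.

Lemma weight_le_mass V (w : {fsfun V -> R with 0}) v :
  (forall u, 0 <= w u) -> w v <= mass w.
Proof.
move=> w0; rewrite (@mass_sub _ _ (v |` finsupp w)) ?fsubsetU1//.
by rewrite (big_fsetD1 v) ?fset1U1//= lerDl sumr_ge0.
Qed.

Lemma prob_le1 V (w : {fsfun V -> R with 0}) v : prob w -> w v <= 1.
Proof. by move=> [w0 <-]; exact: weight_le_mass. Qed.

Lemma mem_supp_gt0 V (w : {fsfun V -> R with 0}) v :
  (forall u, 0 <= w u) -> (v \in finsupp w) = (0 < w v).
Proof. by move=> w0; rewrite mem_finsupp lt_def w0 andbT. Qed.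

Lemma prob_supp_neq0 V (w : {fsfun V -> R with 0}) : prob w -> finsupp w != fset0.
Proof.
move=> [_ w1]; apply/eqP => w0; move: w1; rewrite /mass w0 big_seq_fset0.
by move/esym/eqP; rewrite oner_eq0.
Qed.

Definition comb V a (u w : {fsfun V -> R with 0}) : {fsfun V -> R with 0} :=
  [fsfun v in finsupp u `|` finsupp w => a * u v + w v].

Lemma combE V a (u w : {fsfun V -> R with 0}) v : comb a u w v = a * u v + w v.
Proof.
rewrite fsfunE inE; case: ifPn => //; rewrite negb_or => /andP[hu hw].
by rewrite (fsfun_dflt hu) (fsfun_dflt hw) mulr0 addr0.
Qed.

Lemma bary_comb V (L : lmodType R) (j : V -> L) a (u w : {fsfun V -> R with 0}) :
  bary j (comb a u w) = a *: bary j u + bary j w.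
Proof.
pose S := finsupp u `|` finsupp w.
rewrite (@bary_sub _ _ _ (comb a u w) S) ?finsupp_sub//.
rewrite (@bary_sub _ _ _ u S) ?fsubsetUl// (@bary_sub _ _ _ w S) ?fsubsetUr//.
rewrite scaler_sumr -big_split; apply: eq_bigr => v _.
by rewrite combE scalerDl scalerA.
Qed.

Lemma mass_comb V a (u w : {fsfun V -> R with 0}) :
  mass (comb a u w) = a * mass u + mass w.
Proof. by rewrite !massE bary_comb. Qed.

Definition scale V a (u : {fsfun V -> R with 0}) : {fsfun V -> R with 0} :=
  [fsfun v in finsupp u => a * u v].

Lemma scaleE V a (u : {fsfun V -> R with 0}) v : scale a u v = a * u v.
Proof. by rewrite fsfunE; case: finsuppP => // hu; rewrite mulr0. Qed.

Lemma mass_scale V a (u : {fsfun V -> R with 0}) : mass (scale a u) = a * mass u.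
Proof.
rewrite (@mass_sub _ (scale a u) (finsupp u)) ?finsupp_sub// mulr_sumr.
by apply: eq_bigr => v _; rewrite scaleE.
Qed.

Definition push V V' (j : V -> V') (w : {fsfun V -> R with 0}) :
    {fsfun V' -> R with 0} :=
  [fsfun v' in [fset j v | v in finsupp w] =>
     \sum_(v <- finsupp w | j v == v') w v].

Lemma pushE V V' (j : V -> V') (w : {fsfun V -> R with 0}) v' :
  push j w v' = \sum_(v <- finsupp w | j v == v') w v.
Proof.
rewrite fsfunE; case: ifPn => // h; rewrite big1_seq// => v /andP[/eqP vv' vw].
by move: h; rewrite -vv' in_imfset.
Qed.

Lemma push_sub V V' (j : V -> V') (w : {fsfun V -> R with 0}) v' (S : {fset V}) :
  finsupp w `<=` S -> push j w v' = \sum_(v <- S | j v == v') w v.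
Proof.
move=> wS; rewrite pushE big_mkcond [RHS]big_mkcond.
by apply: (sum_finsupp (F := fun v a => if j v == v' then a else 0)) => // v; case: ifP.
Qed.

Lemma supp_push V V' (j : V -> V') (w : {fsfun V -> R with 0}) v' :
  v' \in finsupp (push j w) -> exists2 v, v \in finsupp w & v' = j v.
Proof. by move/(fsubsetP (finsupp_sub _ _ _))/imfsetP. Qed.

Lemma supp_push_sub (V V' : choiceType) (j : V -> V') (w : {fsfun V -> R with 0}) S :
  finsupp w `<=` S -> finsupp (push j w) `<=` [fset j v | v in S].
Proof.
move=> /fsubsetP wS; apply/fsubsetP => _ /supp_push[v vw ->].
by rewrite in_imfset//=; exact: wS.
Qed.

Lemma bary_push V V' (L : lmodType R) (i : V' -> L) (j : V -> V')
    (w : {fsfun V -> R with 0}) : bary i (push j w) = bary (i \o j) w.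
Proof.
rewrite (@bary_sub _ _ _ (push j w) [fset j v | v in finsupp w]) ?finsupp_sub//.
rewrite /bary (partition_big_imfset _ j); apply: eq_bigr => v' _.
by rewrite pushE scaler_suml; apply: eq_bigr => v /eqP <-.
Qed.

Lemma mass_push V V' (j : V -> V') (w : {fsfun V -> R with 0}) :
  mass (push j w) = mass w.
Proof. by rewrite !massE bary_push. Qed.

Lemma push_push V V' V'' (i : V' -> V'') (j : V -> V') (w : {fsfun V -> R with 0}) :
  push i (push j w) = push (i \o j) w.
Proof.
apply/fsfunP => u; rewrite (@push_sub _ _ _ (push j w) _ [fset j v | v in finsupp w]);
  last exact: finsupp_sub.
rewrite [RHS]pushE [RHS]big_mkcond (partition_big_imfset _ j) big_mkcond/=.
apply: eq_bigr => v' _; case: ifPn => h.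
  by rewrite pushE; apply: eq_bigr => v /eqP ->; rewrite h.
by rewrite big1// => v /eqP ->; rewrite (negbTE h).
Qed.

Lemma push_ge0 V V' (j : V -> V') (w : {fsfun V -> R with 0}) :
  (forall v, 0 <= w v) -> forall v', 0 <= push j w v'.
Proof. by move=> w0 v'; rewrite pushE sumr_ge0. Qed.

Lemma prob_push V V' (j : V -> V') (w : {fsfun V -> R with 0}) :
  prob w -> prob (push j w).
Proof. by move=> [w0 w1]; split; [exact: push_ge0|rewrite mass_push]. Qed.

Lemma prob_inhull n V (j : V -> 'rV[R]_n) (w : {fsfun V -> R with 0}) s : prob w ->
  (forall v, v \in finsupp w -> inhull s (j v)) -> inhull s (bary j w).
Proof. by move=> [w0 w1] h; apply: inhull_average => // v vw _; exact: h. Qed.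

Definition trunc V t (w : {fsfun V -> R with 0}) : {fsfun V -> R with 0} :=
  [fsfun v in finsupp w => Num.max 0 (w v - t)].

Lemma truncE V t (w : {fsfun V -> R with 0}) v : 0 <= t ->
  trunc t w v = Num.max 0 (w v - t).
Proof.
move=> t0; rewrite fsfunE; case: finsuppP => // h.
by rewrite sub0r max_l// oppr_le0.
Qed.

Lemma trunc_ge0 V t (w : {fsfun V -> R with 0}) v : 0 <= trunc t w v.
Proof. by rewrite fsfunE; case: ifP => // _; rewrite le_max lexx. Qed.

Lemma supp_trunc V t (w : {fsfun V -> R with 0}) v :
  v \in finsupp (trunc t w) -> v \in finsupp w /\ t < w v.
Proof.
move=> h; have vw := fsubsetP (finsupp_sub _ _ _) v h; split=> //.
move: h; rewrite mem_finsupp fsfunE vw; apply: contra_neqT.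
by rewrite -leNgt => h; rewrite max_l// subr_le0.
Qed.

(* [w] is the integral over [u] of the indicator functions of the superlevel
   sets [{w > u}]; [levels t w] is the part of that integral below level [t],
   recorded as a measure on superlevel sets. *)
Definition levels V t (w : {fsfun V -> R with 0}) : {fsfun {fset V} -> R with 0} :=
  [fsfun T in fpowerset (finsupp w) =>
     #|` T|%:R * level_len (finsupp w) w 0 t T].

Lemma level_len_ge0 V (S : {fset V}) (w : V -> R) a t T : 0 <= level_len S w a t T.
Proof. by rewrite le_max lexx. Qed.

Lemma level_len_gt0 V (S : {fset V}) (w : V -> R) t T :
  level_len S w 0 t T != 0 ->
  [/\ forall i, i \in T -> 0 < w i,
      forall i, i \in S -> i \notin T -> w i < t
    & forall i j, i \in T -> j \in S -> j \notin T -> w j < w i].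
Proof.
move=> h; have {h} : \big[Num.max/0]_(i <- S `\` T) w i < \big[Num.min/t]_(i <- T) w i.
  by rewrite -subr_gt0 ltNge; apply: contra h => h; rewrite /level_len max_l.
set a := \big[Num.max/0]_(i <- _) _; set b := \big[Num.min/t]_(i <- _) _ => ab.
have bt : b <= t by exact: bigmin_le_id.
have a0 : 0 <= a by exact: bigmax_ge_id.
have bw i : i \in T -> b <= w i by move=> iT; apply: (ge_bigmin_seq _ i).
have wa j : j \in S -> j \notin T -> w j <= a.
  by move=> jS jT; apply: (le_bigmax_seq _ j) => //; rewrite !inE jT.
split=> [i /bw|i iS /(wa i iS)|i j /bw bi jS /(wa j jS)].
- exact: lt_le_trans (le_lt_trans a0 ab).
- by move=> h; exact: le_lt_trans h (lt_le_trans ab bt).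
- by move=> h; apply: le_lt_trans h (lt_le_trans ab bi).
Qed.

(** A set not contained in the support has level length zero, so the ambient set may be enlarged.
    Continuity needs one [S] for a whole family of weights. *)
Lemma levels_sub V t (w : {fsfun V -> R with 0}) (S T : {fset V}) :
  (forall v, 0 <= w v) -> finsupp w `<=` S ->
  levels t w T = if T `<=` S then #|` T|%:R * level_len S w 0 t T else 0.
Proof.
move=> w0 wS; rewrite fsfunE fpowersetE.
case: ifPn => Tw.
  rewrite (fsubset_trans Tw wS) /level_len; congr (_ * Num.max _ (_ - _)).
  apply/eqP; rewrite eq_le; apply/andP; split.
    apply: sub_bigmax_seq => i; rewrite !inE => /andP[-> /=].
    exact: (fsubsetP wS).
  rewrite big_seq; apply: bigmax_le; first exact: bigmax_ge_id.
  move=> i; rewrite !inE => /andP[iT iS].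
  case: (finsuppP w i) => h; first exact: bigmax_ge_id.
  by apply: (le_bigmax_seq _ i) => //; rewrite !inE iT.
case: ifPn => // TS.
have [->|h] := eqVneq (level_len S w 0 t T) 0; first by rewrite mulr0.
have [pos _ _] := level_len_gt0 h.
case/negP: Tw; apply/fsubsetP => i /pos.
by rewrite mem_supp_gt0.
Qed.

Lemma supp_levels V t (w : {fsfun V -> R with 0}) T : T \in finsupp (levels t w) ->
  [/\ T != fset0, T `<=` finsupp w, forall i, i \in finsupp w -> t <= w i -> i \in T
    & forall i j, i \in T -> j \in finsupp w -> w i <= w j -> j \in T].
Proof.
move=> h; have := fsubsetP (finsupp_sub _ _ _) T h; rewrite fpowersetE => Tw.
move: h; rewrite mem_finsupp fsfunE fpowersetE Tw mulf_eq0 negb_or => /andP[T0 h].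
have [pos lt_t lt_w] := level_len_gt0 h.
split=> //.
- by apply: contra T0 => /eqP ->; rewrite cardfs0.
- move=> i iw ti; apply: contraTT ti => iT; rewrite -ltNge; exact: lt_t.
- move=> i j iT jw ij; apply: contraTT ij => jT; rewrite -ltNge; exact: lt_w.
Qed.

Lemma supp_levels_chain V t (w : {fsfun V -> R with 0}) T T' :
  T \in finsupp (levels t w) -> T' \in finsupp (levels t w) ->
  T `<=` T' \/ T' `<=` T.
Proof.
move=> /supp_levels[_ Tw _ hT] /supp_levels[_ Tw' _ hT'].
have [TT'|] := boolP (T `<=` T'); first by left.
move=> /fsubsetPn[i iT iT']; right; apply/fsubsetP => j jT'.
apply: (hT i) => //; first exact: (fsubsetP Tw').
rewrite leNgt; apply: contra iT' => /ltW ji.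
by apply: (hT' j) => //; exact: (fsubsetP Tw).
Qed.

Lemma levels_ge0 V t (w : {fsfun V -> R with 0}) T : 0 <= levels t w T.
Proof. by rewrite fsfunE; case: ifP => // _; rewrite mulr_ge0// level_len_ge0. Qed.

Lemma mass_levels V t (w : {fsfun V -> R with 0}) : (forall v, 0 <= w v) -> 0 <= t ->
  mass (levels t w) = \sum_(v <- finsupp w) Num.min (w v) t.
Proof.
move=> w0 t0; rewrite (@mass_sub _ (levels t w) (fpowerset (finsupp w)));
  last exact: finsupp_sub.
rewrite big_seq.
transitivity (\sum_(T <- fpowerset (finsupp w)) \sum_(v <- finsupp w)
    (if v \in T then level_len (finsupp w) w 0 t T else 0)).
  rewrite [RHS]big_seq; apply: eq_bigr => T TS; rewrite fsfunE TS.
  rewrite -big_mkcond/= big_const_seq/= iter_addr_0 mulr_natl; congr (_ *+ _).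
  rewrite -size_filter; apply: perm_size; apply: uniq_perm.
  - exact: fset_uniq.
  - by rewrite filter_uniq// fset_uniq.
  move=> v; rewrite mem_filter; rewrite fpowersetE in TS.
  by apply/idP/andP => [vT|[]//]; split=> //; exact: (fsubsetP TS).
rewrite exchange_big/= [LHS]big_seq [RHS]big_seq; apply: eq_bigr => v vw.
rewrite -big_mkcond/= sum_level_len_mem// subr0 max_r//.
by rewrite le_min w0.
Qed.

Lemma mass_trunc V t (w : {fsfun V -> R with 0}) : prob w -> 0 <= t ->
  mass (trunc t w) + mass (levels t w) = 1.
Proof.
move=> [w0 w1] t0; rewrite mass_levels// (@mass_sub _ (trunc t w) (finsupp w));
  last exact: finsupp_sub.
rewrite -big_split -w1; apply: eq_bigr => v _ /=.
rewrite truncE// maxEle minEle; repeat (case: ifPn => ?); lra.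
Qed.

Lemma mass_trunc_ge0 V t (w : {fsfun V -> R with 0}) : 0 <= mass (trunc t w).
Proof. by apply: sumr_ge0 => v _; exact: trunc_ge0. Qed.

(** If the truncated mass is zero, this is the zero function and not a probability; in [layer] its
    image is then multiplied by zero. *)
Definition ntrunc V t (w : {fsfun V -> R with 0}) : {fsfun V -> R with 0} :=
  scale (mass (trunc t w))^-1 (trunc t w).

Lemma prob_ntrunc V t (w : {fsfun V -> R with 0}) : mass (trunc t w) != 0 ->
  prob (ntrunc t w).
Proof.
move=> m0; split=> [v|]; last by rewrite mass_scale mulVf.
by rewrite scaleE mulr_ge0 ?trunc_ge0// invr_ge0 mass_trunc_ge0.
Qed.

Lemma supp_ntrunc V t (w : {fsfun V -> R with 0}) v :
  v \in finsupp (ntrunc t w) -> v \in finsupp w /\ t < w v.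
Proof. by move/(fsubsetP (finsupp_sub _ _ _)); exact: supp_trunc. Qed.

(* A homotopy from [G] (at [t = 0]) to the map sending each superlevel set
   [T] of [w], with its weight, to the vertex [c T] (at [t = 1]). *)
Definition layer V V' (G : {fsfun V -> R with 0} -> {fsfun V' -> R with 0})
    (c : {fset V} -> V') (w : {fsfun V -> R with 0}) t : {fsfun V' -> R with 0} :=
  comb (mass (trunc t w)) (G (ntrunc t w)) (push c (levels t w)).

Section Layer.
Context (V V' : choiceType) (G : {fsfun V -> R with 0} -> {fsfun V' -> R with 0})
  (c : {fset V} -> V') (w : {fsfun V -> R with 0}).
Hypothesis pw : prob w.

Lemma layer0 : layer G c w 0 = G w.
Proof.
have [w0 w1] := pw.
have tw : trunc 0 w = w by apply/fsfunP => v; rewrite truncE// subr0 max_r.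
have lw T : levels 0 w T = 0.
  apply/eqP; rewrite eq_le levels_ge0 andbT.
  rewrite (le_trans (weight_le_mass T (levels_ge0 0 w)))// mass_levels//.
  by rewrite big1// => v _; rewrite min_r.
apply/fsfunP => v; rewrite combE tw w1 mul1r pushE big1 ?addr0//.
by congr (G _ v); apply/fsfunP => u; rewrite scaleE tw w1 invr1 mul1r.
Qed.

Lemma layer_ge1 t : 1 <= t -> layer G c w t = push c (levels t w).
Proof.
move=> t1; have t0 : 0 <= t by exact: le_trans t1.
apply/fsfunP => v; rewrite combE [X in X * _]big1 ?mul0r ?add0r// => u _.
by rewrite truncE// max_l// subr_le0 (le_trans (prob_le1 u pw)).
Qed.

Lemma prob_layer t : 0 <= t ->
  (forall w', prob w' -> finsupp w' `<=` finsupp w -> prob (G w')) ->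
  prob (layer G c w t).
Proof.
move=> t0 hG; have hm := mass_trunc pw t0.
have hp := push_ge0 c (levels_ge0 t w).
have [m0|m0] := eqVneq (mass (trunc t w)) 0.
  split=> [v|]; first by rewrite combE m0 mul0r add0r.
  by rewrite mass_comb m0 mul0r mass_push -hm m0.
have [G0 G1] : prob (G (ntrunc t w)).
  apply: hG; first exact: prob_ntrunc.
  by apply/fsubsetP => v /supp_ntrunc[].
split=> [v|]; last by rewrite mass_comb G1 mulr1 mass_push.
by rewrite combE addr_ge0// mulr_ge0// mass_trunc_ge0.
Qed.

Lemma supp_layer t v : v \in finsupp (layer G c w t) ->
  (mass (trunc t w) != 0 /\ v \in finsupp (G (ntrunc t w))) \/
  (exists2 T, T \in finsupp (levels t w) & v = c T).
Proof.
rewrite mem_finsupp combE => h.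
have [hv|/fsfun_dflt hv] := boolP (v \in finsupp (push c (levels t w))).
  by right; exact: supp_push hv.
left; move: h; rewrite hv addr0 mulf_eq0 negb_or => /andP[m0 hG].
by split=> //; rewrite mem_finsupp.
Qed.

Lemma layer_all t (P : V' -> Prop) :
  (forall w' v, prob w' -> finsupp w' `<=` finsupp w -> v \in finsupp (G w') -> P v) ->
  (forall T, T != fset0 -> T `<=` finsupp w -> P (c T)) ->
  forall v, v \in finsupp (layer G c w t) -> P v.
Proof.
move=> hG hc v /supp_layer[[m0 vG]|[T /supp_levels[T0 Tw _ _] ->]]; last exact: hc.
apply: hG vG; first exact: prob_ntrunc.
by apply/fsubsetP => u /supp_ntrunc[].
Qed.

(** Superlevel sets form a chain, and each one recorded below level [t] contains the support of
    [ntrunc t w]. Hence only nested pairs have to be checked, where the bound for the center of the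
    larger set applies. *)
Lemma layer_rel t (P : V' -> V' -> Prop) :
  (forall u v, P u v -> P v u) ->
  (forall w' u v, prob w' -> finsupp w' `<=` finsupp w ->
     u \in finsupp (G w') -> v \in finsupp (G w') -> P u v) ->
  (forall w' T u, prob w' -> finsupp w' `<=` T -> T `<=` finsupp w ->
     u \in finsupp (G w') -> P u (c T)) ->
  (forall T T', T != fset0 -> T `<=` T' -> T' `<=` finsupp w -> P (c T) (c T')) ->
  forall u v, u \in finsupp (layer G c w t) -> v \in finsupp (layer G c w t) ->
    P u v.
Proof.
move=> symP hG hc hT.
have tw : finsupp (ntrunc t w) `<=` finsupp w.
  by apply/fsubsetP => u /supp_ntrunc[].
have mix u T : mass (trunc t w) != 0 -> u \in finsupp (G (ntrunc t w)) ->
    T \in finsupp (levels t w) -> P u (c T).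
  move=> m0 uG /supp_levels[_ Tw htT _]; apply: hc uG => //; first exact: prob_ntrunc.
  by apply/fsubsetP => x /supp_ntrunc[xw /ltW]; exact: htT.
move=> u v /supp_layer[[m0 uG]|[T Tl ->]] /supp_layer[[m0' vG]|[T' Tl' ->]].
- by apply: hG uG vG => //; exact: prob_ntrunc.
- exact: mix.
- by apply: symP; exact: mix.
have [T0 Tw _ _] := supp_levels Tl; have [T0' Tw' _ _] := supp_levels Tl'.
by have [TT'|TT'] := supp_levels_chain Tl Tl'; [|apply: symP]; exact: hT.
Qed.

End Layer.
End WeightOps.

(** * Limits of finite minima, maxima and sums *)

Section Cvg.
Context (R : realType) (T : Type) (F : set_system T).
Context {FF : Filter F}.

Lemma cvg_minr (f g : T -> R) a b : f @ F --> a -> g @ F --> b ->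
  Num.min (f z) (g z) @[z --> F] --> Num.min a b.
Proof.
move=> fa gb; apply: continuous2_cvg; [|exact: fa|exact: gb].
exact: (@min_continuous _ R (a, b)).
Qed.

Lemma cvg_maxr (f g : T -> R) a b : f @ F --> a -> g @ F --> b ->
  Num.max (f z) (g z) @[z --> F] --> Num.max a b.
Proof.
move=> fa gb; apply: continuous2_cvg; [|exact: fa|exact: gb].
exact: (@max_continuous _ R (a, b)).
Qed.

Lemma cvg_bigmin (V : Type) (s : seq V) (f : T -> V -> R) (a : V -> R) (b : T -> R) (b0 : R) :
  (forall v, f z v @[z --> F] --> a v) -> b @ F --> b0 ->
  \big[Num.min/b z]_(v <- s) f z v @[z --> F] --> \big[Num.min/b0]_(v <- s) a v.
Proof.
move=> fa bb; elim: s => [|v s IH].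
  by rewrite big_nil; under eq_fun do rewrite big_nil.
by rewrite big_cons; under eq_fun do rewrite big_cons; exact: cvg_minr.
Qed.

Lemma cvg_bigmax (V : Type) (s : seq V) (f : T -> V -> R) (a : V -> R) (b : T -> R) (b0 : R) :
  (forall v, f z v @[z --> F] --> a v) -> b @ F --> b0 ->
  \big[Num.max/b z]_(v <- s) f z v @[z --> F] --> \big[Num.max/b0]_(v <- s) a v.
Proof.
move=> fa bb; elim: s => [|v s IH].
  by rewrite big_nil; under eq_fun do rewrite big_nil.
by rewrite big_cons; under eq_fun do rewrite big_cons; exact: cvg_maxr.
Qed.

Lemma cvg_sumr (I : Type) (s : seq I) (P : pred I) (f : T -> I -> R) (a : I -> R) :
  (forall i, P i -> f z i @[z --> F] --> a i) ->
  \sum_(i <- s | P i) f z i @[z --> F] --> \sum_(i <- s | P i) a i.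
Proof. by move=> h; apply: cvg_big => //; exact: add_continuous. Qed.

End Cvg.

(** * Continuity of operations on weights, simplex by simplex *)

Section WeightCont.
Local Open Scope fset_scope.
Local Open Scope ring_scope.
Context (R : realType).

Definition wcvg (T : Type) (F : set_system T) (V : choiceType)
    (W : T -> {fsfun V -> R with 0}) (w : {fsfun V -> R with 0}) : Prop :=
  forall v, W z v @[z --> F] --> w v.

(* Continuity on every closed simplex in [D], the image of a finite
   set of vertices being controlled; this is what continuity between
   realizations requires, independently of the complexes. *)
Definition wcont (V V' : choiceType) (D : {fset V} -> Prop)
    (h : {fsfun V -> R with 0} -> R -> {fsfun V' -> R with 0}) : Prop :=
  (forall S, exists S', forall w (t : R), prob w -> D (finsupp w) -> finsupp w `<=` S ->
     0 <= t -> finsupp (h w t) `<=` S') /\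
  (forall (T : Type) (F : set_system T) (W : T -> {fsfun V -> R with 0})
     (t : T -> R) w (t0 : R) (S : {fset V}), Filter F ->
     prob w -> D (finsupp w) -> finsupp w `<=` S -> (forall z, 0 <= t z) -> 0 <= t0 ->
     (\forall z \near F, [/\ prob (W z), D (finsupp (W z)) & finsupp (W z) `<=` S]) ->
     wcvg F W w -> t @ F --> t0 -> wcvg F (fun z => h (W z) (t z)) (h w t0)).

Lemma wcont_comp (V V' V'' : choiceType) (D : {fset V} -> Prop)
    (D' : {fset V'} -> Prop) h (h' : {fsfun V' -> R with 0} -> R -> {fsfun V'' -> R with 0}) :
  wcont D h -> wcont D' h' ->
  (forall w (t : R), prob w -> D (finsupp w) -> 0 <= t ->
     prob (h w t) /\ D' (finsupp (h w t))) ->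
  wcont D (fun w t => h' (h w t) t).
Proof.
move=> [hS hc] [hS' hc'] hD; split=> [S|].
  have [S' hS1] := hS S; have [S'' hS2] := hS' S'; exists S'' => w t pw Dw wS t0.
  by have [p d] := hD w t pw Dw t0; apply: hS2 => //; exact: hS1.
move=> T F W t w t0 S FF pw Dw wS tz t00 near cW ct.
have [S' hS1] := hS S; have [p d] := hD w t0 pw Dw t00.
apply: (hc' T F _ t _ _ S') => //; [exact: hS1| |exact: (hc T F _ _ _ _ S)].
near=> z; have [pz Dz Sz] : [/\ prob (W z), D (finsupp (W z)) & finsupp (W z) `<=` S].
  by near: z.
by have [? ?] := hD (W z) (t z) pz Dz (tz z); split=> //; exact: hS1.
Unshelve. all: by end_near. Qed.

Lemma wcvg_push (T : Type) (F : set_system T) (FF : Filter F) (V V' : choiceType)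
    (j : V -> V') W (w : {fsfun V -> R with 0}) (S : {fset V}) :
  finsupp w `<=` S -> (\forall z \near F, finsupp (W z) `<=` S) -> wcvg F W w ->
  wcvg F (fun z => push j (W z)) (push j w).
Proof.
move=> wS near cW v'; rewrite (push_sub _ _ wS).
apply: (@cvg_trans _ ((\sum_(v <- S | j v == v') W z v) @[z --> F])).
  apply: near_eq_cvg; near=> z; apply/esym/push_sub.
  by near: z.
by apply: cvg_sumr => v _; exact: cW.
Unshelve. all: by end_near. Qed.

Lemma wcont_push (V V' : choiceType) (D : {fset V} -> Prop) (j : V -> V') :
  wcont D (fun w _ => push j w).
Proof.
split=> [S|T F W t w t0 S FF pw Dw wS _ _ near cW _].
  exists [fset j v | v in S] => w t _ _ wS _; apply/fsubsetP => v' /supp_push[v vw ->].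
  by rewrite in_imfset//=; exact: (fsubsetP wS).
by apply: wcvg_push wS _ cW; apply: filterS near => z [].
Qed.

Lemma wcont_sub (V V' : choiceType) (D D' : {fset V} -> Prop)
    (h' : {fsfun V -> R with 0} -> R -> {fsfun V' -> R with 0}) :
  (forall S, D S -> D' S) -> wcont D' h' -> wcont D h'.
Proof.
move=> DD' [hS hc]; split=> [S|T F W t w t0 S FF pw Dw wS tz t00 near cW ct].
  by have [S' hS'] := hS S; exists S' => w t pw /DD' Dw; exact: hS'.
apply: (hc _ _ _ _ _ _ S) => //; first exact: DD'.
by apply: filterS near => z [? /DD' ? ?].
Qed.

Lemma wcvg_levels (T : Type) (F : set_system T) (FF : Filter F) (V : choiceType)
    W (w : {fsfun V -> R with 0}) (S : {fset V}) (t : T -> R) (t0 : R) :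
  prob w -> finsupp w `<=` S ->
  (\forall z \near F, prob (W z) /\ finsupp (W z) `<=` S) -> wcvg F W w ->
  t @ F --> t0 -> wcvg F (fun z => levels (t z) (W z)) (levels t0 w).
Proof.
move=> [w0 _] wS near cW ct A; rewrite (levels_sub _ _ w0 wS).
apply: (@cvg_trans _ ((if A `<=` S then #|` A|%:R * level_len S (W z) 0 (t z) A
    else 0) @[z --> F])).
  apply: near_eq_cvg; near=> z.
  have [[Wz0 _] Sz] : prob (W z) /\ finsupp (W z) `<=` S by near: z.
  by rewrite (levels_sub _ _ Wz0 Sz).
case: ifP => _; last exact: cvg_cst.
apply: cvgM; first exact: cvg_cst.
apply: cvg_maxr; first exact: cvg_cst.
apply: cvgB; first exact: cvg_bigmin.
by apply: cvg_bigmax => //; exact: cvg_cst.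
Unshelve. all: by end_near. Qed.

Lemma wcvg_trunc (T : Type) (F : set_system T) (FF : Filter F) (V : choiceType)
    W (w : {fsfun V -> R with 0}) (t : T -> R) (t0 : R) :
  (forall z, 0 <= t z) -> 0 <= t0 -> wcvg F W w -> t @ F --> t0 ->
  wcvg F (fun z => trunc (t z) (W z)) (trunc t0 w).
Proof.
move=> tz t00 cW ct v; rewrite truncE//; under eq_fun do rewrite truncE//.
by apply: cvg_maxr; [exact: cvg_cst|apply: cvgB => //; exact: cW].
Qed.

Lemma cvg_mass (T : Type) (F : set_system T) (FF : Filter F) (V : choiceType)
    W (w : {fsfun V -> R with 0}) (S : {fset V}) :
  finsupp w `<=` S -> (\forall z \near F, finsupp (W z) `<=` S) -> wcvg F W w ->
  mass (W z) @[z --> F] --> mass w.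
Proof.
move=> wS near cW; rewrite (mass_sub wS).
apply: (@cvg_trans _ ((\sum_(v <- S) W z v) @[z --> F])).
  by apply: near_eq_cvg; near=> z; apply/esym/mass_sub; near: z.
by apply: cvg_sumr => v _; exact: cW.
Unshelve. all: by end_near. Qed.

Lemma wcont_layer (V V' : choiceType) (D : {fset V} -> Prop)
    (G : {fsfun V -> R with 0} -> {fsfun V' -> R with 0}) (c : {fset V} -> V') :
  (forall A B, D A -> B `<=` A -> B != fset0 -> D B) ->
  (forall w, prob w -> D (finsupp w) -> prob (G w)) ->
  wcont D (fun w _ => G w) -> wcont D (layer G c).
Proof.
move=> Dsub probG [GS Gc].
have Dn (w : {fsfun V -> R with 0}) (t : R) : D (finsupp w) -> mass (trunc t w) != 0 ->
    [/\ prob (ntrunc t w), D (finsupp (ntrunc t w))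
      & finsupp (ntrunc t w) `<=` finsupp w].
  move=> Dw m0; have p := prob_ntrunc m0.
  have s : finsupp (ntrunc t w) `<=` finsupp w.
    by apply/fsubsetP => v /supp_ntrunc[].
  by split=> //; apply: Dsub Dw s _; exact: prob_supp_neq0.
split=> [S|T F W t w t0 S FF pw Dw wS tz t00 near cW ct v].
  have [S' hS'] := GS S; exists (S' `|` [fset c A | A in fpowerset S]).
  move=> w t pw Dw wS t0; apply/fsubsetP => v /supp_layer[[m0 vG]|[A]].
    have [p d s] := Dn w t Dw m0.
    rewrite inE; apply/orP; left; apply: (fsubsetP _ _ vG).
    by apply: (hS' _ 0) => //; exact: fsubset_trans wS.
  move=> /supp_levels[_ Aw _ _] ->; rewrite inE; apply/orP; right.
  by rewrite in_imfset//= fpowersetE (fsubset_trans Aw).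
have nearS : \forall z \near F, finsupp (W z) `<=` S.
  by apply: filterS near => z [].
have nearP : \forall z \near F, prob (W z) /\ finsupp (W z) `<=` S.
  by apply: filterS near => z [].
have nearT : \forall z \near F, finsupp (trunc (t z) (W z)) `<=` S.
  by apply: filterS nearS => z h; exact: fsubset_trans (finsupp_sub _ _ _) h.
have ctr := wcvg_trunc FF tz t00 cW ct.
have cm := cvg_mass FF (fsubset_trans (finsupp_sub _ _ _) wS) nearT ctr.
under eq_fun do rewrite combE.
rewrite combE; apply: cvgD; last first.
  apply: (@wcvg_push _ _ _ _ _ c _ _ (fpowerset S)).
  - by apply: fsubset_trans (finsupp_sub _ _ _) _; rewrite fpowersetS.
  - apply: filterS nearS => z h.
    by apply: fsubset_trans (finsupp_sub _ _ _) _; rewrite fpowersetS.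
  - exact: wcvg_levels pw wS nearP cW ct.
(* Where the truncated mass vanishes, [ntrunc] need not converge; the product still tends to 0,
   because the values of [G] are at most 1. *)
have [m0|m0] := eqVneq (mass (trunc t0 w)) 0.
  rewrite m0 mul0r; rewrite m0 in cm.
  apply: (@squeeze_cvgr _ _ _ _ (fun=> 0) (fun z => mass (trunc (t z) (W z)))) => //;
    last exact: cvg_cst.
  near=> z; have [pz Dz Sz] : [/\ prob (W z), D (finsupp (W z)) & finsupp (W z) `<=` S].
    by near: z.
  have [->|mz] := eqVneq (mass (trunc (t z) (W z))) 0; first by rewrite mul0r lexx.
  have [p d s] := Dn (W z) (t z) Dz mz.
  have pG := probG _ p d; have mz0 := mass_trunc_ge0 (t z) (W z).
  by rewrite mulr_ge0 ?pG.1//= ler_piMr// prob_le1.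
apply: cvgM => //.
have mpos : 0 < mass (trunc t0 w) by rewrite lt_def m0 mass_trunc_ge0.
have nearm : \forall z \near F, mass (trunc (t z) (W z)) != 0.
  by near=> z; rewrite gt_eqF//; near: z; apply: cvgr_gt cm _ mpos.
have [p d s] := Dn w t0 Dw m0.
apply: (Gc _ _ (fun z => ntrunc (t z) (W z)) (fun=> 0) _ 0 S) => //.
- exact: fsubset_trans s wS.
- near=> z; have [pz Dz Sz] : [/\ prob (W z), D (finsupp (W z)) & finsupp (W z) `<=` S].
    by near: z.
  have mz : mass (trunc (t z) (W z)) != 0 by near: z.
  have [? ? s'] := Dn (W z) (t z) Dz mz; split=> //; exact: fsubset_trans s' Sz.
- move=> u; rewrite scaleE; under eq_fun do rewrite scaleE.
  by apply: cvgM; [apply: cvgV|exact: ctr].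
- exact: cvg_cst.
Unshelve. all: by end_near. Qed.

End WeightCont.

(** * Cylinders, and homotopies as equalities in the localization *)

Section Cylinder.
Context (R : realType) (N : nat).
Implicit Types (F G : pspace R N).

Lemma cvg_pairE (T : Type) (F : set_system T) (FF : Filter F)
    (X Y : topologicalType) (f : T -> X) (g : T -> Y) (a : X) (b : Y) :
  f @ F --> a -> g @ F --> b -> (f z, g z) @[z --> F] --> (a, b).
Proof. by move=> fa gb; apply: cvg_pair. Qed.

Lemma continuous_pair (X Y Z : topologicalType) (f : X -> Y) (g : X -> Z) :
  continuous f -> continuous g -> continuous (fun x => (f x, g x)).
Proof. by move=> cf cg x; apply: cvg_pairE; [exact: cf|exact: cg]. Qed.

Lemma continuous_const (X Y : topologicalType) (c : Y) : continuous (fun _ : X => c).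
Proof. by move=> x; exact: cvg_cst. Qed.

Lemma continuous_fst (X Y : topologicalType) : continuous (@fst X Y).
Proof. by move=> p; exact: cvg_fst. Qed.

Lemma continuous_snd (X Y : topologicalType) : continuous (@snd X Y).
Proof. by move=> p; exact: cvg_snd. Qed.

Lemma continuous_comp_fun (X Y Z : topologicalType) (f : X -> Y) (g : Y -> Z) :
  continuous f -> continuous g -> continuous (fun x => g (f x)).
Proof. by move=> cf cg x; apply: (@continuous_comp _ _ _ f g); [exact: cf|exact: cg]. Qed.

Definition cyl_map (X Y : Type) (f : X -> Y) (p : X * R) : Y * R := (f p.1, p.2).

Lemma cyl_map_continuous (X Y : topologicalType) (f : X -> Y) :
  continuous f -> continuous (cyl_map f).
Proof.
move=> cf; apply: continuous_pair; last exact: continuous_snd.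
by apply: continuous_comp_fun cf; exact: continuous_fst.
Qed.

(** The cylinder has the whole line as its second factor; homotopies on the unit interval are
    extended to it by [clamp]. *)
Definition cyl F : pspace R N.
Proof.
exists (fun u => (F u * R)%type : topologicalType) (fun u v h => cyl_map (Defs.pmap h)).
- by move=> u v h; exact: (@cyl_map_continuous (F u) (F v) _ (pmap_cont F h)).
- by move=> u h [x t]; rewrite /cyl_map/= pmap_id.
- by move=> u v w h1 h2 h3 [x t]; rewrite /cyl_map/= (pmap_comp _ _ h3).
Defined.

Definition cyl_proj F : pmor (cyl F) F.
Proof.
exists (fun u p => p.1) => // u.
exact: continuous_fst.
Defined.

Definition cyl_at F (t : R) : pmor F (cyl F).
Proof.
exists (fun u x => (x, t)) => // u.
by apply: continuous_pair; move=> x; [exact: cvg_id|exact: cvg_cst].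
Defined.

Lemma continuous_segment (X : topologicalType) (f g h : X -> R) :
  continuous f -> continuous g -> continuous h ->
  continuous (fun x => (1 - h x) * f x + h x * g x).
Proof.
move=> cf cg ch x; suff H (F : set_system X) : Filter F -> f @ F --> f x ->
    g @ F --> g x -> h @ F --> h x ->
    (1 - h z) * f z + h z * g z @[z --> F] --> (1 - h x) * f x + h x * g x.
  by apply: H; [exact: cf|exact: cg|exact: ch].
move=> FF fa gb hc; apply: cvgD; apply: cvgM => //.
by apply: cvgB => //; exact: cvg_cst.
Qed.

(** The line is convex: paths and homotopies lift by joining the second coordinates of their ends
    linearly. *)
Lemma fst_weak_equiv (X : topologicalType) :
  weak_equiv R (fun p : X * R => p.1).
Proof.
have val_cont : continuous (set_val : unit_interval R -> R) by exact: initial_continuous.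
split; first exact: continuous_fst.
  split=> [[x a] [y b] /= [c [cc c0 c1]]|y]; last first.
    by exists (y, 0); exists (fun=> y); split=> //; exact: continuous_const.
  exists (fun t => (c t, (1 - set_val t) * a + set_val t * b)); split.
  - by apply: continuous_pair => //; apply: continuous_segment => //; exact: continuous_const.
  - by move=> t t0; rewrite c0// t0 subr0 mul1r mul0r addr0.
  - by move=> t t1; rewrite c1// t1 subrr mul1r mul0r add0r.
move=> n [x r] _; split=> [a b [ca a0] [cb b0] [H [cH H0 H1 Hb]]|c [/= cc c0]].
  exists (fun p => (H p, (1 - set_val p.2) * (a p.1).2 + set_val p.2 * (b p.1).2)).
  split.
  - apply: continuous_pair => //; apply: continuous_segment.
    + apply: (@continuous_comp_fun _ _ _ fst (fun z => (a z).2)).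
        exact: continuous_fst.
      exact: (continuous_comp_fun ca (@continuous_snd _ _)).
    + apply: (@continuous_comp_fun _ _ _ fst (fun z => (b z).2)).
        exact: continuous_fst.
      exact: (continuous_comp_fun cb (@continuous_snd _ _)).
    + exact: (continuous_comp_fun (@continuous_snd _ _) val_cont).
  - move=> z t t0 /=; rewrite H0// t0 subr0 mul1r mul0r addr0.
    by rewrite /=; case: (a z).
  - move=> z t t1 /=; rewrite H1// t1 subrr mul1r mul0r add0r.
    by rewrite /=; case: (b z).
  - move=> z t bz /=; rewrite Hb// a0// b0//=; congr (_, _).
      by rewrite a0.
    by rewrite -mulrDl subrK mul1r.
exists (fun z => (c z, r)).
  by split=> [|t bt]; [exact: continuous_pair cc (@continuous_const _ _ _)|rewrite c0].
exists (fun p => c p.1); split=> //.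
exact: (continuous_comp_fun (@continuous_fst _ _) cc).
Qed.

Lemma cyl_proj_weak F : pweak_equiv (cyl_proj F).
Proof. by move=> u; exact: fst_weak_equiv. Qed.

(** Every [cyl_at F t] is a section of the inverted [cyl_proj F], hence equal to its inverse; so the
    two ends of the cylinder agree. *)
Lemma ho_homotopy F G (H : pmor (cyl F) G) (f g : pmor F G) :
  (forall u x, H u (x, 0) = f u x) -> (forall u x, H u (x, 1) = g u x) ->
  ho_eq (ho_map f) (ho_map g).
Proof.
move=> H0 H1.
have inv t : ho_eq (ho_map (cyl_at F t)) (ho_inv (@cyl_proj_weak F)).
  have e : pmor_comp (cyl_proj F) (cyl_at F t) = pmor_id F by exact: pmor_ext.
  apply: ho_trans (ho_sym (ho_idl _)) _.
  apply: ho_trans (ho_congr (ho_sym (ho_invl (@cyl_proj_weak F))) (ho_refl _)) _.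
  apply: ho_trans (ho_sym (ho_assoc _ _ _)) _.
  apply: ho_trans (ho_congr (ho_refl _) (ho_map_comp _ _)) _.
  by rewrite e; exact: ho_idr.
have -> : f = pmor_comp H (cyl_at F 0) by apply: pmor_ext => u x /=; rewrite H0.
have -> : g = pmor_comp H (cyl_at F 1) by apply: pmor_ext => u x /=; rewrite H1.
apply: ho_trans (ho_sym (ho_map_comp _ _)) _; apply: ho_trans (ho_map_comp _ _).
by apply: ho_congr (ho_refl _) _; apply: ho_trans (inv 0) (ho_sym (inv 1)).
Qed.

End Cylinder.

(** * Continuity from and into realizations *)

Section RealizationCont.
Local Open Scope fset_scope.
Local Open Scope ring_scope.
Context (R : realType).

Definition simplex_nbhs (V : choiceType) (K : simplicial_complex V) (s : {fset V})
    (w : realization R K) : set_system (realization R K) :=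
  filter_from [set e : R | 0 < e]
    (fun e => [set w' | finsupp (val w') `<=` s /\
                        forall v, `|val w v - val w' v| < e]).

#[local] Instance simplex_nbhs_filter (V : choiceType) (K : simplicial_complex V) s
  (w : realization R K) : Filter (simplex_nbhs s w).
Proof.
apply: filter_from_filter; first by exists 1 => /=.
move=> a b /= a0 b0; exists (Num.min a b); first by rewrite /= lt_min a0.
move=> w' [w's h]; split; split=> // v; have := h v;
  by rewrite lt_min => /andP[].
Qed.

(* The product topology on [realization R K * R] is the weak one because [R]
   is locally compact: this is the tube lemma. *)
Lemma continuous_realization_cyl (V : choiceType) (K : simplicial_complex V)
    (Z : topologicalType) (h : realization R K * R -> Z) :
  (forall s (w : realization R K) (t : R), simplex K s -> finsupp (val w) `<=` s ->
     h p @[p --> filter_prod (simplex_nbhs s w) (nbhs t)] --> h (w, t)) ->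
  continuous h.
Proof.
move=> hs [w0 t0] U; rewrite nbhsE => -[P [oP Ph] PU].
have hO s (w : realization R K) (t : R) : simplex K s -> finsupp (val w) `<=` s ->
    P (h (w, t)) -> filter_prod (simplex_nbhs s w) (nbhs t) [set p | P (h p)].
  by move=> Ks ws Op; apply: (hs s w t Ks ws P); exact: open_nbhs_nbhs.
have Kw0 : simplex K (finsupp (val w0)).
  by case: w0 {Ph} => w /= /set_mem[].
have [[A B] [/= [e e0 eA] [d /= d0 dB]] AB] := hO _ _ _ Kw0 (fsubset_refl _) Ph.
pose J := `[t0 - d / 2, t0 + d / 2]%classic.
have d2 : 0 < d / 2 by rewrite divr_gt0.
have JO t : J t -> P (h (w0, t)).
  move=> Jt; apply: (AB (w0, t)); split => /=.
    by apply: eA; split=> // v; rewrite subrr normr0.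
  apply: dB; rewrite /ball_/= ltr_distlC; move: Jt; rewrite /J/= in_itv/=.
  by move=> /andP[h1 h2]; apply/andP; split; lra.
pose W : set (realization R K) := [set w | forall t : R, J t -> P (h (w, t))].
have oW : open W.
  rewrite -[open W]/(realization_open W) => s Ks w Ww ws.
  have /compact_near_coveringP nc : compact J by exact: segment_compact.
  have := nc _ (simplex_nbhs s w) (fun w' t => P (h (w', t))) _.
  case=> [t Jt|e' e'0 he'].
    have [[A' B'] [/= A'F B'F] AB'] := hO s w t Ks ws (Ww t Jt).
    by exists (B', A') => // -[t' w'] [/= Bt' Aw']; apply: (AB' (w', t')).
  by exists e' => // w' w's hw' t Jt; apply: he' => //.
exists (W, J); first split => /=.
- by apply: open_nbhs_nbhs; split.
- exists (d / 2) => //= t; rewrite /ball_/= ltr_distlC /J/= in_itv/=.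
  by move=> /andP[h1 h2]; apply/andP; split; lra.
- by move=> [w t] [/= Ww Jt]; apply: PU; exact: Ww.
Qed.

(** Only finitely many supports [s] inside [S] occur, and each is treated alone. If [s] contains the
    support of the limit, openness on the simplex [s] applies; otherwise a vertex of positive limit
    weight outside [s] rules [s] out eventually. *)
Lemma cvg_realization (V : choiceType) (K : simplicial_complex V) (T : Type)
    (F : set_system T) (FF : Filter F) (g : T -> realization R K)
    (w : realization R K) (S : {fset V}) :
  (\forall z \near F, finsupp (val (g z)) `<=` S) ->
  wcvg F (fun z => val (g z)) (val w) -> g @ F --> w.
Proof.
move=> nearS cg U; rewrite nbhsE => -[P [oP Pw] PU].
have Kr (x : realization R K) : simplex K (finsupp (val x)).
  by case: x => x /= /set_mem[].
have near1 s : \forall z \near F, finsupp (val (g z)) = s -> P (g z).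
  have [Ks|Ks] := pselect (simplex K s); last first.
    by apply: nearW => z zs; case: Ks; rewrite -zs.
  have [ws|/fsubsetPn[v vw vs]] := boolP (finsupp (val w) `<=` s); last first.
    have w0 : 0 < val w v.
      have /set_mem[_ wge0 _] := valP w.
      by rewrite lt_def wge0 andbT -mem_finsupp.
    near=> z => zs; exfalso.
    have : 0 < val (g z) v by near: z; exact: cvgr_gt (cg v) _ w0.
    by move: vs; rewrite -zs => /fsfun_dflt ->; rewrite ltxx.
  have oP' : realization_open P by [].
  have [e e0 he] := oP' s Ks w Pw ws.
  have nearv v : \forall z \near F, `|val w v - val (g z) v| < e.
    by move/cvgrPdist_lt: (cg v); exact.
  have : \forall z \near F, forall v, v \in s -> `|val w v - val (g z) v| < e.
    have := @filter_bigI T _ s (fun v => [set z | `|val w v - val (g z) v| < e]) F FF.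
    by move=> /(_ (fun v _ => nearv v)); apply: filterS => z hz v vs; exact: hz.
  apply: filterS => z hz zs; apply: he; first by rewrite zs.
  move=> v; have [vs|vs] := boolP (v \in s); first exact: hz.
  rewrite (fsfun_dflt (contra (fsubsetP ws v) vs)) fsfun_dflt ?zs//.
  by rewrite subrr normr0.
have : \forall z \near F, forall s, s \in fpowerset S ->
    finsupp (val (g z)) = s -> P (g z).
  have := @filter_bigI T _ (fpowerset S)
    (fun s => [set z | finsupp (val (g z)) = s -> P (g z)]) F FF.
  by move=> /(_ (fun s _ => near1 s)); apply: filterS => z hz s sS; exact: hz.
move=> near2; suff : \forall z \near F, U (g z) by []; near=> z; apply: PU.
have zS : finsupp (val (g z)) `<=` S by near: z.
have : forall s, s \in fpowerset S -> finsupp (val (g z)) = s -> P (g z) by near: z.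
by apply; [rewrite fpowersetE; exact: zS|].
Unshelve. all: by end_near. Qed.

Definition clamp (t : R) : R := Num.max 0 (Num.min 1 t).

Lemma clamp_ge0 t : 0 <= clamp t.
Proof. by rewrite le_max lexx. Qed.

Lemma clamp_le1 t : clamp t <= 1.
Proof. by rewrite ge_max ler01 ge_min lexx. Qed.

Lemma clamp0 : clamp 0 = 0.
Proof. by rewrite /clamp min_r ?ler01// maxxx. Qed.

Lemma clamp1 : clamp 1 = 1.
Proof. by rewrite /clamp minxx max_r. Qed.

Lemma cvg_clamp (T : Type) (F : set_system T) (FF : Filter F) (t : T -> R) (t0 : R) :
  t @ F --> t0 -> clamp (t z) @[z --> F] --> clamp t0.
Proof.
by move=> h; apply: cvg_maxr; [exact: cvg_cst|apply: cvg_minr => //; exact: cvg_cst].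
Qed.

Lemma realization_prob (V : choiceType) (K : simplicial_complex V)
  (w : realization R K) : prob (val w) /\ simplex K (finsupp (val w)).
Proof. by case: w => w /= /set_mem[]. Qed.

Definition realization_of (V : choiceType) (K : simplicial_complex V)
    (w : {fsfun V -> R with 0}) (H : prob w /\ simplex K (finsupp w)) :
    realization R K :=
  exist _ w (mem_set (And3 H.2 H.1.1 H.1.2)).

Lemma cvg_simplex_nbhs (V : choiceType) (K : simplicial_complex V) s
    (w : realization R K) v :
  (fun z : realization R K => val z v) @ simplex_nbhs s w --> val w v.
Proof.
apply/cvgrPdist_lt => e e0; exists e => // w' [_ h]; exact: h.
Qed.

Lemma near_simplex_nbhs (V : choiceType) (K : simplicial_complex V) s
    (w : realization R K) :
  \forall z \near simplex_nbhs s w, finsupp (val (z : realization R K)) `<=` s.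
Proof. by exists 1 => //= w' []. Qed.

Lemma continuous_wcont (V V' : choiceType) (K : simplicial_complex V)
    (K' : simplicial_complex V') (D : {fset V} -> Prop) h
    (g : realization R K * R -> realization R K') :
  wcont D h -> (forall s, simplex K s -> D s) ->
  (forall p, val (g p) = h (val p.1) (clamp p.2)) -> continuous g.
Proof.
move=> [hS hc] KD gE; apply: continuous_realization_cyl => s w t Ks ws.
have [S' hS'] := hS s.
have [pw Kw] := realization_prob w.
pose F := filter_prod (simplex_nbhs s w) (nbhs t).
have nearD : \forall p \near F, finsupp (val (p : realization R K * R).1) `<=` s.
  exists ([set w' : realization R K | finsupp (val w') `<=` s], setT).
    by split; [exact: near_simplex_nbhs|exact: filterT].
  by move=> [w' t'] [].
apply: (@cvg_realization _ _ _ _ _ _ _ S').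
  apply: filterS nearD => p ps; rewrite gE.
  have [pp Kp] := realization_prob p.1.
  by apply: hS' => //; [exact: KD|exact: clamp_ge0].
rewrite /wcvg; under eq_forall => v do under eq_fun do rewrite gE.
rewrite gE; apply: (hc _ _ _ _ _ _ s) => //.
- exact: KD.
- by move=> z; exact: clamp_ge0.
- exact: clamp_ge0.
- apply: filterS nearD => p ps; have [pp Kp] := realization_prob p.1.
  by split=> //; exact: KD.
- move=> v; apply: (cvg_comp fst (fun z : realization R K => val z v));
    [exact: cvg_fst|exact: cvg_simplex_nbhs].
- by apply: cvg_clamp; exact: cvg_snd.
Qed.

End RealizationCont.

(** * A partition of unity on [M] indexed by a grid *)

Section Partition.
Local Open Scope fset_scope.
Local Open Scope ring_scope.
Context (R : realType) (n : nat) (M : set 'rV[R]_n) (m0 : M) (h : R).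
Hypothesis h0 : 0 < h.
Implicit Types (k : 'rV[int]_n) (x : 'rV[R]_n) (r : R).

Definition grid_pt k : 'rV[R]_n := \row_i (h * (k ord0 i)%:~R).

Lemma finite_grid r :
  exists S : {fset 'rV[int]_n}, forall k, `|grid_pt k| <= r -> k \in S.
Proof.
pose b := Num.truncn (`|r| / h); pose I := 'I_(b.*2.+1).
pose toZ (c : {ffun 'I_n -> I}) : 'rV[int]_n := \row_i ((c i : nat)%:Z - b%:Z).
exists [fset k in [seq toZ c | c <- enum {: {ffun 'I_n -> I}}]] => k hk.
have kb i : (`|k ord0 i| <= b)%N.
  have : `|grid_pt k ord0 i| <= `|r|.
    by apply: le_trans (norm_coord_le _ _) (le_trans hk (ler_norm r)).
  rewrite mxE normrM (gtr0_norm h0) mulrC -ler_pdivlMr// => hi.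
  by rewrite truncn_ge_nat ?divr_ge0 ?(ltW h0)// natr_absz intr_norm.
rewrite !inE/=; apply/mapP.
have cb i : (`|(k ord0 i + b%:Z)%R| < b.*2.+1)%N.
  by have := kb i; move: (k ord0 i) => z; rewrite /b; lia.
exists [ffun i => Ordinal (cb i)]; first by rewrite mem_enum.
apply/rowP => i; rewrite !mxE ffunE/=.
by have := kb i; move: (k ord0 i) => z; rewrite /b; lia.
Qed.

Definition grid_box r : {fset 'rV[int]_n} := projT1 (cid (finite_grid r)).

Lemma grid_boxP r k : `|grid_pt k| <= r -> k \in grid_box r.
Proof. by rewrite /grid_box; case: cid => S /= hS; exact: hS. Qed.

Definition tent x k : R := Num.max 0 (h - `|x - grid_pt k|).

Lemma tent_box x k r : `|x| <= r -> tent x k != 0 -> k \in grid_box (r + h).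
Proof.
move=> xr tk; apply: grid_boxP; have xk : `|x - grid_pt k| < h.
  by rewrite -subr_gt0 ltNge; apply: contra tk => hk; rewrite /tent max_l.
rewrite -[grid_pt k](subKr x) (le_trans (ler_normB _ _))//.
by rewrite lerD// ltW.
Qed.

Definition tents x : {fsfun 'rV[int]_n -> R with 0} :=
  [fsfun k in grid_box (`|x| + h) => tent x k].

Lemma tentsE x k : tents x k = tent x k.
Proof.
rewrite fsfunE; case: ifPn => // kb; apply/esym/eqP.
by apply: contraR kb; exact: tent_box.
Qed.

Lemma supp_tents x r : `|x| <= r -> finsupp (tents x) `<=` grid_box (r + h).
Proof.
by move=> xr; apply/fsubsetP => k; rewrite mem_finsupp tentsE; exact: tent_box.
Qed.

Lemma tents_ge0 x k : 0 <= tents x k.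
Proof. by rewrite tentsE le_max lexx. Qed.

Lemma mass_tents_gt0 x : 0 < mass (tents x).
Proof.
pose k : 'rV[int]_n := \row_i Num.floor (x ord0 i / h).
have : `|x - grid_pt k| < h.
  rewrite [ltLHS]/Num.Def.normr/= mx_normrE; apply/bigmax_ltP; split=> //.
  move=> [i j] _; rewrite ord1 !mxE/=.
  have := floor_itv (x ord0 j / h); rewrite ler_pdivlMr// ltr_pdivrMr// intrD.
  by rewrite ltr_norml => /andP[? ?]; apply/andP; split; lra.
move=> xk; apply: lt_le_trans (weight_le_mass k (tents_ge0 x)).
by rewrite tentsE lt_max subr_gt0 xk orbT.
Qed.

(** The default [m0] serves grid points far from [M]. It is not reached in [grid_partition m]: if
    the tent at [k] is nonzero at [m], then [m] itself is a candidate. *)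
Definition grid_vertex k : M :=
  xget m0 [set a : M | `|set_val a - grid_pt k| < h].

Definition grid_partition (m : M) : {fsfun M -> R with 0} :=
  push grid_vertex (scale (mass (tents (set_val m)))^-1 (tents (set_val m))).

Lemma prob_grid_partition m : prob (grid_partition m).
Proof.
have m1 := mass_tents_gt0 (set_val m).
apply: prob_push; split=> [k|]; last by rewrite mass_scale mulVf// gt_eqF.
by rewrite scaleE mulr_ge0 ?tents_ge0// invr_ge0 ltW.
Qed.

Lemma supp_grid_partition m v : v \in finsupp (grid_partition m) ->
  `|set_val m - set_val v| < 2 * h.
Proof.
move=> /supp_push[k /(fsubsetP (finsupp_sub _ _ _))].
rewrite mem_finsupp tentsE => tk ->.
have mk : `|set_val m - grid_pt k| < h.
  by rewrite -subr_gt0 ltNge; apply: contra tk => hk; rewrite /tent max_l.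
have vk : `|set_val (grid_vertex k) - grid_pt k| < h.
  by rewrite /grid_vertex; case: xgetP => [a _|/(_ m)].
rewrite -(subrKA (grid_pt k)) (le_lt_trans (ler_normD _ _))//.
by rewrite -opprB distrC addrC opprB; lra.
Qed.

Lemma grid_partition_bounded r : exists S : {fset M}, forall m : M,
  `|set_val m| <= r -> finsupp (grid_partition m) `<=` S.
Proof.
exists [fset grid_vertex k | k in grid_box (r + h)] => m mr.
apply/fsubsetP => v /supp_push[k /(fsubsetP (finsupp_sub _ _ _)) kt ->].
by rewrite in_imfset//=; exact: (fsubsetP (supp_tents mr)).
Qed.

Lemma wcvg_grid_partition (T : Type) (F : set_system T) (FF : Filter F) (m : T -> M)
    (a : M) : set_val (m z) @[z --> F] --> set_val a ->
  wcvg F (fun z => grid_partition (m z)) (grid_partition a).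
Proof.
move=> ma; pose r := `|set_val a : 'rV[R]_n| + 1.
have near : \forall z \near F, `|set_val (m z) : 'rV[R]_n| <= r.
  move/cvgrPdist_lt : (ma) => /(_ 1 ltr01); apply: filterS => z az.
  rewrite -[set_val (m z)](subKr (set_val a)) (le_trans (ler_normB _ _))//.
  by rewrite lerD2l ltW.
have ct k : tents (set_val (m z)) k @[z --> F] --> tents (set_val a) k.
  rewrite tentsE; under eq_fun do rewrite tentsE.
  apply: cvg_maxr; first exact: cvg_cst.
  apply: cvgB; first exact: cvg_cst.
  by apply: cvg_norm; apply: cvgB => //; exact: cvg_cst.
have nearS : \forall z \near F, finsupp (tents (set_val (m z))) `<=` grid_box (r + h).
  by apply: filterS near => z; exact: supp_tents.
have ar : `|set_val a : 'rV[R]_n| <= r by rewrite lerDl.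
have cm : mass (tents (set_val (m z))) @[z --> F] --> mass (tents (set_val a)).
  exact: (cvg_mass FF (supp_tents ar) nearS).
apply: (@wcvg_push _ _ _ _ _ _ _ _ _ (grid_box (r + h))).
- by apply: fsubset_trans (finsupp_sub _ _ _) _; exact: supp_tents.
- by apply: filterS nearS => z; apply: fsubset_trans; exact: finsupp_sub.
- move=> k; rewrite scaleE; under eq_fun do rewrite scaleE.
  apply: cvgM; last exact: ct.
  by apply: cvgV => //; rewrite gt_eqF// mass_tents_gt0.
Qed.

End Partition.

(** * Projected circumcenters of finite families in [M] *)

Section Centers.
Local Open Scope fset_scope.
Local Open Scope ring_scope.
Context (R : realType) (n : nat) (M : set 'rV[R]_n) (m0 : M) (k r : R).
Local Notation J := (Jconst R n).
Hypothesis closedM : closed M.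
Hypothesis k0 : 0 <= k.
Hypothesis unip : forall x y, M y -> k * eucl x y < 1 ->
  exists! a, nearest M x a.
Hypothesis J_ge : 1 / 2 <= J.
Hypothesis r0 : 0 < r.
Hypothesis kr : k * (J * r) < 1 - J.
Implicit Types (d : R).

Let E := (1 - k * (J * r))^-1.

Definition dM (a b : M) : R := eucl (set_val a) (set_val b).

Lemma dM_sym a b : dM a b = dM b a. Proof. exact: eucl_sym. Qed.
Lemma dM_triangle b a c : dM a c <= dM a b + dM b c.
Proof. exact: eucl_triangle. Qed.

Definition projM (x : 'rV[R]_n) : M := xget m0 [set a : M | nearest M x (set_val a)].

Lemma projMP x a : nearest M x a -> nearest M x (set_val (projM x)).
Proof.
move=> na; rewrite /projM; case: xgetP => [b _ //|/(_ (exist _ a (mem_set na.1)))].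
by case.
Qed.

Lemma projM_self (m : M) : projM (set_val m) = m.
Proof.
have sm := nearest_self (set_mem (valP m)).
have np := projMP sm; apply: val_inj.
apply: (nearest_unique unip np sm).
have : eucl (set_val m) (set_val (projM (set_val m))) <= 0.
  by rewrite -(eucl_xx (set_val m)); exact: np.2 _ sm.1.
move=> le0; have -> : eucl (set_val m) (set_val (projM (set_val m))) = 0.
  by apply/eqP; rewrite eq_le le0 eucl_ge0.
by rewrite mulr0.
Qed.

Section Family.
Context (V : choiceType) (j : V -> M).
Implicit Types (S : {fset V}).

Definition dclose d S := S != fset0 /\
  forall u v, u \in S -> v \in S -> dM (j u) (j v) < d.

Lemma dclose_sub d S T : dclose d S -> T `<=` S -> T != fset0 -> dclose d T.
Proof.
move=> [_ h] /fsubsetP TS T0; split=> // u v uT vT; apply: h; exact: TS.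
Qed.

Lemma dclose_le t t' S : t <= t' -> dclose t S -> dclose t' S.
Proof. by move=> tt' [S0 hS]; split=> // u v uS vS; apply: lt_le_trans (hS u v uS vS) tt'. Qed.

Definition pts S : seq 'rV[R]_n := [seq set_val (j v) | v <- S].

Definition centerM S : M := projM (circumcenter (pts S)).

Lemma pts_mem S v : v \in S -> set_val (j v) \in pts S.
Proof. by move=> vS; apply/mapP; exists v. Qed.

Lemma pts_sub S T : S `<=` T -> {subset pts S <= pts T}.
Proof.
by move=> /fsubsetP ST _ /mapP[v vS ->]; apply: pts_mem; exact: ST.
Qed.

(** A finite set attains its diameter, so a strict bound leaves a smaller closed one; thus the
    strict inequalities of the Rips complex survive the non-strict estimates on hulls. *)
Lemma dclose_spread d S : dclose d S -> d <= r ->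
  exists2 d', d' < d & spread M r (pts S) d'.
Proof.
move=> [S0 hd] dr; have [v0 v0S] := fset0Pn _ S0.
pose d' := \big[Num.max/0]_(p <- [seq (u, v) | u <- S, v <- S]) dM (j p.1) (j p.2).
have d0 : 0 < d by apply: le_lt_trans (hd v0 v0 v0S v0S); exact: eucl_ge0.
exists d'.
  rewrite /d' big_seq; elim/big_rec: _ => // p x /allpairsP[[u v] [/= uS vS ->]] xd.
  by rewrite gt_max xd hd.
have d'r : d' <= r.
  rewrite /d' big_seq; apply: bigmax_le; first exact: ltW.
  move=> p /allpairsP[[u v] [/= uS vS ->]]; apply: le_trans dr.
  by apply: ltW; exact: hd.
split=> //.
- by apply/eqP => e; have := pts_mem v0S; rewrite e.
- by move=> _ /mapP[v _ ->]; exact: set_mem (valP (j v)).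
move=> _ _ /mapP[u uS ->] /mapP[v vS ->].
by apply: (le_bigmax_seq _ (u, v)) => //; apply/allpairsP; exists (u, v).
Qed.

Lemma dclose_projM d S q : dclose d S -> d <= r -> inhull (pts S) q ->
  nearest M q (set_val (projM q)).
Proof.
move=> cS dr hq; have [d' _ sp] := dclose_spread cS dr.
by have [a na _] := hull_nearest k0 unip kr sp hq; exact: projMP na.
Qed.

Let J0 : 0 < J. Proof. by move: J_ge; lra. Qed.

Let EJ0 : 0 < E * J.
Proof. by rewrite mulr_gt0// invr_gt0; move: kr J0; lra. Qed.

Lemma dclose_center d S q : dclose d S -> d <= r -> inhull (pts S) q ->
  dM (projM q) (centerM S) < E * J * d.
Proof.
move=> cS dr hq; have [d' d'd sp] := dclose_spread cS dr.
have [s0 _ _ _] := sp; have [cs _] := circumcenterP s0.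
have h := center_close closedM k0 unip kr sp hq (dclose_projM cS dr hq)
  (dclose_projM cS dr cs).
by apply: le_lt_trans h _; rewrite ltr_pM2l.
Qed.

Lemma dclose_vertex d S q : dclose d S -> d <= r -> inhull (pts S) q ->
  exists2 v, v \in S & dM (projM q) (j v) < E * J * d.
Proof.
move=> cS dr hq; have [d' d'd sp] := dclose_spread cS dr.
have [_ /mapP[v vS ->] h] :=
  hull_proj_near closedM k0 unip kr sp hq (dclose_projM cS dr hq).
by exists v => //; apply: le_lt_trans h _; rewrite ltr_pM2l.
Qed.

Lemma center_vertex d S v : dclose d S -> d <= r -> v \in S ->
  dM (j v) (centerM S) < E * J * d.
Proof.
move=> cS dr vS; rewrite -[j v]projM_self; apply: dclose_center => //.
by apply: inhull_mem; exact: pts_mem.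
Qed.

Lemma center_center d S T : dclose d S -> d <= r -> T `<=` S -> T != fset0 ->
  dM (centerM T) (centerM S) < E * J * d.
Proof.
move=> cS dr TS T0; apply: dclose_center => //.
have [d' _ [s0 _ _ _]] := dclose_spread (dclose_sub cS TS T0) dr.
exact: (inhull_sub (pts_sub TS) (circumcenterP s0).1).
Qed.

Lemma inhull_bary S (w : {fsfun V -> R with 0}) : prob w -> finsupp w `<=` S ->
  inhull (pts S) (bary (fun v => set_val (j v)) w).
Proof.
move=> pw /fsubsetP wS; apply: prob_inhull => // v vw.
by apply: inhull_mem; apply: pts_mem; exact: wS.
Qed.

Lemma dclose_tube d S q : dclose d S -> d <= r -> inhull (pts S) q ->
  k * eucl q (set_val (projM q)) <= k * (J * r).
Proof.
move=> cS dr hq; have [d' _ sp] := dclose_spread cS dr.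
exact: (hull_tube k0 sp hq (dclose_projM cS dr hq)).
Qed.

Lemma dclose_depth d S : dclose d S -> d <= r ->
  eucl (circumcenter (pts S)) (set_val (centerM S)) <= J * r / 2.
Proof.
move=> cS dr; have [d' d'd sp] := dclose_spread cS dr; have [s0 _ _ _] := sp.
have [cs _] := circumcenterP s0.
exact: (center_depth closedM k0 unip J_ge kr sp (dclose_projM cS dr cs)).
Qed.

Lemma dclose_inhull_center d S : dclose d S -> d <= r ->
  inhull (pts S) (circumcenter (pts S)).
Proof.
by move=> cS dr; have [d' _ [s0 _ _ _]] := dclose_spread cS dr; exact: (circumcenterP s0).1.
Qed.

End Family.

Lemma projM_lip x y : nearest M x (set_val (projM x)) ->
  nearest M y (set_val (projM y)) ->
  k * eucl x (set_val (projM x)) <= k * (J * r) ->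
  k * eucl y (set_val (projM y)) <= k * (J * r) ->
  dM (projM x) (projM y) <= E * eucl x y.
Proof. exact: tube_lip. Qed.

(* [q'] is obtained from [q] by replacing the projected centers with the
   circumcenters themselves, each at distance at most [J r / 2]. *)
Lemma layer_center_eucl (V : choiceType) (j : V -> M) (w : {fsfun V -> R with 0}) t :
  prob w -> 0 <= t -> dclose j r (finsupp w) ->
  let q := bary (@set_val _ M) (layer (push j) (centerM j) w t) in
  exists q', [/\ inhull (pts j (finsupp w)) q' & eucl q q' <= J * r / 2].
Proof.
move=> pw t0 cw q.
pose z T := circumcenter (pts j T).
pose q' := bary id (layer (push (fun v => set_val (j v))) z w t).
exists q'; split.
  apply: prob_inhull; first by apply: prob_layer => // w' pw' _; exact: prob_push.
  apply: layer_all => // [w' v pw' w'w /supp_push[u uw' ->]|T T0 Tw].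
    by apply: inhull_mem; apply: pts_mem; exact: (fsubsetP w'w).
  apply: (@inhull_sub R n (pts j T)); first exact: pts_sub Tw.
  exact: (dclose_inhull_center (dclose_sub cw Tw T0) (lexx _)).
have Jr0 : 0 <= J * r / 2 by rewrite divr_ge0// mulr_ge0 ?Jconst_ge0// ltW.
rewrite /q /q' /layer !bary_comb !bary_push !euclE opprD addrACA.
rewrite subrr add0r -sumrB.
pose L := levels t w.
have le1 : mass L <= 1.
  by rewrite -(mass_trunc pw t0) lerDr mass_trunc_ge0.
rewrite (_ : \sum_(T <- finsupp L) _ =
  \sum_(T <- finsupp L) L T *: (set_val (centerM j T) - z T)); last first.
  by apply: eq_bigr => T _; rewrite scalerBr.
apply: (@le_trans _ _ (\sum_(T <- finsupp L) L T * (J * r / 2))).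
  have tri (s : seq {fset V}) (F : {fset V} -> 'rV[R]_n) (b : {fset V} -> R) :
      (forall T, T \in s -> enorm (F T) <= b T) ->
      enorm (\sum_(T <- s) F T) <= \sum_(T <- s) b T.
    elim: s => [|T s IH] hb; first by rewrite !big_nil enorm0.
    rewrite !big_cons (le_trans (enormD _ _))// lerD ?hb ?mem_head//.
    by apply: IH => T' T's; apply: hb; rewrite inE T's orbT.
  apply: tri => T /supp_levels[T0 Tw _ _].
  rewrite enormZ ger0_norm ?levels_ge0// ler_wpM2l ?levels_ge0//.
  rewrite -euclE eucl_sym; exact: (dclose_depth (dclose_sub cw Tw T0) (lexx _)).
by rewrite -mulr_suml -[leRHS]mul1r ler_wpM2r.
Qed.

End Centers.

(** * Continuity of barycenters and of the projection *)

Section Continuity.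
Local Open Scope fset_scope.
Local Open Scope ring_scope.
Context (R : realType).

Lemma wcont_id (V : choiceType) (D : {fset V} -> Prop) :
  wcont D (fun (w : {fsfun V -> R with 0}) _ => w).
Proof. by split=> [S|//]; exists S. Qed.

Lemma wcont_fix (V V' : choiceType) (D : {fset V} -> Prop)
    (h : {fsfun V -> R with 0} -> R -> {fsfun V' -> R with 0}) t : 0 <= t ->
  wcont D h -> wcont D (fun w _ => h w t).
Proof.
move=> t0 [hS hc]; split=> [S|T F W t' w t'0 S FF pw Dw wS _ _ near cW _].
  by have [S' hS'] := hS S; exists S' => w _ pw Dw wS _; exact: hS'.
by apply: (hc _ _ _ (fun=> t) _ _ S) => //; exact: cvg_cst.
Qed.

Lemma cvg_bary (T : Type) (F : set_system T) (FF : Filter F) (V : choiceType)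
    n (j : V -> 'rV[R]_n) W (w : {fsfun V -> R with 0}) (S : {fset V}) :
  finsupp w `<=` S -> (\forall z \near F, finsupp (W z) `<=` S) -> wcvg F W w ->
  bary j (W z) @[z --> F] --> bary j w.
Proof.
move=> wS near cW; rewrite (bary_sub _ wS).
apply: (@cvg_trans _ ((\sum_(v <- S) W z v *: j v) @[z --> F])).
  by apply: near_eq_cvg; near=> z; apply/esym/bary_sub; near: z.
apply: cvg_big => [|v _]; first exact: add_continuous.
by apply: cvgZ; [exact: cW|exact: cvg_cst].
Unshelve. all: by end_near. Qed.

Definition in_tube n (M : set 'rV[R]_n) (m0 : M) (k c : R) (b : 'rV[R]_n) : Prop :=
  nearest M b (set_val (projM m0 b)) /\ k * eucl b (set_val (projM m0 b)) <= c.

Lemma cvg_projM n (M : set 'rV[R]_n) (m0 : M) (k c : R) (T : Type)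
    (F : set_system T) (FF : Filter F) (p : T -> 'rV[R]_n) a :
  closed M -> 0 <= k ->
  (forall a b, M b -> k * eucl a b < 1 -> exists! c, nearest M a c) ->
  c < 1 -> p @ F --> a ->
  (\forall z \near F, in_tube m0 k c (p z)) -> in_tube m0 k c a ->
  set_val (projM m0 (p z)) @[z --> F] --> set_val (projM m0 a).
Proof.
move=> cM k0 unip c1 /cvg_eucl pa near [na ka]; apply/cvg_eucl.
apply: (@squeeze_cvgr _ _ _ _ (fun=> 0) (fun z => (1 - c)^-1 * eucl (p z) a)).
- near=> z; rewrite eucl_ge0/=.
  have [nz kz] : in_tube m0 k c (p z) by near: z.
  exact: (nearest_lip_unif cM k0 unip nz na c1 kz ka).
- exact: cvg_cst.
- by rewrite -[0](mulr0 (1 - c)^-1); apply: cvgM => //; exact: cvg_cst.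
Unshelve. all: by end_near. Qed.

End Continuity.

(** * The interleaving, for a nonempty [M] and abstract constants *)

Section Reconstruction.
Local Open Scope fset_scope.
Local Open Scope ring_scope.
Context (R : realType) (n N : nat) (M : set 'rV[R]_n) (m0 : M).
Context (k delta emet efun e Lf : R).
Context (f : M -> 'rV[R]_N) (X : metricType R) (g : X -> 'rV[R]_N).
Context (y : X -> M) (x : M -> X).
Local Notation J := (Jconst R n).
Implicit Types (u v : 'rV[R]_N).
Let r : R := delta + emet.
(* [d] bounds the distance from a point of a set of diameter less than [r] to
   its projected circumcenter; it plays the role of [r] after contraction. *)
Let q : R := (1 - k * (J * r))^-1 * J.
Let d : R := q * r.
Hypothesis closedM : closed M.
Hypothesis k0 : 0 <= k.
Hypothesis unip : forall a b, M b -> k * eucl a b < 1 -> exists! c, nearest M a c.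
Hypothesis J_ge : 1 / 2 <= J.
Hypothesis delta0 : 0 < delta.
Hypothesis emet0 : 0 <= emet.
Hypothesis efun0 : 0 <= efun.
Hypothesis kr : k * (J * r) < 1 - J.
Hypothesis d_emet : d + emet <= delta.
Hypothesis Lf0 : 0 <= Lf.
Hypothesis f_lip : forall a b, `|f a - f b| <= Lf * dM a b.
Hypothesis e_ge : Lf * d + efun <= e.
Hypothesis y_dist : forall a b, dM (y a) (y b) <= mdist a b + emet.
Hypothesis x_dist : forall a b, mdist (x a) (x b) <= dM a b + emet.
Hypothesis xy_dist : forall a b, mdist a (x b) <= dM (y a) b + emet.
Hypothesis yx_dist : forall a, dM (y (x a)) a <= emet.
Hypothesis y_fun : forall a, `|g a - f (y a)| <= efun.
Hypothesis x_fun : forall a, `|g (x a) - f a| <= efun.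

Let J0 : 0 < J. Proof. by move: J_ge; lra. Qed.
Let kJr0 : 0 <= k * (J * r).
Proof. by rewrite !mulr_ge0 ?(ltW J0)// /r; move: delta0 emet0; lra. Qed.
Let r0 : 0 < r. Proof. by rewrite /r; move: delta0 emet0; lra. Qed.
Let q_lt1 : q < 1.
Proof.
rewrite /q mulrC ltr_pdivrMr ?mul1r; first by move: kr; lra.
by move: kr J0; lra.
Qed.
Let q_ge : 1 / 2 <= q.
Proof.
apply: le_trans J_ge _; rewrite /q mulrC ler_pdivlMr; last by move: kr J0; lra.
by rewrite mulrBr mulr1 gerBl; apply: mulr_ge0 => //; exact: ltW.
Qed.
Let d0 : 0 < d. Proof. by rewrite mulr_gt0//; move: q_ge; lra. Qed.
Let d_lt_r : d < r.
Proof. by rewrite /d gtr_pMl. Qed.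
Let qd_lt : q * d < d. Proof. by rewrite gtr_pMl. Qed.
Let emet_le : emet <= d / 2.
Proof.
have : r / 2 <= d by rewrite /d mulrC ler_pM2r//; move: q_ge; lra.
by move: d_emet; rewrite /r; lra.
Qed.
Let e0 : 0 <= e.
Proof. by apply: le_trans e_ge; rewrite addr_ge0// mulr_ge0// ltW. Qed.

(** Half of the room between [q * d] and [d]. As [q >= 1 / 2], it is at most [d / 4], so that
    vertices of the partition at one point are less than [d] apart. *)
Let eta : R := (1 - q) * d / 2.
Let eta0 : 0 < eta. Proof. by rewrite divr_gt0// mulr_gt0// subr_gt0. Qed.
Let eta_le : eta <= d / 4.
Proof.
have : (1 - q) * d <= 1 / 2 * d by rewrite ler_pM2r//; move: q_ge; lra.
by rewrite /eta; lra.
Qed.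
Let eta_qd : q * d + eta <= d.
Proof. by move: qd_lt; rewrite /eta; lra. Qed.

(** Vertices at infinity-norm distance below [2 * h] are at Euclidean distance at most
    [n * (2 * h)]; the successor of [n] makes this strictly less than [eta]. *)
Let h : R := eta / (2 * n.+1%:R).
Let h0 : 0 < h. Proof. by rewrite divr_gt0// mulr_gt0. Qed.
Let s := grid_partition m0 h0.

Lemma supp_s_dist (m v : M) : v \in finsupp (s m) -> dM m v < eta.
Proof.
move/supp_grid_partition => mv.
rewrite /dM euclE; apply: le_lt_trans (enorm_le_norm _) _.
apply: (@le_lt_trans _ _ (n%:R * (2 * h))); first by rewrite ler_wpM2l// ltW.
have n1 : 0 < n.+1%:R :> R by [].
have nn : n%:R < n.+1%:R :> R by rewrite ltr_nat.
rewrite /h; set c := n.+1%:R in n1 nn *.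
have -> : n%:R * (2 * (eta / (2 * c))) = n%:R * eta / c by field; rewrite gt_eqF.
by rewrite ltr_pdivrMr// mulrC ltr_pM2l.
Qed.

Lemma f_le a b t : dM a b <= t -> forall i, f b ord0 i <= f a ord0 i + Lf * t.
Proof.
move=> ab i; have [le _] := norm_le_coords (f_lip b a) i; rewrite dM_sym in le.
by apply: le_trans le _; rewrite lerD2l ler_wpM2l.
Qed.

Definition ripsX u := rips delta (sublevel g u).
Definition mclose (S : {fset X}) := S != fset0 /\
  forall a b, a \in S -> b \in S -> mdist a b < delta.

Lemma mclose_sub A B : mclose A -> B `<=` A -> B != fset0 -> mclose B.
Proof. by move=> [_ h'] /fsubsetP BA B0; split=> // a b /BA aA /BA bA; exact: h'. Qed.

Lemma mclose_dclose S : mclose S -> dclose y r S.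
Proof.
move=> [S0 hS]; split=> // a b aS bS.
by apply: le_lt_trans (y_dist a b) _; rewrite /r ltrD2r hS.
Qed.

Lemma ripsX_mclose u S : simplex (ripsX u) S -> mclose S.
Proof. by case. Qed.

Lemma ripsX_y u S a i : simplex (ripsX u) S -> a \in S ->
  f (y a) ord0 i <= u ord0 i + efun.
Proof.
move=> [_ hS _] aS; have [_ h1] := norm_le_coords (y_fun a) i.
by have := hS a aS i; lra.
Qed.

(** The way back from [M] into the Rips complex: scale [d] becomes at most [d + emet <= delta]. This
    is where the first contraction is spent. *)
Lemma push_x_simplex u (w : {fsfun M -> R with 0}) : prob w ->
  (forall a b, a \in finsupp w -> b \in finsupp w -> dM a b < d) ->
  (forall a i, a \in finsupp w -> f a ord0 i + efun <= u ord0 i) ->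
  prob (push x w) /\ simplex (ripsX u) (finsupp (push x w)).
Proof.
move=> pw hd hf; have pp := prob_push x pw; split=> //; split.
- exact: prob_supp_neq0.
- move=> _ /supp_push[a aw ->] i; have [h1 _] := norm_le_coords (x_fun a) i.
  by apply: le_trans h1 (hf a i aw).
move=> _ _ /supp_push[a aw ->] /supp_push[b bw ->].
apply: le_lt_trans (x_dist a b) _; apply: lt_le_trans d_emet.
by rewrite ltrD2r hd.
Qed.

Let P := rips_pspace g delta.
Let Q := sublevel_pspace f.
Let ee (u : 'rV[R]_N) := u + const_mx e + const_mx e.

Lemma eeE u i : ee u ord0 i = u ord0 i + 2 * e.
Proof. by rewrite !mxE; ring. Qed.

(** The ends are returned with their underlying weights, so that consecutive homotopies can be
    matched by comparing weights only. *)
Lemma rips_homotopy h' : wcont mclose h' ->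
  (forall u (w : {fsfun X -> R with 0}) (t : R),
     prob w -> simplex (ripsX u) (finsupp w) -> 0 <= t -> t <= 1 ->
     prob (h' w t) /\ simplex (ripsX (ee u)) (finsupp (h' w t))) ->
  exists F0 F1 : pmor P (pshift e (pshift e P)),
    [/\ forall u (w : realization R (ripsX u)),
          val (F0 u w : realization R (ripsX (ee u))) = h' (val w) 0,
        forall u (w : realization R (ripsX u)),
          val (F1 u w : realization R (ripsX (ee u))) = h' (val w) 1
      & ho_eq (ho_map F0) (ho_map F1)].
Proof.
move=> ch hh.
have H u (p : realization R (ripsX u) * R) :
    prob (h' (val p.1) (clamp p.2)) /\
    simplex (ripsX (ee u)) (finsupp (h' (val p.1) (clamp p.2))).
  have [pw Kw] := realization_prob p.1.
  by apply: hh => //; [exact: clamp_ge0|exact: clamp_le1].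
pose Hm u (p : realization R (ripsX u) * R) := realization_of (H u p).
have Hc u : continuous (Hm u : (cyl P) u -> pshift e (pshift e P) u).
  exact: (@continuous_wcont _ _ _ _ _ mclose h' (Hm u) ch (@ripsX_mclose u)).
have Hn u v (uv : lev u v) (p : (cyl P) u) :
    Hm v (Defs.pmap uv p) = Defs.pmap uv (Hm u p : pshift e (pshift e P) u).
  exact: val_inj.
pose HH : pmor (cyl P) (pshift e (pshift e P)) := PMor Hc Hn.
exists (pmor_comp HH (cyl_at P 0)), (pmor_comp HH (cyl_at P 1)); split.
- by move=> u w /=; rewrite clamp0.
- by move=> u w /=; rewrite clamp1.
- exact: (ho_homotopy (H := HH)).
Qed.

(** * The four homotopies stay in the complex *)

Let cM := centerM m0 y.
Let cc := centerM m0 (@id M).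
Let B (w : {fsfun M -> R with 0}) : M := projM m0 (bary (@set_val _ M) w).
Let center_weights (w : {fsfun X -> R with 0}) := layer (push y) cM w 1.

Let dr : d <= r := ltW d_lt_r.

Lemma centerM_f u S T i : simplex (ripsX u) S -> T `<=` S -> T != fset0 ->
  f (cM T) ord0 i <= u ord0 i + efun + Lf * d.
Proof.
move=> KS TS T0; have [a aT] := fset0Pn _ T0.
have cT := mclose_dclose (mclose_sub (ripsX_mclose KS) TS T0).
have h1 := center_vertex m0 closedM k0 unip J_ge r0 kr cT (lexx r) aT.
have := f_le (ltW h1) i; have := ripsX_y i KS (fsubsetP TS a aT).
by rewrite -/q -/d -/cM; lra.
Qed.

Lemma centerM_y S T a : mclose S -> T `<=` S -> a \in T -> dM (y a) (cM T) < d.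
Proof.
move=> DS TS aT; have T0 : T != fset0 by apply/fset0Pn; exists a.
have cT := mclose_dclose (mclose_sub DS TS T0).
exact: (center_vertex m0 closedM k0 unip J_ge r0 kr cT (lexx r) aT).
Qed.

Lemma centerM_centerM S T T' : mclose S -> T' `<=` S -> T != fset0 -> T `<=` T' ->
  dM (cM T) (cM T') < d.
Proof.
move=> DS TS' T0 TT'; have T0' : T' != fset0.
  by apply: contra T0 => /eqP T'0; rewrite T'0 fsubset0 in TT'.
have cT' := mclose_dclose (mclose_sub DS TS' T0').
exact: (center_center m0 closedM k0 unip J_ge r0 kr cT' (lexx r) TT' T0).
Qed.

Let Lf_eta : Lf * eta <= Lf * d / 4.
Proof. by have := ler_wpM2l Lf0 eta_le; lra. Qed.
Let Lf_qd : Lf * (q * d) + Lf * eta <= Lf * d.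
Proof. by have := ler_wpM2l Lf0 eta_qd; lra. Qed.
Let Lf_eta0 : 0 <= Lf * eta. Proof. by rewrite mulr_ge0// ltW. Qed.
Let Lf_d0 : 0 <= Lf * d. Proof. by rewrite mulr_ge0// ltW. Qed.

(** From the inclusion to the centers. An old vertex is compared with a center by [xy_dist], two
    centers by [x_dist]; both give [d + emet <= delta]. The values move by [Lf * d] and twice by
    [efun]. *)
Lemma incl_centers_simplex u (w : {fsfun X -> R with 0}) (t : R) :
  prob w -> simplex (ripsX u) (finsupp w) -> 0 <= t -> t <= 1 ->
  prob (layer id (x \o cM) w t) /\
  simplex (ripsX (ee u)) (finsupp (layer id (x \o cM) w t)).
Proof.
move=> pw Kw t0 _; have [w0 hu hd] := Kw.
have cw := ripsX_mclose Kw.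
have pl : prob (layer id (x \o cM) w t) by exact: prob_layer.
split=> //; split; first exact: prob_supp_neq0.
  apply: layer_all => // [w' a _ /fsubsetP w'w aw' i|T T0 Tw i].
    rewrite eeE; have := hu a (w'w a aw') i; have := e0; lra.
  have [h1 _] := norm_le_coords (x_fun (cM T)) i.
  by have := centerM_f i Kw Tw T0; rewrite eeE; move: e_ge h1 Lf_d0; rewrite /=; lra.
apply: layer_rel => // [a b|w' a b _ /fsubsetP w'w aw bw|w' T a _ /fsubsetP w'T Tw aw|
    T T' T0 TT' Tw].
- by rewrite metric_sym.
- by apply: hd; exact: w'w.
- apply: le_lt_trans (xy_dist a (cM T)) _; apply: lt_le_trans d_emet.
  by rewrite ltrD2r; apply: centerM_y cw Tw _; exact: w'T.
apply: le_lt_trans (x_dist _ _) _; apply: lt_le_trans d_emet.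
by rewrite ltrD2r; exact: centerM_centerM cw Tw T0 TT'.
Qed.

Lemma center_weights_close (w : {fsfun X -> R with 0}) : prob w -> mclose (finsupp w) ->
  prob (center_weights w) /\ dclose (@id M) d (finsupp (center_weights w)).
Proof.
move=> pw Dw.
have pA : prob (center_weights w) by apply: prob_layer => // w' pw' _; exact: prob_push.
split=> //; split; first exact: prob_supp_neq0.
rewrite /center_weights layer_ge1// => a b /supp_push[T Tl ->] /supp_push[T' Tl' ->] /=.
have [T0 Tw _ _] := supp_levels Tl; have [T0' Tw' _ _] := supp_levels Tl'.
have [TT'|TT'] := supp_levels_chain Tl Tl'; first exact: centerM_centerM Dw Tw' T0 TT'.
by rewrite dM_sym; exact: centerM_centerM Dw Tw T0' TT'.
Qed.

Lemma center_weights_f u (w : {fsfun X -> R with 0}) a i :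
  prob w -> simplex (ripsX u) (finsupp w) -> a \in finsupp (center_weights w) ->
  f a ord0 i <= u ord0 i + efun + Lf * d.
Proof.
move=> pw Kw; rewrite /center_weights layer_ge1// => /supp_push[T Tl ->].
by have [T0 Tw _ _] := supp_levels Tl; exact: centerM_f Kw Tw T0.
Qed.

(** From the centers to centers of sets of centers. Vertices and new centers are within [q * d], and
    the values drift by at most [Lf * d + Lf * (q * d)] before the return by [x]. *)
Lemma centers_refine_simplex u (w : {fsfun X -> R with 0}) (t : R) :
  prob w -> simplex (ripsX u) (finsupp w) -> 0 <= t -> t <= 1 ->
  prob (push x (layer id cc (center_weights w) t)) /\
  simplex (ripsX (ee u)) (finsupp (push x (layer id cc (center_weights w) t))).
Proof.
move=> pw Kw t0 _; have [pA cA] := center_weights_close pw (ripsX_mclose Kw).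
apply: push_x_simplex; first exact: prob_layer.
  apply: layer_rel => // [a b|w' a b _ /fsubsetP w'w aw bw|w' T a _ /fsubsetP w'T Tw aw|
    T T' T0 TT' Tw].
  - by rewrite dM_sym.
  - by apply: cA.2; exact: w'w.
  - have aT := w'T a aw; have T0 : T != fset0 by apply/fset0Pn; exists a.
    apply: lt_trans qd_lt.
    exact: (center_vertex m0 closedM k0 unip J_ge r0 kr (dclose_sub cA Tw T0) dr aT).
  - apply: lt_trans qd_lt.
    have T0' : T' != fset0.
      by apply: contra T0 => /eqP T'0; rewrite T'0 fsubset0 in TT'.
    exact: (center_center m0 closedM k0 unip J_ge r0 kr (dclose_sub cA Tw T0') dr TT' T0).
move=> a i; move: a; apply: layer_all => // [w' a _ /fsubsetP w'w aw|T T0 Tw].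
  by have := center_weights_f i pw Kw (w'w a aw); rewrite eeE; move: e_ge Lf_d0; lra.
have [a aT] := fset0Pn _ T0.
have h1 := center_vertex m0 closedM k0 unip J_ge r0 kr (dclose_sub cA Tw T0) dr aT.
have := f_le (ltW h1) i; have := center_weights_f i pw Kw (fsubsetP Tw a aT).
by rewrite eeE -/q -/cc; move: e_ge Lf_qd Lf_eta0 => /=; lra.
Qed.

Lemma weight_proj_vertex t (w : {fsfun M -> R with 0}) : prob w ->
  dclose (@id M) t (finsupp w) -> t <= r ->
  exists2 v, v \in finsupp w & dM (B w) v < q * t.
Proof.
move=> pw cw tr.
exact: (dclose_vertex m0 closedM k0 unip J_ge r0 kr cw tr (inhull_bary id pw (fsubset_refl _))).
Qed.

(** Its end is that of the preceding homotopy, its start the partition of unity at the projected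
    barycenter. A partition vertex is within [eta] of that projection and the projection within
    [q * d] of a center: this uses up [q * d + eta <= d]. *)
Lemma refine_project_simplex u (w : {fsfun X -> R with 0}) (t : R) :
  prob w -> simplex (ripsX u) (finsupp w) -> 0 <= t -> t <= 1 ->
  prob (push x (layer (fun w' => s (B w')) cc (center_weights w) t)) /\
  simplex (ripsX (ee u)) (finsupp (push x (layer (fun w' => s (B w')) cc (center_weights w) t))).
Proof.
move=> pw Kw t0 _; have [pA cA] := center_weights_close pw (ripsX_mclose Kw).
apply: push_x_simplex.
- by apply: prob_layer => // w' _ _; exact: prob_grid_partition.
- apply: layer_rel => // [a b|w' a b _ _ /supp_s_dist aw /supp_s_dist bw|
    w' T a pw' w'T Tw /supp_s_dist aw|T T' T0 TT' Tw].
  + by rewrite dM_sym.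
  + apply: le_lt_trans (dM_triangle (B w') a b) _; rewrite dM_sym in aw.
    by move: aw bw eta_le d0; lra.
  + have T0 : T != fset0.
      have := prob_supp_neq0 pw'; apply: contra => /eqP T0.
      by rewrite T0 fsubset0 in w'T.
    apply: le_lt_trans (dM_triangle (B w') a (cc T)) _; rewrite dM_sym in aw.
    have := dclose_center m0 closedM k0 unip J_ge r0 kr (dclose_sub cA Tw T0) dr
      (inhull_bary id pw' w'T).
    by rewrite -/(B w') -/q -/cc => h1; move: aw eta_qd; lra.
  + apply: lt_trans qd_lt.
    have T0' : T' != fset0.
      by apply: contra T0 => /eqP T'0; rewrite T'0 fsubset0 in TT'.
    exact: (center_center m0 closedM k0 unip J_ge r0 kr (dclose_sub cA Tw T0') dr TT' T0).
- move=> a i; move: a; apply: layer_all => // [w' a pw' w'w /supp_s_dist aw|T T0 Tw].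
    have [v vw hv] := weight_proj_vertex pw' (dclose_sub cA w'w (prob_supp_neq0 pw')) dr.
    have := f_le (ltW aw) i; rewrite dM_sym in hv; have := f_le (ltW hv) i.
    have := center_weights_f i pw Kw (fsubsetP w'w v vw).
    by rewrite eeE; move: e_ge Lf_qd => /=; lra.
  have [a aT] := fset0Pn _ T0.
  have h1 := center_vertex m0 closedM k0 unip J_ge r0 kr (dclose_sub cA Tw T0) dr aT.
  have := f_le (ltW h1) i; have := center_weights_f i pw Kw (fsubsetP Tw a aT).
  by rewrite eeE -/q -/cc; move: e_ge Lf_qd Lf_eta0 => /=; lra.
Qed.

Lemma layer_y_close (w : {fsfun X -> R with 0}) (t : R) : prob w -> mclose (finsupp w) ->
  0 <= t -> prob (layer (push y) cM w t) /\
  dclose (@id M) r (finsupp (layer (push y) cM w t)).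
Proof.
move=> pw Dw t0.
have pl : prob (layer (push y) cM w t).
  by apply: prob_layer => // w' pw' _; exact: prob_push.
split=> //; split; first exact: prob_supp_neq0.
apply: layer_rel => // [a b|
    w' a b _ /fsubsetP w'w /supp_push[a' aw ->] /supp_push[b' bw ->]|
    w' T a _ /fsubsetP w'T Tw /supp_push[a' aw ->]|T T' T0 TT' Tw].
- by rewrite dM_sym.
- by apply: (mclose_dclose Dw).2; exact: w'w.
- by apply: lt_trans d_lt_r; apply: centerM_y Dw Tw _; exact: w'T.
- by apply: lt_trans d_lt_r; exact: centerM_centerM Dw Tw T0 TT'.
Qed.

(** The delicate point is the value of [f]: trading projected centers for circumcenters costs
    [d / 2], reaching a vertex [d], and the partition at most [d / 4], together less than
    [2 * d]. *)
Lemma project_composite_simplex u (w : {fsfun X -> R with 0}) (t : R) :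
  prob w -> simplex (ripsX u) (finsupp w) -> 0 <= t -> t <= 1 ->
  prob (push x (s (B (layer (push y) cM w t)))) /\
  simplex (ripsX (ee u)) (finsupp (push x (s (B (layer (push y) cM w t))))).
Proof.
move=> pw Kw t0 _; have Dw := ripsX_mclose Kw; have cw := mclose_dclose Dw.
have [pl cl] := layer_y_close pw Dw t0.
set p := B _; apply: push_x_simplex; first exact: prob_grid_partition.
  move=> a b /supp_s_dist aw /supp_s_dist bw; rewrite dM_sym in aw.
  by apply: le_lt_trans (dM_triangle p a b) _; move: aw bw eta_le d0; lra.
move=> a i /supp_s_dist pa.
have [p' [hp' pp']] := layer_center_eucl m0 closedM k0 unip J_ge r0 kr pw t0 cw.
have hp := inhull_bary id pl (fsubset_refl _).
have := projM_lip closedM k0 unip kr (dclose_projM m0 k0 unip r0 kr cl (lexx r) hp)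
  (dclose_projM m0 k0 unip r0 kr cw (lexx r) hp')
  (dclose_tube m0 k0 unip r0 kr cl (lexx r) hp) (dclose_tube m0 k0 unip r0 kr cw (lexx r) hp').
rewrite -/cM -/(B _) -/p => ppr.
have [v vw hv] := dclose_vertex m0 closedM k0 unip J_ge r0 kr cw (lexx r) hp'.
have pp2 : dM p (projM m0 p') <= d / 2.
  apply: le_trans ppr _; have E0 : 0 <= (1 - k * (J * r))^-1.
    by rewrite invr_ge0; move: kr J0; lra.
  by have := ler_wpM2l E0 pp'; rewrite /d /q; lra.
rewrite dM_sym in pp2; have := f_le pp2 i; have := f_le (ltW pa) i.
rewrite dM_sym in hv; have := f_le (ltW hv) i; have := ripsX_y i Kw vw.
by rewrite eeE -/q -/d; move: e_ge Lf_eta Lf_d0; lra.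
Qed.

(** * Continuity of the four homotopies *)

Let kr1 : k * (J * r) < 1. Proof. by move: kr J0; lra. Qed.

Lemma wcont_partition_proj : wcont (dclose (@id M) r) (fun w _ => s (B w)).
Proof.
split=> [S|T F W t w t0 S FF pw Dw wS _ _ near cW _].
  (* The projected barycenter is within [d] of a vertex in [S], hence in a bounded set, where the
     partition has finitely many vertices. *)
  pose rho := \big[Num.max/0]_(v <- S) `|set_val v : 'rV[R]_n| + d.
  have [S' hS'] := grid_partition_bounded m0 h0 rho.
  exists S' => w t pw cw /fsubsetP wS _; apply: hS'.
  have [v vw hv] := weight_proj_vertex pw cw (lexx r).
  rewrite -[set_val (B w)](subrK (set_val v)) (le_trans (ler_normD _ _))//.
  rewrite addrC lerD//.
    by apply: (le_bigmax_seq _ v) => //; exact: wS.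
  by apply: le_trans (norm_le_enorm _) _; rewrite -euclE; exact: ltW.
apply: wcvg_grid_partition.
apply: (cvg_projM FF closedM k0 unip kr1).
- by apply: cvg_bary wS _ cW; apply: filterS near => z [].
- apply: filterS near => z [pz cz _].
  have hz := inhull_bary id pz (fsubset_refl _).
  by split; [exact: (dclose_projM m0 k0 unip r0 kr cz (lexx r) hz)
            |exact: (dclose_tube m0 k0 unip r0 kr cz (lexx r) hz)].
- have hw := inhull_bary id pw (fsubset_refl _).
  by split; [exact: (dclose_projM m0 k0 unip r0 kr Dw (lexx r) hw)
            |exact: (dclose_tube m0 k0 unip r0 kr Dw (lexx r) hw)].
Qed.

Lemma wcont_center_weights : @wcont R _ _ mclose (fun w _ => center_weights w).
Proof.
apply: (wcont_fix (h := layer (push y) cM) ler01).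
apply: wcont_layer; first exact: mclose_sub.
  by move=> w pw _; exact: prob_push.
exact: wcont_push.
Qed.

Lemma wcont_incl_centers : @wcont R _ _ mclose (layer id (x \o cM)).
Proof.
by apply: wcont_layer => //; [exact: mclose_sub|exact: wcont_id].
Qed.

Lemma wcont_push_x (D : {fset X} -> Prop)
    (h' : {fsfun X -> R with 0} -> R -> {fsfun M -> R with 0}) :
  wcont D h' -> (forall w (t : R), prob w -> D (finsupp w) -> 0 <= t -> prob (h' w t)) ->
  wcont D (fun w t => push x (h' w t)).
Proof.
move=> ch ph; apply: (wcont_comp (D' := fun=> True) (h' := fun w _ => push x w) ch).
  exact: wcont_push.
by move=> w t pw Dw t0; split=> //; exact: ph.
Qed.

Lemma wcont_centers_refine :
  @wcont R _ _ mclose (fun w t => push x (layer id cc (center_weights w) t)).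
Proof.
apply: wcont_push_x; last first.
  by move=> w t pw Dw t0; have [pA _] := center_weights_close pw Dw; exact: prob_layer.
apply: (wcont_comp wcont_center_weights (D' := dclose (@id M) d) (h' := layer id cc)).
  by apply: wcont_layer => //; [exact: dclose_sub|exact: wcont_id].
by move=> w t pw Dw t0; exact: center_weights_close.
Qed.

Lemma wcont_refine_project :
  @wcont R _ _ mclose (fun w t => push x (layer (fun w' => s (B w')) cc (center_weights w) t)).
Proof.
apply: wcont_push_x; last first.
  move=> w t pw Dw t0; have [pA _] := center_weights_close pw Dw; apply: prob_layer => // *.
  exact: prob_grid_partition.
apply: (wcont_comp wcont_center_weights (D' := dclose (@id M) d)
  (h' := layer (fun w' => s (B w')) cc)).
  apply: wcont_layer; first exact: dclose_sub.
    by move=> *; exact: prob_grid_partition.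
  by apply: wcont_sub wcont_partition_proj => S; exact: dclose_le.
by move=> w t pw Dw t0; exact: center_weights_close.
Qed.

Lemma wcont_project_composite :
  @wcont R _ _ mclose (fun w t => push x (s (B (layer (push y) cM w t)))).
Proof.
apply: wcont_push_x; last by move=> *; exact: prob_grid_partition.
apply: (wcont_comp (h := layer (push y) cM) _ wcont_partition_proj).
  apply: wcont_layer; first exact: mclose_sub.
    by move=> w pw _; exact: prob_push.
  exact: wcont_push.
by move=> w t pw Dw t0; exact: layer_y_close.
Qed.

(** * The two maps and their composites *)

Lemma weight_proj_push (w : {fsfun X -> R with 0}) :
  B (push y w) = projM m0 (bary (fun a => set_val (y a)) w).
Proof. by rewrite /B bary_push. Qed.

Lemma phi_mem u (w : realization R (ripsX u)) :
  sublevel f (u + const_mx e) (B (push y (val w))).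
Proof.
have [pw Kw] := realization_prob w; have cw := mclose_dclose (ripsX_mclose Kw).
move=> i; rewrite !mxE weight_proj_push.
have hw := inhull_bary y pw (fsubset_refl _).
have [v vw hv] := dclose_vertex m0 closedM k0 unip J_ge r0 kr cw (lexx r) hw.
rewrite dM_sym in hv; have := f_le (ltW hv) i; have := ripsX_y i Kw vw.
by rewrite -/q -/d; move: e_ge; lra.
Qed.

Lemma continuous_sublevel (T : topologicalType) u (h' : T -> sublevel f u) :
  continuous (fun z => set_val (set_val (h' z)) : 'rV[R]_n) -> continuous h'.
Proof.
move=> ch; apply: (@continuous_comp_initial _ _ _ (set_val : sublevel f u -> M)).
exact: (@continuous_comp_initial _ _ _ (set_val : M -> 'rV[R]_n)).
Qed.

Definition phi_fun u (w : P u) : pshift e Q u :=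
  exist _ (B (push y (val (w : realization R (ripsX u))))) (mem_set (phi_mem w)).

Lemma continuous_phi u : continuous (@phi_fun u).
Proof.
apply: continuous_sublevel.
(* A dummy real coordinate, so that [continuous_realization_cyl] applies. *)
pose hh (p : realization R (ripsX u) * R) : 'rV[R]_n :=
  set_val (projM m0 (bary (fun a => set_val (y a)) (val p.1))).
have ch : continuous hh.
  apply: continuous_realization_cyl => S w t KS wS.
  have FF : Filter (simplex_nbhs S w) by exact: simplex_nbhs_filter.
  have cl (z : realization R (ripsX u)) :
      in_tube m0 k (k * (J * r)) (bary (fun a => set_val (y a)) (val z)).
    have [pz Kz] := realization_prob z; have cz := mclose_dclose (ripsX_mclose Kz).
    have hz := inhull_bary y pz (fsubset_refl _).
    by split; [exact: (dclose_projM m0 k0 unip r0 kr cz (lexx r) hz)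
              |exact: (dclose_tube m0 k0 unip r0 kr cz (lexx r) hz)].
  apply: (cvg_projM _ closedM k0 unip kr1); [|by apply: nearW => p; exact: cl|exact: cl].
  apply: (cvg_bary _ wS).
    exists ([set w' : realization R (ripsX u) | finsupp (val w') `<=` S], setT).
      by split; [exact: near_simplex_nbhs|exact: filterT].
    by move=> [w' t'] [].
  move=> v; apply: (cvg_comp fst (fun z : realization R (ripsX u) => val z v));
    [exact: cvg_fst|exact: cvg_simplex_nbhs].
have -> : (fun z => set_val (set_val (phi_fun z))) = (fun z : P u => hh (z, 0)).
  by apply/funext => z; rewrite /hh -weight_proj_push.
apply: (continuous_comp_fun _ ch); apply: continuous_pair; first by move=> z; exact: cvg_id.
exact: continuous_const.
Qed.

Definition phi : pmor P (pshift e Q).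
Proof.
exists phi_fun; first exact: continuous_phi.
by move=> u v uv w; apply: val_inj.
Defined.

Lemma psi_mem u (m : sublevel f u) :
  prob (push x (s (set_val m))) /\
  simplex (ripsX (u + const_mx e)) (finsupp (push x (s (set_val m)))).
Proof.
apply: push_x_simplex; first exact: prob_grid_partition.
  move=> a b /supp_s_dist aw /supp_s_dist bw; rewrite dM_sym in aw.
  by apply: le_lt_trans (dM_triangle (set_val m) a b) _; move: aw bw eta_le d0; lra.
move=> a i /supp_s_dist /ltW am; have := f_le am i; rewrite !mxE.
have : f (set_val m) ord0 i <= u ord0 i := set_mem (valP m) i.
by move: e_ge Lf_eta Lf_d0; lra.
Qed.

Definition psi_fun u (m : Q u) : pshift e P u :=
  realization_of (psi_mem (m : sublevel f u)).

Lemma near_grid (T : Type) (F : set_system T) (FF : Filter F) (m : T -> M) (a : M) :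
  set_val (m z) @[z --> F] --> set_val a ->
  exists S, finsupp (s a) `<=` S /\ \forall z \near F, finsupp (s (m z)) `<=` S.
Proof.
move=> ma.
have [S hS] := grid_partition_bounded m0 h0 (`|set_val a : 'rV[R]_n| + 1).
exists S; split; first by apply: hS; rewrite lerDl.
move/cvgrPdist_lt : ma => /(_ 1 ltr01); apply: filterS => z az; apply: hS.
rewrite -[set_val (m z)](subKr (set_val a)) (le_trans (ler_normB _ _))//.
by rewrite lerD2l ltW.
Qed.

Lemma sublevel_val_continuous u :
  continuous (fun z : sublevel f u => set_val (set_val z) : 'rV[R]_n).
Proof.
apply: (@continuous_comp_fun _ _ _ set_val (set_val : M -> 'rV[R]_n));
  exact: initial_continuous.
Qed.

Lemma continuous_psi u : continuous (@psi_fun u).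
Proof.
move=> m; have mc := @sublevel_val_continuous u m.
have [S [mS near]] := near_grid (nbhs_filter m) mc.
apply: (@cvg_realization _ _ _ _ _ (nbhs_filter m) _ _ [fset x a | a in S]).
  by apply: filterS near => z; exact: supp_push_sub.
rewrite -[wcvg _ _ _]/(wcvg (nbhs m) (fun z : sublevel f u => push x (s (set_val z)))
  (push x (s (set_val m)))).
apply: (@wcvg_push _ _ _ (nbhs_filter m) _ _ x _ _ _ mS near).
exact: (@wcvg_grid_partition _ _ _ _ _ _ _ _ (nbhs_filter m) _ _ mc).
Qed.

Definition psi : pmor Q (pshift e P).
Proof.
exists psi_fun; first exact: continuous_psi.
by move=> u v uv w; apply: val_inj.
Defined.

Lemma pmor_val_eq (F G : pmor P (pshift e (pshift e P))) :
  (forall u (w : realization R (ripsX u)),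
     val (F u w : realization R (ripsX (ee u))) =
     val (G u w : realization R (ripsX (ee u)))) -> F = G.
Proof. by move=> FG; apply: pmor_ext => u w; apply: val_inj; exact: FG. Qed.

(** [A] and [B] are run forwards from the inclusion, [C] and [D] backwards to the composite. [B] and
    [C] meet because [layer] at time 1 depends only on the centers. *)
Lemma psi_phi :
  ho_eq (ho_map (pmor_comp (pshift_mor e psi) phi)) (ho_map (pstruct2 e0 P)).
Proof.
have [A0 [A1 [A0E A1E hA]]] := rips_homotopy wcont_incl_centers incl_centers_simplex.
have [B0 [B1 [B0E B1E hB]]] := rips_homotopy wcont_centers_refine centers_refine_simplex.
have [C0 [C1 [C0E C1E hC]]] := rips_homotopy wcont_refine_project refine_project_simplex.
have [D0 [D1 [D0E D1E hD]]] := rips_homotopy wcont_project_composite project_composite_simplex.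
have pw u (w : realization R (ripsX u)) := (realization_prob w).1.
have pA u (w : realization R (ripsX u)) := (center_weights_close (pw u w)
  (ripsX_mclose (realization_prob w).2)).1.
have <- : A0 = pstruct2 e0 P by apply: pmor_val_eq => u w; rewrite A0E layer0.
have <- : D0 = pmor_comp (pshift_mor e psi) phi.
  by apply: pmor_val_eq => u w; rewrite D0E layer0.
have AB : A1 = B0.
  by apply: pmor_val_eq => u w; rewrite A1E B0E layer0// /center_weights !layer_ge1// push_push.
have BC : B1 = C1.
  by apply: pmor_val_eq => u w; rewrite B1E C1E !layer_ge1.
have CD : C0 = D1.
  by apply: pmor_val_eq => u w; rewrite C0E D1E layer0.
rewrite AB in hA; rewrite BC in hB; rewrite CD in hC.
apply: ho_trans hD (ho_sym _); apply: ho_trans hA _; apply: ho_trans hB _.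
exact: ho_sym.
Qed.

(** The point of [R^n] whose projection is the composite at [m]. *)
Let back (m : M) : 'rV[R]_n := bary (@set_val _ M) (push y (push x (s m))).

(** The partition contributes [eta <= d / 4] and the correspondence [emet <= d / 2]. *)
Lemma back_dist m : eucl (set_val m) (back m) <= 3 / 4 * d.
Proof.
have pb : prob (push y (push x (s m))).
  by do 2 apply: prob_push; exact: prob_grid_partition.
apply: (inhull_ball (inhull_bary id pb (fsubset_refl _))).
move=> _ /mapP[_ /supp_push[_ /supp_push[a /supp_s_dist ma ->] ->] ->].
have := dM_triangle a m (y (x a)); have := yx_dist a; rewrite dM_sym.
by rewrite /dM; move: ma eta_le emet_le; rewrite /dM; lra.
Qed.

Let path (m : M) (t : R) : 'rV[R]_n := set_val m + t *: (back m - set_val m).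

Lemma path_dist m t : 0 <= t -> t <= 1 -> eucl (path m t) (set_val m) <= 3 / 4 * d.
Proof.
move=> t0 t1; rewrite /path euclE addrAC subrr add0r enormZ ger0_norm//.
rewrite -euclE eucl_sym; apply: le_trans (back_dist m).
by rewrite ler_piMl// eucl_ge0.
Qed.

Lemma path_tube m t : 0 <= t -> t <= 1 -> in_tube m0 k (3 / 4) (path m t).
Proof.
move=> t0 t1; have pd := path_dist m t0 t1; have Mm := set_mem (valP m).
(* From [J >= 1 / 2] and [k * (J * r) < 1 - J] follows [k * r <= 1], and [d < r]. *)
have kd : k * (3 / 4 * d) <= 3 / 4.
  have kr2 : k * r <= 1.
    have h1 : k * r * (1 / 2) <= k * r * J by rewrite ler_wpM2l// mulr_ge0// ltW.
    by move: kr J_ge h1; lra.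
  have h2 : k * d <= k * r by rewrite ler_wpM2l.
  by move: h2 kr2; lra.
have kp : k * eucl (path m t) (set_val m) <= 3 / 4.
  by apply: le_trans kd; rewrite ler_wpM2l.
have [|a [na _]] := unip Mm (a := path m t); first by move: kp; lra.
have np := projMP m0 na; split=> //.
by apply: le_trans kp; rewrite ler_wpM2l//; exact: np.2 _ Mm.
Qed.

Lemma path_proj m t : 0 <= t -> t <= 1 -> dM m (projM m0 (path m t)) <= 2 * d.
Proof.
move=> t0 t1; have pd := path_dist m t0 t1; have Mm := set_mem (valP m).
have [np _] := path_tube m t0 t1.
have := np.2 _ Mm; have := eucl_triangle (set_val m) (path m t) (set_val (projM m0 (path m t))).
by rewrite (eucl_sym (set_val m) (path m t)) /dM; move: d0 pd; lra.
Qed.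

Lemma phi_psi :
  ho_eq (ho_map (pmor_comp (pshift_mor e phi) psi)) (ho_map (pstruct2 e0 Q)).
Proof.
have H u (p : sublevel f u * R) :
    sublevel f (ee u) (projM m0 (path (set_val p.1) (clamp p.2))).
  move=> i; rewrite eeE.
  have := f_le (path_proj (set_val p.1) (clamp_ge0 p.2) (clamp_le1 p.2)) i.
  have : f (set_val p.1) ord0 i <= u ord0 i := set_mem (valP p.1) i.
  by move: e_ge efun0; lra.
pose Hm u (p : (cyl Q) u) : pshift e (pshift e Q) u :=
  exist _ (projM m0 (path (set_val (p : sublevel f u * R).1) (clamp p.2)))
    (mem_set (H u p)).
have Hc u : continuous (Hm u).
  apply: continuous_sublevel => -[m t].
  pose F : set_system (sublevel f u * R) := nbhs (m, t).
  have FF : Filter F by exact: nbhs_filter.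
  have mc : set_val (set_val z.1) @[z --> F] --> (set_val (set_val m) : 'rV[R]_n).
    apply: (cvg_comp fst (fun z : sublevel f u => set_val (set_val z) : 'rV[R]_n)).
      exact: cvg_fst.
    exact: sublevel_val_continuous.
  apply: (@cvg_projM _ _ _ m0 k (3 / 4) _ F FF
    (fun z => path (set_val z.1) (clamp z.2)) (path (set_val m) (clamp t))
    closedM k0 unip).
  - by lra.
  - have [S [mS near]] := near_grid FF mc.
    have near1 : \forall z \near F, finsupp (push x (s (set_val z.1))) `<=` [fset x a | a in S].
      by apply: filterS near => z; exact: supp_push_sub.
    have near2 : \forall z \near F, finsupp (push y (push x (s (set_val z.1)))) `<=`
        [fset y b | b in [fset x a | a in S]].
      by apply: filterS near1 => z; exact: supp_push_sub.
    have bc : back (set_val z.1) @[z --> F] --> back (set_val m).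
      apply: (cvg_bary _ (supp_push_sub y (supp_push_sub x mS)) near2).
      apply: (@wcvg_push _ _ _ FF _ _ y _ _ _ (supp_push_sub x mS) near1).
      apply: (@wcvg_push _ _ _ FF _ _ x _ _ _ mS near).
      exact: (@wcvg_grid_partition _ _ _ _ _ _ _ _ FF _ _ mc).
    apply: cvgD => //; apply: cvgZ; last exact: cvgB.
    by apply: cvg_clamp; exact: cvg_snd.
  - by apply: nearW => z; apply: path_tube; [exact: clamp_ge0|exact: clamp_le1].
  - by apply: path_tube; [exact: clamp_ge0|exact: clamp_le1].
have Hn u v (uv : lev u v) (p : (cyl Q) u) :
    Hm v (Defs.pmap uv p) = Defs.pmap uv (Hm u p : pshift e (pshift e Q) u).
  exact: val_inj.
pose HH : pmor (cyl Q) (pshift e (pshift e Q)) := PMor Hc Hn.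
apply: ho_sym; apply: (ho_homotopy (H := HH)) => u m; apply: val_inj => /=.
  by rewrite clamp0 /path scale0r addr0 (projM_self m0 unip).
by rewrite clamp1 /path scale1r subrKC.
Qed.

Lemma reconstruction : interleaved e P Q.
Proof.
exists e0, (ho_map phi), (ho_map psi); split => /=.
  exact: ho_trans (ho_map_comp _ _) psi_phi.
exact: ho_trans (ho_map_comp _ _) phi_psi.
Qed.

End Reconstruction.

(** * The empty case, the reach and the constants *)

(** Serves an empty [M], where no default point [m0] exists. *)
Lemma interleaved_empty (R : realType) (N : nat) (e : R) (F G : pspace R N) :
  0 <= e -> (forall u, F u -> False) -> (forall u, G u -> False) ->
  interleaved e F G.
Proof.
move=> e0 F0 G0.
have mk (A B : pspace R N) : (forall u, A u -> False) -> pmor A B.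
  move=> A0; exists (fun u a => False_rect _ (A0 u a)) => [u a|u v h a].
    by case: (A0 u a).
  by case: (A0 u a).
exists e0, (ho_map (mk _ _ F0)), (ho_map (mk _ _ G0)); split.
  apply: ho_trans (ho_map_comp _ _) _; rewrite (_ : pmor_comp _ _ = pstruct2 e0 F).
    exact: ho_refl.
  by apply: pmor_ext => u a; case: (F0 u a).
apply: ho_trans (ho_map_comp _ _) _; rewrite (_ : pmor_comp _ _ = pstruct2 e0 G).
  exact: ho_refl.
by apply: pmor_ext => u a; case: (G0 u a).
Qed.

Section Reach.
Context (R : realType) (n : nat) (M : set 'rV[R]_n).

Definition inv_reach (tau : \bar R) : R := if tau is t%:E then t^-1 else 0.

Lemma EfactorE (tau : \bar R) (r : R) :
  Efactor n tau r = (1 - inv_reach tau * (Jconst R n * r))^-1.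
Proof.
case: tau => [t| |] /=; rewrite ?mul0r ?subr0 ?invr1//.
by congr (1 - _)^-1; ring.
Qed.

Lemma reach_unique (x y : 'rV[R]_n) : (0 < reach M)%E -> M y ->
  inv_reach (reach M) * eucl x y < 1 -> exists! a, nearest M x a.
Proof.
move=> tau0 My h; have lt : ((eucl x y)%:E < reach M)%E.
  move: tau0 h; case: (reach M) => [t| |] //=; last by move=> _ _; exact: ltry.
  by rewrite lte_fin => t0; rewrite mulrC ltr_pdivrMr// mul1r lte_fin.
(* The reach is a supremum, so some admissible radius already exceeds the distance from [x] to
   [y]. *)
have [_ [t [t0 ht] <-] lt'] := ereal_sup_gt lt.
apply: ht; apply: le_lt_trans lt'; apply: ereal_inf_lbound.
by exists y.
Qed.

Lemma inv_reach_ge0 (tau : \bar R) : (0 < tau)%E -> 0 <= inv_reach tau.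
Proof. by case: tau => [t| |] //=; rewrite lte_fin invr_ge0 => /ltW. Qed.

Lemma inv_reach_mul_lt (tau : \bar R) (a c : R) : (0 < tau)%E -> 0 < c ->
  (a%:E < c%:E * tau)%E -> inv_reach tau * a < c.
Proof.
case: tau => [t| |] //=; last by rewrite mul0r.
by rewrite lte_fin -EFinM lte_fin => t0 _ h; rewrite mulrC ltr_pdivrMr.
Qed.

End Reach.

Lemma Jconst_bounds (R : realType) n : (1 <= n)%N ->
  1 / 2 <= Jconst R n /\ Jconst R n < 1.
Proof.
move=> n1; have J0 := Jconst_ge0 R n.
have n1' : 1 <= n%:R :> R by rewrite -[1]/(1%:R) ler_nat.
have J2 : Jconst R n ^+ 2 * (2 * (n%:R + 1)) = n%:R.
  by rewrite sqr_Jconst natr1 divfK// gt_eqF// mulr_gt0.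
have m0 : 0 < 2 * (n%:R + 1) :> R by lra.
move: J0 J2; set j := Jconst R n => j0 J2; split.
  rewrite leNgt; apply/negP => h; have j2 : j ^+ 2 < 1 / 4 by nra.
  by have := ltr_pM2r m0 (j ^+ 2) (1 / 4); rewrite j2; lra.
rewrite ltNge; apply/negP => h; have j2 : 1 <= j ^+ 2 by nra.
by have := ler_pM2r m0 1 (j ^+ 2); rewrite j2; lra.
Qed.

(* With [a = k J delta] and [b = k J emet], the left-hand side exceeds the first
   summand on the right by [J emet / ((1 - a - b) (1 - a))]. *)
Lemma shift_bound (R : realFieldType) (J k delta emet rho : R) :
  1 / 2 <= J -> J < 1 -> 0 <= k -> 0 <= delta -> 0 <= emet -> delta + emet <= rho ->
  k * (J * rho) < 1 - J ->
  (1 - k * (J * (delta + emet)))^-1 * J * (delta + emet) <=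
  (1 - k * (J * delta))^-1 * J * delta +
  (1 - k * (J * (rho / (1 - J))))^-1 * (2 * J / (1 - J)) * emet.
Proof.
move=> J2 J1 k0 d0 m0 dr kr.
set a := k * (J * delta); set b := k * (J * emet); set c := k * (J * rho) in kr *.
have J0 : 0 < J by lra.
have a0 : 0 <= a by rewrite mulr_ge0// mulr_ge0// ltW.
have b0 : 0 <= b by rewrite mulr_ge0// mulr_ge0// ltW.
have abc : a + b <= c.
  by rewrite /a /b /c -!mulrDr ler_wpM2l// ler_wpM2l// ltW.
have -> : k * (J * (delta + emet)) = a + b by rewrite /a /b; ring.
have -> : k * (J * (rho / (1 - J))) = c / (1 - J) by rewrite /c; ring.
have u0 : 0 < 1 - (a + b) by lra.
have v0 : 0 < 1 - a by lra.
have w0 : 0 < 1 - J - c by lra.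
have j0 : 0 < 1 - J by lra.
have e1 : (1 - (a + b))^-1 * J * (delta + emet) =
    (1 - a)^-1 * J * delta + J * emet / ((1 - (a + b)) * (1 - a)).
  have e2 : J * delta * b = a * (J * emet) by rewrite /a /b; ring.
  have e3 : J * (delta + emet) * (1 - a) = J * delta * (1 - (a + b)) + J * emet.
    by move: e2; rewrite mulrBr mulr1; lra.
  apply: (mulIf (x := (1 - (a + b)) * (1 - a))); first by rewrite mulf_neq0 ?gt_eqF.
  transitivity (J * (delta + emet) * (1 - a)).
    by field; rewrite gt_eqF.
  by rewrite e3; field; rewrite !gt_eqF.
rewrite e1 lerD2l.
have -> : (1 - c / (1 - J))^-1 * (2 * J / (1 - J)) * emet = J * emet * (2 / (1 - J - c)).
  by field; rewrite !gt_eqF.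
rewrite ler_wpM2l//; first by rewrite mulr_ge0// ltW.
rewrite ler_pdivlMr// mulrC ler_pdivrMr ?mulr_gt0//.
(* Both factors are at least [1 - c > 1 / 2], so twice their product is at least [1 - c], which
   exceeds [1 - J - c]. *)
have : 1 - c <= 1 - (a + b) by lra.
have : 1 - c <= 1 - a by lra.
have : 1 / 2 < 1 - c by lra.
nra.
Qed.

Theorem theorem8p23 (R : realType) (n N : nat) (hn : (1 <= n)%N)
  (M : set 'rV[R]_n) (hM : closed M)
  (f : M -> 'rV[R]_N) (Lf : R) (hLf0 : 0 <= Lf)
  (hLf : forall x y : M, `|f x - f y| <= Lf * eucl (set_val x) (set_val y))
  (delta rho emet efun : R)
  (hdelta0 : 0 < delta)
  (hdelta : (delta%:E <=
    ((1 - Jconst R n) / ((1 + Jconst R n) * Jconst R n))%:E * reach M)%E)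
  (hdeltarho : delta <= rho)
  (hrho : (rho%:E < ((1 - Jconst R n) / Jconst R n)%:E * reach M)%E)
  (hemet0 : 0 <= emet)
  (hemet1 : emet <= rho - delta)
  (hemet2 : emet <= (1 - Efactor n (reach M) rho * Jconst R n) /
                    (1 + Efactor n (reach M) rho * Jconst R n) * delta)
  (hefun0 : 0 <= efun)
  (X : metricType R) (g : X -> 'rV[R]_N)
  (C : set (X * M))
  (hC : correspondence mdist (fun x y : M => eucl (set_val x) (set_val y)) g f
          emet efun C) :
  interleaved
    (Efactor n (reach M) delta * Lf * Jconst R n * delta
     + Efactor n (reach M) (rho / (1 - Jconst R n)) * Lf * Lconst R n * emet
     + efun)
    (rips_pspace g delta)
    (sublevel_pspace f).
Proof.
have [J2 J1] := Jconst_bounds R hn; set J := Jconst R n in J1 J2 *.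
have J0 : 0 < J by lra.
set c1 := (1 - J) / J in hrho.
have c10 : 0 < c1 by rewrite divr_gt0// subr_gt0.
have tau0 : (0 < reach M)%E.
  have rho0 : 0 < rho by lra.
  move: hrho; case: (reach M) => [t| |] //=.
    by rewrite -EFinM !lte_fin => h; rewrite -(pmulr_rgt0 _ c10); lra.
  by rewrite muleC mulNyr gtr0_sg// mul1e.
set k := inv_reach (reach M); have k0 : 0 <= k := inv_reach_ge0 tau0.
(* Equivalently, the factor [E] at [rho] satisfies [E * J < 1]. *)
have krho : k * (J * rho) < 1 - J.
  have := inv_reach_mul_lt tau0 c10 hrho; rewrite -/k /c1 ltr_pdivlMr//; lra.
have drho : delta + emet <= rho by lra.
have kr : k * (J * (delta + emet)) < 1 - J.
  by apply: le_lt_trans krho; rewrite ler_wpM2l// ler_wpM2l// ltW.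
have kd : k * (J * delta) < 1 - J.
  by apply: le_lt_trans krho; rewrite ler_wpM2l// ler_wpM2l// ltW.
rewrite !EfactorE -/J -/k in hemet2 *.
set E := (1 - k * (J * rho))^-1 in hemet2.
have E0 : 0 < E by rewrite invr_gt0; lra.
set d := (1 - k * (J * (delta + emet)))^-1 * J * (delta + emet).
have dE : d <= E * J * (delta + emet).
  rewrite /d ler_wpM2r ?addr_ge0 ?(ltW hdelta0)// ler_wpM2r ?(ltW J0)//.
  rewrite lef_pV2 ?posrE; [|lra|lra].
  by rewrite lerD2l lerN2 ler_wpM2l// ler_wpM2l// ltW.
(* Multiplied out, the second bound on [emet] reads [E * J * (delta + emet) + emet <= delta]; as
   [delta + emet <= rho], the factor at [rho] dominates the one in [d]. *)
have d_emet : d + emet <= delta.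
  have EJ0 : 0 < E * J by rewrite mulr_gt0.
  have := hemet2; rewrite mulrAC ler_pdivlMr; last by lra.
  by move: dE; lra.
have sb := shift_bound J2 J1 k0 (ltW hdelta0) hemet0 drho krho.
set e := _ + _ + efun.
have e_ge : Lf * d + efun <= e.
  rewrite /e lerD2r; apply: le_trans (ler_wpM2l hLf0 sb) _.
  by rewrite /Lconst -/J; lra.
have [hCX hCM hCd hCf] := hC.
have d0 : 0 <= d.
  rewrite /d mulr_ge0 ?addr_ge0 ?(ltW hdelta0)// mulr_ge0 ?(ltW J0)// invr_ge0; lra.
(* If [M] is empty, the correspondence forces [X] to be empty, and a realization without vertices
   has no points since weights sum to 1. *)
have [[m0]|noM] := pselect (exists m : M, True); last first.
  apply: interleaved_empty => [|u w|u m].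
  - by apply: le_trans e_ge; rewrite addr_ge0// mulr_ge0.
  - have [pw _] := realization_prob (w : realization R (rips delta (sublevel g u))).
    have [a _] := fset0Pn _ (prob_supp_neq0 pw).
    by have [m _] := hCX a; apply: noM; exists m.
  - by apply: noM; exists (set_val (m : sublevel f u)).
move=> _.
have [y hy] := choice hCX; have [x hx] := choice hCM.
have dist a m a' m' : C (a, m) -> C (a', m') ->
    mdist a a' <= eucl (set_val m) (set_val m') + emet /\
    eucl (set_val m) (set_val m') <= mdist a a' + emet.
  by move=> h1 h2; have := hCd _ _ _ _ h1 h2; rewrite ler_norml => /andP[? ?]; split; lra.
apply: (@reconstruction R n N M m0 k delta emet efun e Lf f X g y x) => //.
- by move=> a b Mb; exact: reach_unique.
- by move=> a b; exact: (dist _ _ _ _ (hy a) (hy b)).2.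
- by move=> a b; exact: (dist _ _ _ _ (hx a) (hx b)).1.
- by move=> a b; exact: (dist _ _ _ _ (hy a) (hx b)).1.
- move=> a; have := (dist _ _ _ _ (hy (x a)) (hx a)).2.
  by rewrite mdistxx add0r.
- by move=> a; exact: hCf.
- by move=> a; exact: hCf.
Qed.
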